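(* For every $L>0$ there are constants $c_1,c_2,C_1>0$ depending only on $L$ such that the following holds. Let $X$ be a centered, strongly square integrable random variable with values in $\mathcal{H}$, with covariance operator $\Sigma$ having eigenvalues $\lambda_1\geq\lambda_2\geq\dots>0$ and orthonormal basis of eigenvectors $u_1,u_2,\dots$. Suppose that the Karhunen--Loève coefficients $\eta_j=\lambda_j^{-1/2}\langle X,u_j\rangle$, $j\geq 1$, are independent and satisfy $\sup_{j\geq 1}\sup_{q\geq 1}q^{-1/2}(\mathbb{E}|\eta_j|^q)^{1/q}\leq L$. Let $X_1,\dots,X_n$ be independent copies of $X$, and let $\hat P_{\leq d}$ be the empirical PCA projection of rank $d$. Let $1\leq d'\leq d$ be natural numbers such that $$\lambda_{d'}\geq 2\lambda_{d+1}\quad\text{and}\quad \max\Big(d',\ \lambda_{d'}^{-1}\sum_{k>d}\lambda_k\Big)\leq c_1 n.$$ Then, for all $1\leq t\leq c_2 n$, with probability at least $1-\exp(-t)$, $$R(\hat P_{\leq d})\leq \Big(1+C_1\Big(\frac{d'}{n}+\frac{t}{n}\Big)\Big)\min_{P\in\mathcal{P}_{d'}}R(P).$$ In particular, with probability at least $1-\exp(-c_2 n)$, $$R(\hat P_{\leq d})\leq \big(1+C_1(c_1+c_2)\big)\min_{P\in\mathcal{P}_{d'}}R(P).$$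
   Context: $\mathcal{H}$ is a real (separable, infinite-dimensional) Hilbert space with inner product $\langle\cdot,\cdot\rangle$ and norm $\|\cdot\|$. $X$ is an $\mathcal{H}$-valued random variable, centered ($\mathbb{E}X=0$) and strongly square integrable ($\mathbb{E}\|X\|^2<\infty$). For $u,v,x\in\mathcal{H}$, $(u\otimes v)x=\langle v,x\rangle u$. The covariance operator $\Sigma=\mathbb{E}\,X\otimes X$ has positive summable eigenvalues $\lambda_1\geq\lambda_2\geq\dots>0$ (with multiplicity) and corresponding eigenvectors $u_1,u_2,\dots$ assumed to form an orthonormal basis of $\mathcal{H}$, so $\Sigma=\sum_{j\geq1}\lambda_j\,u_j\otimes u_j$. $\mathcal{P}_d$ is the class of orthogonal projections on $\mathcal{H}$ of rank $d$. The reconstruction error of an orthogonal projection $P$ is $R(P)=\mathbb{E}\|X-PX\|^2=\mathrm{tr}(\Sigma(I-P))$, the expectation being over $X$ for fixed $P$; $R(\hat P)$ for a data-dependent $\hat P$ is the random variable obtained by plugging $\hat P$ into $R$, i.e. $\mathrm{tr}(\Sigma(I-\hat P))$. Given independent copies $X_1,\dots,X_n$ of $X$ ($n\geq 1$), the sample covariance is $\hat\Sigma=n^{-1}\sum_{i=1}^nX_i\otimes X_i$, with eigenvalues $\hat\lambda_1\geq\hat\lambda_2\geq\dots\geq0$ and an orthonormal basis of eigenvectors $\hat u_1,\hat u_2,\dots$. The empirical PCA projection is $\hat P_{\leq d}=\sum_{j\leq d}\hat u_j\otimes\hat u_j$, a minimizer over $\mathcal{P}_d$ of the empirical reconstruction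 error $R_n(P)=n^{-1}\sum_{i=1}^n\|X_i-PX_i\|^2$. *)

(* Defs.v *)
From HB Require Import structures.
From mathcomp Require Export all_boot all_order all_algebra.
From mathcomp Require Export finmap.
From mathcomp Require Export all_classical all_reals all_analysis.
From mathcomp Require Export measurable_realfun random_variable.

Set Implicit Arguments.
Unset Strict Implicit.
Unset Printing Implicit Defensive.

Export Order.TTheory GRing.Theory Num.Theory.
Export numFieldNormedType.Exports.

Local Open Scope classical_set_scope.
Local Open Scope ring_scope.

(* A real Hilbert space is a [completeNormedModType R] together with a
   symmetric positive definite form [ip : {dot H for idfun}] inducing the norm,
   [forall x, ip x x = `|x| ^+ 2].  Sequences indexed by 1, 2, 3, ... on paper
   are functions on [nat] here, so [lam j] is the (j+1)-st eigenvalue. *)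

Section Hilbert.
Variables (R : realType) (H : completeNormedModType R).
Variable ip : {dot H for idfun}.

Definition tensor (u v : H) : H -> H := fun x => ip v x *: u.

(* A Hilbert basis indexed by [nat]; its existence makes [H] separable and
   infinite-dimensional. *)
Definition orthonormal_basis (e : nat -> H) : Prop :=
  (forall i j, ip (e i) (e j) = (i == j)%:R) /\
  (forall x, series (fun j => ip (e j) x *: e j) @ \oo --> x).

Definition eigenbasis (S : H -> H) (lam : nat -> R) (e : nat -> H) : Prop :=
  [/\ nonincreasing_seq lam, orthonormal_basis e &
      forall j, S (e j) = lam j *: e j].

Definition has_rank (d : nat) (p : H -> H) : Prop :=
  exists b : 'I_d -> H,
    (forall a : 'I_d -> R, \sum_(i < d) a i *: b i = 0 -> forall i, a i = 0) /\
    range p = range (fun a : 'I_d -> R => \sum_(i < d) a i *: b i).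

Definition orthogonal_projection (p : H -> H) : Prop :=
  [/\ linear p, forall x, p (p x) = p x & forall x y, ip (p x) y = ip x (p y)].

Definition projections (d : nat) : set (H -> H) :=
  [set p | orthogonal_projection p /\ has_rank d p].

End Hilbert.

Definition borel (R : realType) (H : completeNormedModType R) :=
  g_sigma_algebraType (@open H).

Section Probability.
Variables (dT : measure_display) (T : measurableType dT) (R : realType).
Variable P : probability T R.

(* Mutual independence, over an arbitrary index type: the product rule for
   every finite subfamily. *)
Definition mutually_independent (I : choiceType) (dE : measure_display)
    (E : measurableType dE) (Y : I -> T -> E) : Prop :=
  forall (J : {fset I}) (B : I -> set E), (forall j, measurable (B j)) ->
    fine (P (\bigcap_(j in [set` J]) (Y j @^-1` B j))) =
    \prod_(j <- enum_fset J) fine (P (Y j @^-1` B j)).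

Definition same_law (dE : measure_display) (E : measurableType dE)
    (Y Z : T -> E) : Prop :=
  forall A : set E, measurable A -> P (Y @^-1` A) = P (Z @^-1` A).

Definition psi2_norm (f : T -> R) : \bar R :=
  ereal_sup [set ((q `^ (- 2^-1))%:E * 'N[P]_(q%:E)[EFin \o f])%E
            | q in [set q : R | 1 <= q]].

Variables (H : completeNormedModType R) (ip : {dot H for idfun}).

(* The expectation of a strongly integrable [H]-valued random variable: the
   vector representing the continuous functional [v |-> E <Y, v>]. *)
Definition is_expectation (Y : T -> H) (m : H) : Prop :=
  P.-integrable setT (fun w => (`|Y w|)%:E) /\
  forall v : H, 'E_P[fun w => ip (Y w) v : R]%E = (ip m v)%:E.

Definition is_covariance (X : T -> H) (Sigma : H -> H) : Prop :=
  forall v : H, is_expectation (fun w => tensor ip (X w) (X w) v) (Sigma v).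

(* For a data-dependent [p = Phat w'] the argument [p] is frozen: the
   expectation is over [X] only. *)
Definition reconstruction_error (X : T -> H) (p : H -> H) : \bar R :=
  'E_P[fun w => (`|X w - p (X w)| ^+ 2)%R]%E.

Definition KL_coefficient (X : T -> H) (lam : nat -> R) (u : nat -> H)
    (j : nat) : T -> R :=
  fun w => (Num.sqrt (lam j))^-1 * ip (X w) (u j).

Definition sample_covariance (n : nat) (Xs : 'I_n -> T -> H) (w : T) : H -> H :=
  fun x => n%:R^-1 *: \sum_(i < n) tensor ip (Xs i w) (Xs i w) x.

Definition pca_projection (d : nat) (uhat : nat -> T -> H) (w : T) : H -> H :=
  fun x => \sum_(j < d) tensor ip (uhat j w) (uhat j w) x.

End Probability.

Definition is_minimum (R : realType) (A : set (\bar R)) (m : \bar R) : Prop :=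
  A m /\ lbound A m.

(* Main.v *)
Require Import Defs.
From mathcomp Require Import ring lra.
Import Order.TTheory GRing.Theory Num.Theory.
Import numFieldNormedType.Exports.

(** The minimal risk of rank [d'] is the tail sum [m] of the eigenvalues of index
    at least [d'] (Ky Fan, [risk_minimum]), and the risk of the empirical
    projection [Phat] exceeds [m] at most by its residual on the head, the sum over
    [j < d'] of [lam j |u_j - Phat u_j|^2] ([risk_upper]). Expanded in the empirical
    eigenvectors, this residual is the sum over [l >= d] of [|z_l|^2], where [z_l]
    is the head of [uhat_l] scaled by the square root of the covariance.

    Testing the eigenvector equation of [uhat_l] against its head expresses the
    empirical quadratic form at [z_l], minus [lamhat_l] times the squared head, by
    the empirical covariance of head and tail. The quadratic form is at least
    [9/10 |z_l|^2], since the Gram matrix of the [d'] standardised coefficients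
    concentrates when [d' <= c1 n]. The eigenvalue term is at most
    [lamhat_d / lam_(d'-1) |z_l|^2], and [lamhat_d <= 121/200 lam_(d'-1)]
    ([lamhat_le]): the spectral gap gives the factor 1/2 up to the fluctuations of
    a block of [r] coordinates after [d], for [r] a small multiple of [n], and the
    coordinates beyond it have eigenvalues so small that the Gram matrix of the
    tails of the [n] observations is small in operator norm. Hence
    [|z_l|^2 <= 12 |kappa_l|^2 / n^2], and Bessel's inequality sums the [kappa_l]
    to the squared Hilbert--Schmidt norm of the covariance of head and tail
    ([head_excess]).

    Three probabilistic facts remain: the two Gram matrices ([gram_event]), the
    operator norm of the tails ([tail_event]) and the Hilbert--Schmidt norm of the
    covariance of head and tail ([cross_event]). The moment condition gives an
    exponential moment of the squares of the coefficients, hence a subgaussian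
    Laplace transform, hence, by writing the exponential of a square as a Gaussian
    average, an exponential moment of squares of arbitrary linear functionals
    ([linear_exp_sqr]). Bernstein's inequality and a net of the unit ball then
    control the operator norms. For the covariance of head and tail one conditions
    on the tail: given the tail, the [d'] head columns are independent and each
    contributes a quadratic form whose trace is the tail energy of the sample, of
    order [n m]; this yields the bound [(d' + t) n m] up to a constant and so an
    excess of order [m (d' + t) / n]. The infinitely many tail coordinates are
    reached by truncation and monotone limits of events. *)

Set Implicit Arguments.
Unset Strict Implicit.
Unset Printing Implicit Defensive.

Local Open Scope classical_set_scope.
Local Open Scope ring_scope.

(** * Inequalities for the exponential *)

Section ExpInequalities.
Variable R : realType.
Implicit Types x p : R.

(** From [expR (- x) >= 1 - x], hence [expR x <= (1 - x)^-1]. *)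
Lemma expR_le_quadratic x : x <= 2^-1 -> expR x <= 1 + x + 2 * x ^+ 2.
Proof.
move=> x2; have xN1 : 0 < 1 - x by lra.
have := expR_ge1Dx (- x); rewrite expRN => h.
apply: (@le_trans _ _ (1 - x)^-1).
  by rewrite -[expR x]invrK lef_pV2 // posrE invr_gt0 expR_gt0.
rewrite -[leLHS]mul1r ler_pdivrMr //.
have : 0 <= x ^+ 2 * (1 - 2 * x) by apply: mulr_ge0; [exact: sqr_ge0|lra].
nra.
Qed.

(** Valid for every real [x], with a first-order term that integrates to zero
    against a centered variable. *)
Lemma expR_le_id_sqr x : expR x <= x + expR (2 * x ^+ 2).
Proof.
have [x2|x2] := leP x 2^-1.
  have := expR_le_quadratic x2; have := expR_ge1Dx (2 * x ^+ 2); lra.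
have : expR x <= expR (2 * x ^+ 2) by rewrite ler_expR; nra.
lra.
Qed.

(** By convexity: the tangent at [p x] lies below the exponential at [x] and
    at [0]. *)
Lemma expR_interpolation p x : 0 <= p <= 1 ->
  expR (p * x) <= (1 - p) + p * expR x.
Proof.
move=> /andP[p0 p1]; set y := p * x.
have yx : expR x >= expR y * (1 + (x - y)).
  have -> : expR x = expR y * expR (x - y) by rewrite -expRD addrC subrK.
  by rewrite ler_pM2l ?expR_gt0 // expR_ge1Dx.
have y0 : expR y * (1 + - y) <= 1.
  have e : expR y * expR (- y) = 1 by rewrite -expRD subrr expR0.
  by rewrite -[leRHS]e ler_pM2l ?expR_gt0 // expR_ge1Dx.
have -> : expR y = p * (expR y * (1 + (x - y))) + (1 - p) * (expR y * (1 - y)).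
  by rewrite {3 5}/y; ring.
have := ler_wpM2l p0 yx; have p1' : 0 <= 1 - p by lra.
have := ler_wpM2l p1' y0; lra.
Qed.

Lemma expR_le_sqr_expR x : 0 <= x -> expR x <= 1 + x + x ^+ 2 * expR x.
Proof.
move=> x0; have := expR_ge1Dx (- x); rewrite expRN => h.
have e0 := expR_gt0 x.
have : expR x * (1 - x) <= 1.
  have e : expR x * (expR x)^-1 = 1 by rewrite mulfV // gt_eqF.
  by rewrite -[leRHS]e ler_pM2l.
nra.
Qed.

Lemma sqr_le_expR_half x : 0 <= x -> x ^+ 2 <= 16 * expR (x / 2).
Proof.
move=> x0; have h := expR_ge1Dx (x / 4).
have -> : x / 2 = x / 4 + x / 4 by lra.
rewrite expRD; nra.
Qed.

(** A single term of the exponential series; it plays the role of Stirling's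
    lower bound for the factorial. *)
Lemma expn_le_expR_fact (k : nat) :
  k%:R ^+ k <= expR k%:R * k`!%:R :> R.
Proof.
case: k => [|k]; first by rewrite expr0 fact0 expR0 mulr1.
have := @expR_ge1Dxn R k.+1%:R k (ler0n _ _) => h.
rewrite -ler_pdivrMr ?ltr0n ?fact_gt0 //; lra.
Qed.

End ExpInequalities.

(** * Series of nonnegative reals *)

Section Series.
Variable R : realType.
Implicit Types u : nat -> R.

Lemma eseries_EFin m u (l : R) :
  (fun n => \sum_(m <= k < n) u k) @ \oo --> l ->
  (\sum_(m <= k <oo) (u k)%:E = l%:E)%E.
Proof.
move=> ul; apply/cvg_lim => //.
rewrite (_ : (fun n => _) = EFin \o (fun n => \sum_(m <= k < n) u k)).
  by apply/fine_cvgP; split; [exact: nearW|].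
by apply/funext => n /=; rewrite sumEFin.
Qed.

Lemma eseries_le_partial m u (B : R) : (forall k, 0 <= u k) ->
  (forall n, \sum_(m <= k < n) u k <= B) ->
  (\sum_(m <= k <oo) (u k)%:E <= B%:E)%E.
Proof.
move=> u0 uB; apply: lime_le.
  by apply: is_cvg_nneseries => k _ _; rewrite lee_fin.
by apply: nearW => n; rewrite sumEFin lee_fin.
Qed.

Lemma eseries_ge_partial m u n : (forall k, 0 <= u k) ->
  ((\sum_(m <= k < n) u k)%:E <= \sum_(m <= k <oo) (u k)%:E)%E.
Proof.
move=> u0; rewrite -sumEFin; apply: nneseries_lim_ge => k _.
by rewrite lee_fin.
Qed.

Lemma expR_eseries (x : R) : (\sum_(k <oo) (exp_coeff x k)%:E = (expR x)%:E)%E.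
Proof. by apply: eseries_EFin; exact: is_cvg_series_exp_coeff. Qed.

End Series.

(** * Exponential moments of one variable *)

Section Expectation.
Variables (dT : measure_display) (T : measurableType dT) (R : realType).
Variables (P : probability T R).
Implicit Types f g : T -> R.

Lemma le_expectation f g : measurable_fun setT f -> measurable_fun setT g ->
  (forall w, 0 <= f w) -> (forall w, f w <= g w) ->
  (\int[P]_w (f w)%:E <= \int[P]_w (g w)%:E)%E.
Proof.
move=> mf mg f0 fg; apply: ge0_le_integral => //.
- by move=> w _; rewrite lee_fin.
- exact/measurable_EFinP.
- exact/measurable_EFinP.
- by move=> w _; rewrite lee_fin.
Qed.

Lemma expectation_affine (a b : R) f : 0 <= a -> 0 <= b ->
  measurable_fun setT f -> (forall w, 0 <= f w) ->
  (\int[P]_w (a + b * f w)%:E = a%:E + b%:E * \int[P]_w (f w)%:E)%E.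
Proof.
move=> a0 b0 mf f0; under eq_integral do rewrite EFinD.
rewrite ge0_integralD //; last 2 first.
- by move=> w _; rewrite lee_fin mulr_ge0.
- by apply/measurable_EFinP; exact: measurable_funM.
under [X in (_ + X)%E]eq_integral do rewrite EFinM.
rewrite ge0_integralZl //; last 2 first.
- exact/measurable_EFinP.
- by move=> w _; rewrite lee_fin.
by rewrite integral_cst //= probability_setT mule1.
Qed.

Lemma measurable_ge (g : T -> R) (s : R) : measurable_fun setT g ->
  measurable [set w | s <= g w].
Proof.
move=> mg; have -> : [set w | s <= g w] = g @^-1` `[s, +oo[.
  by apply/seteqP; split=> w /=; rewrite in_itv/= andbT.
by rewrite -[X in measurable X]setTI; exact: mg.
Qed.

Lemma exp_markov g (s : R) : measurable_fun setT g ->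
  (P [set w | s <= g w]%R <= (expR (- s))%:E * \int[P]_w (expR (g w))%:E)%E.
Proof.
move=> mg; have mA := measurable_ge s mg.
have me : measurable_fun setT (fun w => expR (g w)).
  exact: measurableT_comp.
rewrite -ge0_integralZl //; last exact/measurable_EFinP.
rewrite -(setIT [set w | _]) -integral_indic //.
under [leRHS]eq_integral do rewrite -EFinM.
apply: le_expectation => //.
- exact: measurable_funM.
- move=> w; rewrite indicE -expRD; case: (boolP (w \in _)); rewrite ?expR_ge0 //.
  by rewrite inE /= => sg; rewrite -expR0 ler_expR addrC subr_ge0.
Qed.

(** Since [k ^ k <= exp k * k!], the term of order [k] in the power series of
    [exp (a f^2)] has expectation at most [(2 a L^2 e) ^ k], and the condition on
    [a] makes this at most [2 ^- k]. *)
Lemma expectation_exp_sqr (L a : R) f : measurable_fun setT f ->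
  0 < L -> 0 <= a -> 4 * (a * L ^+ 2) * expR 1 <= 1 ->
  (forall k : nat, (0 < k)%N ->
     (\int[P]_w (f w ^+ k.*2)%:E <= ((2 * L ^+ 2 * k%:R) ^+ k)%:E)%E) ->
  (\int[P]_w (expR (a * f w ^+ 2))%:E <= 2%:E)%E.
Proof.
move=> mf L0 a0 aL mom.
pose F k w := (exp_coeff (a * f w ^+ 2) k)%:E.
have af0 w : 0 <= a * f w ^+ 2 by rewrite mulr_ge0 // sqr_ge0.
have F0 k w : (0 <= F k w)%E by rewrite lee_fin exp_coeff_ge0.
have mF k : measurable_fun setT (F k).
  apply/measurable_EFinP; rewrite /exp_coeff /=; apply: measurable_funM => //.
  by apply: measurable_funX; apply: measurable_funM => //; exact: measurable_funX.
rewrite (_ : (fun w => _) = fun w => (\sum_(k <oo) F k w)%E); last first.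
  by apply/funext => w; rewrite /F expR_eseries.
rewrite integral_nneseries //.
apply: (@le_trans _ _ (\sum_(0 <= k <oo) ((2^-1) ^+ k)%:E)%E); last first.
  rewrite (@eseries_EFin _ _ _ 2) //.
  have := @cvg_geometric_series R 1 2^-1; rewrite /series /geometric /=.
  rewrite (_ : (fun n => _) = (fun n => \sum_(0 <= k < n) 2^-1 ^+ k)).
    have e : 1 * (1 - 2^-1)^-1 = 2 :> R by field.
    by rewrite e; apply; rewrite ger0_norm //; lra.
  by apply/funext => n; apply: eq_bigr => k _; rewrite mul1r.
apply: lee_nneseries => k *; first exact: integral_ge0.
case: k => [|k].
  under eq_integral do rewrite /F /exp_coeff /= expr0 fact0 divr1.
  by rewrite integral_cst //= probability_setT mule1 expr0.
under eq_integral do rewrite /F /exp_coeff /= exprMn -exprM mul2n mulrAC EFinM.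
rewrite ge0_integralZl //; last 3 first.
- apply/measurable_EFinP; exact: measurable_funX.
- by move=> w _; rewrite lee_fin exprn_even_ge0 //= odd_double.
- by rewrite lee_fin divr_ge0 // exprn_ge0.
apply: (le_trans (lee_wpmul2l _ (mom k.+1 isT))).
  by rewrite lee_fin divr_ge0 // exprn_ge0.
rewrite -EFinM lee_fin mulrAC -exprMn.
rewrite (_ : a * _ = (2 * (a * L ^+ 2)) * k.+1%:R); last by ring.
rewrite exprMn ler_pdivrMr ?ltr0n ?fact_gt0 //.
apply: (@le_trans _ _ ((2 * (a * L ^+ 2)) ^+ k.+1 * (expR k.+1%:R * k.+1`!%:R))).
  apply: ler_wpM2l; last exact: expn_le_expR_fact.
  by rewrite exprn_ge0 // !mulr_ge0 // ltW.
rewrite mulrA ler_wpM2r //.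
rewrite -[k.+1%:R]mulr1 expRM_natl -exprMn lerXn2r ?nnegrE ?invr_ge0 //.
  by rewrite !mulr_ge0 ?expR_ge0 // ltW.
lra.
Qed.

(** Convexity turns one exponential moment into bounds that improve linearly as
    the exponent shrinks, because [(1 - p) + 2 p <= exp p]. *)
Lemma expectation_exp_interpolation (p : R) f : measurable_fun setT f ->
  0 <= p <= 1 -> (\int[P]_w (expR (f w))%:E <= 2%:E)%E ->
  (\int[P]_w (expR (p * f w))%:E <= (expR p)%:E)%E.
Proof.
move=> mf p01 f2; have /andP[p0 p1] := p01.
have me : measurable_fun setT (fun w => expR (f w)) by exact: measurableT_comp.
apply: (@le_trans _ _ (\int[P]_w (1 - p + p * expR (f w))%:E)%E).
  apply: le_expectation => [|||w].
  - by apply: measurableT_comp => //; exact: measurable_funM.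
  - by apply: measurable_funD => //; exact: measurable_funM.
  - by move=> w; exact: expR_ge0.
  - exact: expR_interpolation.
rewrite expectation_affine ?subr_ge0 //.
apply: (@le_trans _ _ ((1 - p)%:E + p%:E * 2%:E)%E).
  by rewrite leeD2l // lee_wpmul2l.
rewrite -EFinM -EFinD lee_fin; have := expR_ge1Dx p; lra.
Qed.

(** For small [s] the centering removes the linear term of [expR_le_id_sqr]; for
    large [s] one splits [s f <= s^2 / (2 a) + a f^2 / 2], and the remaining
    constant is absorbed by [s^2]. *)
Lemma subgaussian_mgf (a s : R) f : measurable_fun setT f -> 0 < a ->
  (\int[P]_w (expR (a * f w ^+ 2))%:E <= 2%:E)%E ->
  P.-integrable setT (EFin \o f) -> (\int[P]_w (f w)%:E = 0)%E ->
  (\int[P]_w (expR (s * f w))%:E <= (expR (2 / a * s ^+ 2))%:E)%E.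
Proof.
move=> mf a0 f2 intf f0.
have a0' : 0 <= a by exact: ltW.
have aN0 : a != 0 by rewrite gt_eqF.
have mY : measurable_fun setT (fun w => a * f w ^+ 2).
  by apply: measurable_funM => //; exact: measurable_funX.
have me : measurable_fun setT (fun w => expR (s * f w)).
  by apply: measurableT_comp => //; exact: measurable_funM.
have s20 : 0 <= s ^+ 2 / a by rewrite divr_ge0 // sqr_ge0.
have [small|large] := leP (2 * s ^+ 2) a.
  have p01 : 0 <= 2 * s ^+ 2 / a <= 1.
    by rewrite ler_pdivrMr // mul1r small andbT divr_ge0 // mulr_ge0 // sqr_ge0.
  have := expectation_exp_interpolation mY p01 f2.
  rewrite (_ : 2 / a * s ^+ 2 = 2 * s ^+ 2 / a); last by ring.
  apply: le_trans.
  have mg : measurable_fun setT (fun w => expR (2 * s ^+ 2 / a * (a * f w ^+ 2))).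
    by apply: measurableT_comp => //; exact: measurable_funM.
  have intsf : P.-integrable setT (fun w => (s * f w)%:E).
    by under eq_fun do rewrite EFinM; exact: integrableZl.
  have [fin|] := boolP (\int[P]_w (expR (2 * s ^+ 2 / a * (a * f w ^+ 2)))%:E
                        < +oo)%E; last by rewrite -leNgt leye_eq => /eqP ->; rewrite leey.
  have intg : P.-integrable setT
      (fun w => (expR (2 * s ^+ 2 / a * (a * f w ^+ 2)))%:E).
    apply/integrableP; split; first exact/measurable_EFinP.
    by under eq_integral do rewrite gee0_abs ?lee_fin ?expR_ge0 //.
  apply: (@le_trans _ _ (\int[P]_w ((s * f w)%:E +
      (expR (2 * s ^+ 2 / a * (a * f w ^+ 2)))%:E))%E).
    under [leRHS]eq_integral do rewrite -EFinD.
    apply: le_expectation => //.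
    - by apply: measurable_funD => //; exact: measurable_funM.
    - move=> w; have := expR_le_id_sqr (s * f w).
      by rewrite (_ : 2 * s ^+ 2 / a * _ = 2 * (s * f w) ^+ 2) //; field; exact: aN0.
  rewrite integralD //.
  under eq_integral do rewrite EFinM.
  by rewrite integralZl // f0 mule0 add0e.
have p01 : 0 <= (2^-1 : R) <= 1 by lra.
have f2' := expectation_exp_interpolation mY p01 f2.
apply: (@le_trans _ _ ((expR (s ^+ 2 / a / 2))%:E *
    \int[P]_w (expR (2^-1 * (a * f w ^+ 2)))%:E)%E).
  have mg : measurable_fun setT (fun w => expR (2^-1 * (a * f w ^+ 2))).
    by apply: measurableT_comp => //; exact: measurable_funM.
  rewrite -ge0_integralZl //; last exact/measurable_EFinP.
  under [leRHS]eq_integral do rewrite -EFinM.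
  apply: le_expectation => //.
  - exact: measurable_funM.
  move=> w; rewrite -expRD ler_expR.
  have : 0 <= (s - a * f w) ^+ 2 / (2 * a) by rewrite divr_ge0 ?sqr_ge0 // mulr_ge0.
  rewrite (_ : (s - a * f w) ^+ 2 / (2 * a) =
     s ^+ 2 / a / 2 + 2^-1 * (a * f w ^+ 2) - s * f w); first by lra.
  by field; exact: aN0.
apply: (le_trans (lee_wpmul2l _ f2')); first by rewrite lee_fin expR_ge0.
rewrite -EFinM -expRD lee_fin ler_expR.
have : 2^-1 <= s ^+ 2 / a by rewrite ler_pdivlMr //; lra.
rewrite (_ : 2 / a * s ^+ 2 = 2 * (s ^+ 2 / a)); [lra|by ring].
Qed.

End Expectation.

(** * Gaussian linearisation *)

Section Gaussian.
Variable R : realType.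
Local Notation mu := (@lebesgue_measure R).

(** Completing the square: up to a factor, [exp (c g)] shifts the mean of the
    normal density to [c]. *)
Lemma gaussian_mgf (c : R) :
  (\int[mu]_g (expR (c * g) * normal_pdf 0 1 g)%:E = (expR (c ^+ 2 / 2))%:E)%E.
Proof.
rewrite (_ : (fun g => _) =
    fun g => ((expR (c ^+ 2 / 2))%:E * (normal_pdf c 1 g)%:E)%E); last first.
  apply/funext => g; rewrite -EFinM; congr EFin.
  rewrite !normal_pdfE ?oner_neq0 // mulrCA [RHS]mulrCA; congr (_ * _).
  by rewrite /normal_fun -!expRD; congr expR; field.
rewrite ge0_integralZl ?integral_normal_pdf ?mule1 //.
- by apply/measurable_EFinP; exact: measurable_normal_pdf.
- by move=> x _; rewrite lee_fin normal_pdf_ge0.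
Qed.

(** The weight [exp (3 g^2 / 8)] turns the normal density of variance 1 into
    twice the one of variance 4. *)
Lemma gaussian_exp_sqr :
  (\int[mu]_g (expR (3 / 8 * g ^+ 2) * normal_pdf 0 1 g)%:E = 2%:E)%E.
Proof.
rewrite (_ : (fun g => _) = fun g => (2%:E * (normal_pdf 0 2 g)%:E)%E); last first.
  apply/funext => g; rewrite -EFinM; congr EFin.
  rewrite !normal_pdfE ?oner_neq0 // mulrCA [RHS]mulrA; congr (_ * _).
    rewrite /normal_peak.
    have -> : 2 ^+ 2 * pi *+ 2 = 2 ^+ 2 * (1 ^+ 2 * pi *+ 2) :> R by ring.
    rewrite sqrtrM ?sqr_ge0 // sqrtr_sqr ger0_norm // invfM mulrA.
    by rewrite divff // mul1r.
  by rewrite /normal_fun -!expRD; congr expR; field.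
rewrite ge0_integralZl ?integral_normal_pdf ?mule1 //.
- by apply/measurable_EFinP; exact: measurable_normal_pdf.
- by move=> x _; rewrite lee_fin normal_pdf_ge0.
Qed.

End Gaussian.

Section ExponentialSquare.
Variables (dT : measure_display) (T : measurableType dT) (R : realType).
Variables (P : probability T R).
Implicit Types f g : T -> R.
Local Notation mu := (@lebesgue_measure R).

(** Writing [exp (theta y^2)] as a Gaussian average of [exp (c g y)] turns a
    bound on the Laplace transform into one on the exponential of the square.
    The rate [3 / (16 K)] leaves exactly the integral of [gaussian_exp_sqr]. *)
Lemma expectation_exp_sqr_of_mgf (K : R) f : measurable_fun setT f -> 0 < K ->
  (forall s, (\int[P]_w (expR (s * f w))%:E <= (expR (K * s ^+ 2))%:E)%E) ->
  (\int[P]_w (expR (3 / (16 * K) * f w ^+ 2))%:E <= 2%:E)%E.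
Proof.
move=> mf K0 mgf.
pose theta := 3 / (16 * K); pose c := Num.sqrt (2 * theta).
have c2 : c ^+ 2 = 2 * theta.
  by rewrite sqr_sqrtr // /theta mulr_ge0 // divr_ge0 // mulr_ge0 // ltW.
pose F (z : T * R) := (expR (c * f z.1 * z.2) * normal_pdf 0 1 z.2)%:E.
have F0 z : (0 <= F z)%E by rewrite lee_fin mulr_ge0 ?expR_ge0 ?normal_pdf_ge0.
have mF : measurable_fun setT F.
  apply/measurable_EFinP; apply: measurable_funM; last first.
    by apply: measurableT_comp; [exact: measurable_normal_pdf|exact: measurable_snd].
  apply: measurableT_comp => //; apply: measurable_funM; last exact: measurable_snd.
  apply: measurable_funM => //; exact: (measurableT_comp mf measurable_fst).
rewrite (_ : (\int[P]_w _)%E = (\int[P]_w \int[mu]_g F (w, g))%E); last first.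
  apply: eq_integral => w _; rewrite /F /= gaussian_mgf; congr (expR _)%:E.
  by rewrite exprMn c2 /theta; field; rewrite gt_eqF.
rewrite (@fubini_tonelli _ _ _ _ _ P mu) //.
have mphi : measurable_fun setT
    (fun g : R => expR (3 / 8 * g ^+ 2) * normal_pdf 0 1 g).
  apply: measurable_funM; last exact: measurable_normal_pdf.
  by apply: measurableT_comp => //; apply: measurable_funM.
rewrite -(@gaussian_exp_sqr R); apply: ge0_le_integral => //.
- by move=> g _; exact: integral_ge0.
- by have := @measurable_fun_fubini_tonelli_G _ _ _ _ _ P F mF F0.
- by apply/measurable_EFinP; exact: mphi.
move=> g _; rewrite /F /=.
under eq_integral do rewrite EFinM.
rewrite ge0_integralZr //; last 2 first.
- apply/measurable_EFinP; apply: measurableT_comp => //.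
  by apply: measurable_funM => //; exact: measurable_funM.
- by rewrite lee_fin normal_pdf_ge0.
rewrite EFinM lee_wpmul2r ?lee_fin ?normal_pdf_ge0 //.
under eq_integral do rewrite mulrAC.
apply: (le_trans (mgf _)); rewrite lee_fin ler_expR exprMn c2 /theta.
by rewrite le_eqVlt; apply/orP; left; apply/eqP; field; rewrite gt_eqF.
Qed.

Lemma psi2_moment (L : R) f (k : nat) : measurable_fun setT f ->
  (psi2_norm P f <= L%:E)%E -> (0 < k)%N -> 0 < L ->
  (\int[P]_w (f w ^+ k.*2)%:E <= ((2 * L ^+ 2 * k%:R) ^+ k)%:E)%E.
Proof.
move=> mf fL k0 L0; pose q : R := k.*2%:R.
have q1 : 1 <= q by rewrite ler1n double_gt0.
have q0 : 0 < q by lra.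
have qN0 : q != 0 by rewrite gt_eqF.
have : ((q `^ (- 2^-1))%:E * 'N[P]_(q%:E)[EFin \o f] <= L%:E)%E.
  apply: le_trans fL; apply: ereal_sup_ubound; exists q => //.
have N0 := Lnorm_ge0 P q%:E (EFin \o f).
move=> h.
have : ('N[P]_(q%:E)[EFin \o f] `^ q <= (L * q `^ (2^-1))%:E `^ q)%E.
  apply: gt0_ler_poweR; first exact: ltW.
  - by rewrite in_itv/= N0 /= leey.
  - by rewrite in_itv/= leey andbT lee_fin mulr_ge0 ?powR_ge0 // ltW.
  have := lee_wpmul2l _ h => /(_ (q `^ 2^-1)%:E).
  rewrite lee_fin powR_ge0 => /(_ isT).
  rewrite muleA -EFinM -powRD ?qN0 ?implybT // subrr powRr0 mul1e -EFinM.
  by rewrite mulrC.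
rewrite poweR_Lnorm // poweR_EFin powRM ?powR_ge0 ?(ltW L0) //.
rewrite -powRrM powR_mulrn ?(ltW L0) //.
rewrite (_ : 2^-1 * q = k%:R); last by rewrite /q -mul2n natrM; field.
rewrite powR_mulrn ?(ltW q0) // /q -mul2n exprM -exprMn.
rewrite (_ : L ^+ 2 * _ = 2 * L ^+ 2 * k%:R); last by rewrite natrM; ring.
apply: le_trans; rewrite le_eqVlt; apply/orP; left; apply/eqP.
apply: eq_integral => w _; rewrite /= powR_mulrn //.
by rewrite !exprM real_normK ?num_real.
Qed.

End ExponentialSquare.

(** * Independence and decoupling *)

Section Rectangles.
Variables (R : realType) (I : finType).

Definition rectangles : set (set (I -> R)) :=
  [set A | exists2 B : I -> set R, (forall i, measurable (B i)) &
           A = [set x | forall i, B i (x i)]].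

(** The sigma-algebra is generated by rectangles, which are stable under
    intersection, so that a probability on [vec] is determined by its values on
    rectangles. *)
Definition vec := g_sigma_algebraType rectangles.

Lemma rectangles_setI : setI_closed rectangles.
Proof.
move=> _ _ [B mB ->] [C mC ->]; exists (fun i => B i `&` C i).
  by move=> i; exact: measurableI.
by apply/seteqP; split=> [x [Bx Cx] i|x BCx]; [|split=> i; case: (BCx i)].
Qed.

Lemma rectanglesT : rectangles setT.
Proof. by exists (fun=> setT) => //; apply/seteqP; split. Qed.

Lemma measurable_coord (i : I) : measurable_fun setT (fun x : vec => x i).
Proof.
move=> _ B mB; rewrite setTI; apply: sub_sigma_algebra.
exists (fun j => if j == i then B else setT); first by move=> j; case: ifP.
apply/seteqP; split=> [x Bx j|x /(_ i)]; last by rewrite eqxx.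
by case: eqP => // ->.
Qed.

Lemma measurable_to_vec d (T : measurableType d) (f : T -> vec) :
  (forall i, measurable_fun setT (fun w => f w i)) -> measurable_fun setT f.
Proof.
move=> mf; apply: (@measurability _ _ T vec setT f rectangles) => // _ [_ [B mB ->] <-].
rewrite setTI (_ : _ @^-1` _ = \bigcap_(i in setT) ((f ^~ i) @^-1` B i)).
  apply: fin_bigcap_measurable => // i _; rewrite -[_ @^-1` _]setTI.
  exact: mf.
by apply/seteqP; split=> x /= => [H i _|H i]; exact: H.
Qed.

End Rectangles.

Section Independent.
Variables (dT : measure_display) (T : measurableType dT) (R : realType).
Variables (P : probability T R) (I : finType) (xi : I -> T -> R).

(** The product rule over all of the finite index type is enough: subfamilies
    are obtained by taking the other sets equal to [setT]. *)
Definition independent_family :=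
  forall B : I -> set R, (forall i, measurable (B i)) ->
    P [set w | forall i, B i (xi i w)] =
    (\prod_i fine (P (xi i @^-1` B i)))%:E.

Hypothesis mxi : forall i, measurable_fun setT (xi i).
Hypothesis ind : independent_family.

Let join : T -> vec R I := fun w i => xi i w.
Let mix (J : pred I) : T * T -> vec R I :=
  fun z i => if J i then xi i z.2 else xi i z.1.

Let mjoin : measurable_fun setT join.
Proof. exact: measurable_to_vec. Qed.

Let mmix J : measurable_fun setT (mix J).
Proof.
apply: measurable_to_vec => i; rewrite /mix; case: (J i).
  by apply: measurableT_comp => //; exact: measurable_snd.
by apply: measurableT_comp => //; exact: measurable_fst.
Qed.

Lemma measurable_decoupled (J : pred I) (F : vec R I -> \bar R) :
  measurable_fun setT F -> (forall x, 0 <= F x)%E ->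
  measurable_fun setT (fun w' =>
    \int[P]_w F (fun i => if J i then xi i w else xi i w'))%E.
Proof.
move=> mF F0.
have mFm : measurable_fun setT (F \o mix J) by exact: measurableT_comp.
exact: (@measurable_fun_fubini_tonelli_F _ _ _ _ _ P _ mFm (fun z => F0 _)).
Qed.

(** The coordinates in [J] may be drawn from an independent copy of the sample
    space, because the two laws on [vec] agree on rectangles. Conditioning on the
    coordinates outside [J] thereby becomes an iterated integral. *)
Lemma decoupling (J : pred I) (F : vec R I -> \bar R) :
  measurable_fun setT F -> (forall x, 0 <= F x)%E ->
  (\int[P]_w F (fun i => xi i w) =
   \int[P]_w' \int[P]_w F (fun i => if J i then xi i w else xi i w'))%E.
Proof.
move=> mF F0.
pose Q : {measure set (T * T)%type -> \bar R} := (P \x P)%E.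
pose m1_ : {measure set vec R I -> \bar R} := pushforward P join.
pose m2_ : {measure set vec R I -> \bar R} := pushforward Q (mix J).
pose m1 := m1_ mjoin; pose m2 := m2_ (mmix J).
transitivity (\int[m1]_x F x)%E.
  by rewrite /m1 ge0_integral_pushforward.
transitivity (\int[m2]_x F x)%E; last first.
  rewrite /m2 ge0_integral_pushforward// preimage_setT /Q.
  rewrite (@fubini_tonelli1 _ _ _ _ _ P P (F \o mix J)) //.
    exact: measurableT_comp.
  by move=> z; exact: F0.
apply: eq_measure_integral => A mA _.
apply: (@measure_unique _ R (vec R I) (@rectangles R I) (fun=> setT)) => //.
- exact: rectangles_setI.
- by move=> _; exact: rectanglesT.
- by apply/seteqP; split=> // x _; exists 0%N.
- move=> _ [B mB ->].
  pose B1 i := if J i then setT else B i.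
  pose B2 i := if J i then B i else setT.
  have mB1 i : measurable (B1 i) by rewrite /B1; case: (J i).
  have mB2 i : measurable (B2 i) by rewrite /B2; case: (J i).
  have mrect (C : I -> set R) : (forall i, measurable (C i)) ->
      measurable [set w | forall i, C i (xi i w)].
    move=> mC; rewrite (_ : [set _ | _] =
        join @^-1` [set x | forall i, C i (x i)]) //.
    rewrite -[_ @^-1` _]setTI; apply: mjoin => //.
    by apply: sub_sigma_algebra; exists C.
  rewrite /m1 /m2 /pushforward.
  transitivity (P [set w | forall i, B i (xi i w)]); first by [].
  transitivity ((P \x P)%E ([set w | forall i, B1 i (xi i w)] `*`
                   [set w | forall i, B2 i (xi i w)])); last first.
    congr ((P \x P)%E _); apply/seteqP; split=> -[x y] /=.
      case=> H1 H2 i; move: (H1 i) (H2 i); rewrite /B1 /B2 /mix /=.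
      by case: (J i).
    move=> H; split=> i; move: (H i); rewrite /B1 /B2 /mix /=; by case: (J i).
  transitivity (P [set w | forall i, B1 i (xi i w)] *
                P [set w | forall i, B2 i (xi i w)])%E; last first.
    by rewrite product_measure1E //; exact: mrect.
  rewrite ind // (ind mB1) (ind mB2) -EFinM -big_split /=; congr EFin; apply: eq_bigr => i _.
  have ET : fine (P (xi i @^-1` setT)) = 1.
    by rewrite preimage_setT probability_setT.
  by rewrite /B1 /B2; case: (J i); rewrite ET ?mul1r ?mulr1.
- by move=> _; rewrite (_ : m1 _ = P setT) // probability_setT ltry.
Qed.

(** The product rule for functions of disjoint groups of coordinates, where [g]
    labels the group of each coordinate: decoupling one group takes its factor
    out of the integral. *)
Lemma expectation_prod_groups (G : finType) (g : I -> G)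
    (F : G -> vec R I -> R) :
  (forall l, measurable_fun setT (F l)) -> (forall l x, 0 <= F l x) ->
  (forall l x y, (forall i, g i = l -> x i = y i) -> F l x = F l y) ->
  (\int[P]_w (\prod_l F l (fun i => xi i w))%:E =
   \prod_l \int[P]_w (F l (fun i => xi i w))%:E)%E.
Proof.
move=> mF F0 dF.
pose E l := (\int[P]_w (F l (fun i => xi i w))%:E)%E.
have E0 l : (0 <= E l)%E by apply: integral_ge0 => w _; rewrite lee_fin.
have mFx l : measurable_fun setT (fun w => F l (fun i => xi i w)).
  exact: (@measurableT_comp _ _ _ _ _ _ (F l) _ join).
suff H (s : seq G) : uniq s ->
    (\int[P]_w (\prod_(l <- s) F l (fun i => xi i w))%:E =
     \prod_(l <- s) E l)%E.
  by rewrite H // index_enum_uniq.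
elim: s => [_|l s IH /= /andP[ls us]].
  under eq_integral do rewrite big_nil.
  by rewrite big_nil integral_cst // mul1e; exact: probability_setT.
have mG : measurable_fun setT
    (fun x : vec R I => (\prod_(l' <- l :: s) F l' x)%:E).
  apply/measurable_EFinP; apply: measurable_prod => l' _; exact: mF.
transitivity (\int[P]_w (\prod_(l' <- l :: s) F l' (fun i => xi i w))%:E)%E.
  by [].
rewrite (decoupling (fun i => g i == l) mG); last first.
  by move=> x; rewrite lee_fin; apply: prodr_ge0 => l' _.
under eq_integral => w' _.
  under eq_integral => w _.
    rewrite big_cons EFinM.
    rewrite (dF l _ (fun i => xi i w)); last by move=> i ->; rewrite eqxx.
    rewrite (_ : \prod_(l' <- s) _ = \prod_(l' <- s) F l' (fun i => xi i w'));
      last first.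
      rewrite big_seq [RHS]big_seq; apply: eq_bigr => l' l's.
      apply: dF => i gi; case: eqP => // gl; move: ls.
      by rewrite -gl gi l's.
    over.
  rewrite ge0_integralZr //; last 3 first.
    exact/measurable_EFinP.
    by move=> w _; rewrite lee_fin.
    by rewrite lee_fin; apply: prodr_ge0 => l' _.
  over.
rewrite ge0_integralZl //; last 3 first.
- apply/measurable_EFinP; apply: measurable_prod => l' _; exact: mFx.
- by move=> w _; rewrite lee_fin; apply: prodr_ge0 => l' _.
- exact: E0.
by rewrite IH // big_cons.
Qed.

End Independent.

(** * Nets for quadratic forms *)

Section QuadraticForms.
Variables (R : realType) (S : finType).
Implicit Types (v w x y : S -> R) (q : (S -> R) -> R).

Definition sqnorm v := \sum_s v s ^+ 2.

Lemma sqnorm_ge0 v : 0 <= sqnorm v.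
Proof. by apply: sumr_ge0 => s _; exact: sqr_ge0. Qed.

Lemma sqnormZ (c : R) v : sqnorm (fun s => c * v s) = c ^+ 2 * sqnorm v.
Proof. by rewrite /sqnorm mulr_sumr; apply: eq_bigr => s _; rewrite exprMn. Qed.

Lemma sqnorm_eq0 v : sqnorm v = 0 -> forall s, v s = 0.
Proof.
move=> /eqP; rewrite psumr_eq0 => [|s _]; last exact: sqr_ge0.
by move=> /allP h s; apply/eqP; rewrite -sqrf_eq0; apply: h; rewrite mem_index_enum.
Qed.

Definition quadratic q := exists A : S -> S -> R,
  forall v, q v = \sum_s \sum_t v s * A s t * v t.

Lemma quadratic_sqr (a : S -> R) : quadratic (fun v => (\sum_s a s * v s) ^+ 2).
Proof.
exists (fun s t => a s * a t) => v; rewrite expr2 mulr_suml; apply: eq_bigr => s _.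
by rewrite mulr_sumr; apply: eq_bigr => t _; ring.
Qed.

Lemma quadratic_sqnorm : quadratic sqnorm.
Proof.
exists (fun s t => (s == t)%:R) => v; apply: eq_bigr => s _.
rewrite (bigD1 s) //= eqxx mulr1 big1 ?addr0 // => t ts.
by rewrite eq_sym (negbTE ts) mulr0 mul0r.
Qed.

Lemma quadraticD q1 q2 : quadratic q1 -> quadratic q2 ->
  quadratic (fun v => q1 v + q2 v).
Proof.
move=> [A hA] [B hB]; exists (fun s t => A s t + B s t) => v.
rewrite hA hB -big_split; apply: eq_bigr => s _ /=.
by rewrite -big_split; apply: eq_bigr => t _ /=; ring.
Qed.

Lemma quadraticZ (c : R) q : quadratic q -> quadratic (fun v => c * q v).
Proof.
move=> [A hA]; exists (fun s t => c * A s t) => v.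
rewrite hA mulr_sumr; apply: eq_bigr => s _.
by rewrite mulr_sumr; apply: eq_bigr => t _; ring.
Qed.

Lemma quadratic_sum (I : Type) (r : seq I) (Q : I -> (S -> R) -> R) :
  (forall i, quadratic (Q i)) -> quadratic (fun v => \sum_(i <- r) Q i v).
Proof.
move=> hQ; elim: r => [|i r IH].
  exists (fun _ _ => 0) => v; rewrite big_nil big1 // => s _.
  by rewrite big1 // => t _; rewrite mulr0 mul0r.
have [A hA] := quadraticD (hQ i) IH.
by exists A => v; rewrite big_cons hA.
Qed.

Lemma quadratic_hom q (c : R) v : quadratic q ->
  q (fun s => c * v s) = c ^+ 2 * q v.
Proof.
move=> [A hA]; rewrite !hA mulr_sumr; apply: eq_bigr => s _.
by rewrite mulr_sumr; apply: eq_bigr => t _; ring.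
Qed.

(** Polarisation, with weights 4 and 1/2 that give both arguments length of order
    one when [v] and [w] lie in the unit ball at distance 1/4. *)
Lemma quadratic_polar q v w : quadratic q -> q v - q w =
  8^-1 * (q (fun s => 4 * (v s - w s) + (v s + w s) / 2) -
          q (fun s => 4 * (v s - w s) - (v s + w s) / 2)).
Proof.
move=> [A hA]; rewrite !hA -!sumrB mulr_sumr; apply: eq_bigr => s _.
by rewrite -!sumrB mulr_sumr; apply: eq_bigr => t _; field.
Qed.

Lemma quadratic_bounded q : quadratic q ->
  exists M, forall v, sqnorm v <= 1 -> `|q v| <= M.
Proof.
move=> [A hA]; exists (\sum_s \sum_t `|A s t|) => v v1.
have v1' s : `|v s| <= 1.
  rewrite -(@expr_le1 _ 2) // real_normK ?num_real //.
  apply: le_trans v1; rewrite /sqnorm (bigD1 s) //= lerDl.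
  by apply: sumr_ge0 => t _; exact: sqr_ge0.
rewrite hA; apply: (le_trans (ler_norm_sum _ _ _)); apply: ler_sum => s _.
apply: (le_trans (ler_norm_sum _ _ _)); apply: ler_sum => t _.
rewrite !normrM -[leRHS]mul1r -[leRHS]mulr1.
by rewrite !ler_pM ?mulr_ge0 // normr_ge0.
Qed.

(** Points of the grid of mesh [1 / (4 sqrt #|S|)], coded by a sign and an
    absolute value for each coordinate; the bound on the absolute values is large
    enough for the whole unit ball. *)
Definition grid := {ffun S -> bool * 'I_(16 * #|S|).+1}.

Definition grid_point (g : grid) : S -> R :=
  fun s => (4 * Num.sqrt #|S|%:R)^-1 * ((-1) ^+ (g s).1 * (g s).2%:R).

(** The squares of the integer coordinates of a grid point of the unit ball sum to
    at most [16 #|S|], hence so do their absolute values; the net is counted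
    through this linear constraint. *)
Definition net : {set grid} :=
  finset (fun g : grid => (\sum_s (g s).2 <= 16 * #|S|)%N &&
    (sqnorm (grid_point g) <= 1)).

Lemma net_le1 g : g \in net -> sqnorm (grid_point g) <= 1.
Proof. by rewrite inE => /andP[]. Qed.

(** Summing [2 ^- (sum of the entries)] over all grid points factors over the
    coordinates, each factor being at most 4 by a geometric sum, while every
    point of the net contributes at least [2 ^- (16 #|S|)]. *)
Lemma card_net : (#|net| <= 2 ^ (18 * #|S|))%N.
Proof.
pose x : bool * 'I_(16 * #|S|).+1 -> R := fun p => 2^-1 ^+ p.2.
have x0 p : 0 <= x p by rewrite exprn_ge0.
have sx : \sum_p x p <= 4.
  rewrite -(pair_bigA _ (fun b k => x (b, k))) /=.
  have half m : \sum_(k < m) (2^-1 : R) ^+ k <= 2.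
    suff -> : \sum_(k < m) (2^-1 : R) ^+ k = 2 - 2 * 2^-1 ^+ m.
      by rewrite lerBlDr lerDl mulr_ge0 // exprn_ge0.
    elim: m => [|m IH]; first by rewrite big_ord0 expr0; ring.
    by rewrite big_ord_recr /= IH exprS; field.
  rewrite big_bool /x /=; have := half (16 * #|S|).+1; lra.
have total : \sum_(g : grid) \prod_s x (g s) = (\sum_p x p) ^+ #|S|.
  by rewrite -(bigA_distr_bigA (fun (s : S) p => x p)) prodr_const.
have: (#|net|%:R : R) * 2^-1 ^+ (16 * #|S|) <= 4 ^+ #|S|.
  apply: (@le_trans _ _ ((\sum_p x p) ^+ #|S|)); last first.
    by rewrite lerXn2r ?nnegrE // sumr_ge0.
  rewrite -total (bigID (mem net)) /=.
  apply: (@le_trans _ _ (\sum_(g in net) \prod_s x (g s))); last first.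
    by rewrite lerDl sumr_ge0 // => g _; exact: prodr_ge0.
  rewrite mulr_natl -sumr_const; apply: ler_sum => g; rewrite inE => /andP[gn _].
  by rewrite /x prodrXr ler_iXn2l //; lra.
move=> h; rewrite -(ler_nat R) natrX.
rewrite (_ : (18 * #|S| = 16 * #|S| + 2 * #|S|)%N); last by rewrite -mulnDl.
rewrite exprD [X in _ * X]exprM (_ : 2 ^+ 2 = 4); last by rewrite expr2; ring.
rewrite mulrC -ler_pdivrMr ?exprn_gt0 //.
by rewrite -exprVn.
Qed.

(** Rounding towards zero keeps the point in the unit ball. *)
Lemma rounding v : sqnorm v <= 1 ->
  exists2 g, g \in net & sqnorm (fun s => v s - grid_point g s) <= 16^-1.
Proof.
move=> v1; pose N := #|S|; pose r : R := Num.sqrt N%:R.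
have r0 : 0 <= r by exact: sqrtr_ge0.
have r2 : r ^+ 2 = N%:R by rewrite sqr_sqrtr.
pose k s := Num.trunc (4 * r * `|v s|).
have x0 s : 0 <= 4 * r * `|v s| by rewrite !mulr_ge0.
have kle s : (k s)%:R <= 4 * r * `|v s| by rewrite truncn_le.
have kgt s : 4 * r * `|v s| < (k s)%:R + 1.
  by have /andP[_] := truncn_itv (x0 s); rewrite natr1.
have ksum : (\sum_s k s <= 16 * N)%N.
  apply: (@leq_trans (\sum_s k s ^ 2)).
    by apply: leq_sum => s _; case: (k s) => // m; rewrite -mulnn leq_pmulr.
  rewrite -(ler_nat R) natr_sum.
  apply: (@le_trans _ _ (\sum_s 16 * r ^+ 2 * v s ^+ 2)).
    apply: ler_sum => s _; rewrite natrX.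
    rewrite (_ : 16 * _ * _ = (4 * r * `|v s|) ^+ 2).
      by rewrite lerXn2r ?nnegrE.
    rewrite !exprMn real_normK ?num_real //; ring.
  rewrite -mulr_sumr r2 natrM -[leRHS]mulr1; apply: ler_wpM2l => //.
have klt s : (k s < (16 * N).+1)%N.
  rewrite ltnS; apply: leq_trans ksum; by rewrite (bigD1 s) //= leq_addr.
pose g : grid := [ffun s => (v s < 0, Ordinal (klt s))].
have dist s : `|v s - grid_point g s| <= (4 * r)^-1 /\
              `|grid_point g s| <= `|v s|.
  have S0 : 0 < r by rewrite sqrtr_gt0 ltr0n; apply/card_gt0P; exists s.
  have c0 : 0 < (4 * r)^-1 by rewrite invr_gt0 mulr_gt0.
  have cr : (4 * r)^-1 * (4 * r) = 1 by rewrite mulVf // gt_eqF // mulr_gt0.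
  rewrite /grid_point ffunE /= -/N -/r.
  have a1 : (4 * r)^-1 * (k s)%:R <= `|v s|.
    by have := ler_wpM2l (ltW c0) (kle s); rewrite mulrA cr mul1r.
  have a2 : `|v s| <= (4 * r)^-1 * (k s)%:R + (4 * r)^-1.
    have := ler_wpM2l (ltW c0) (ltW (kgt s)).
    by rewrite mulrA cr mul1r mulrDr mulr1.
  have a3 : 0 <= (4 * r)^-1 * (k s)%:R by rewrite mulr_ge0 // ltW.
  split; last first.
    rewrite !normrM normrX normrN1 expr1n mul1r (gtr0_norm c0).
    by rewrite ger0_norm.
  case: ltP a1 a2 => vs.
    rewrite expr1 ltr0_norm // => a1 a2; rewrite ler_norml; lra.
  by rewrite expr0 ger0_norm // => a1 a2; rewrite ler_norml; lra.
have g1 : sqnorm (grid_point g) <= 1.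
  apply: le_trans v1; apply: ler_sum => s _.
  have [_ h] := dist s; rewrite -real_normK ?num_real // -[leRHS]real_normK ?num_real //.
  by rewrite lerXn2r ?nnegrE.
exists g; first by rewrite inE g1 andbT; under eq_bigr do rewrite ffunE /=.
have [N0|N0] := eqVneq N 0%N.
  rewrite /sqnorm big1 ?invr_ge0 // => s _; exfalso.
  have : (0 < N)%N by apply/card_gt0P; exists s.
  by rewrite N0.
apply: (@le_trans _ _ (\sum_(s : S) (4 * r)^-1 ^+ 2)).
  apply: ler_sum => s _; have [h _] := dist s.
  rewrite -real_normK ?num_real // lerXn2r ?nnegrE //.
  by rewrite invr_ge0 mulr_ge0.
have NR0 : (N%:R : R) != 0 by rewrite pnatr_eq0.
rewrite sumr_const -/N exprVn exprMn r2 -(@mulr_natl _ _ N).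
by rewrite le_eqVlt; apply/orP; left; apply/eqP; field.
Qed.

(** By polarisation the form changes between [v] and its rounding by at most half
    of its supremum over the unit ball, so that this supremum is at most twice the
    maximum over the net. *)
Lemma quadratic_net q (e : R) : quadratic q ->
  (forall g, g \in net -> `|q (grid_point g)| <= e) ->
  forall v, `|q v| <= 2 * e * sqnorm v.
Proof.
move=> qq qe.
pose E := [set x | exists2 v, sqnorm v <= 1 & x = `|q v|].
have [M hM] := quadratic_bounded qq.
have hE : has_sup E.
  split; last by exists M => _ [v v1 ->]; exact: hM.
  exists `|q (fun=> 0)|, (fun=> 0) => //.
  by rewrite /sqnorm big1 // => s _; rewrite expr0n.
have qzero v : sqnorm v = 0 -> q v = 0.
  move=> v0; have [A hA] := qq; rewrite hA big1 // => s _; rewrite big1 // => t _.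
  by rewrite (sqnorm_eq0 v0) mul0r mul0r.
have homB v (c : R) : (forall w, sqnorm w <= 1 -> `|q w| <= c) ->
    `|q v| <= c * sqnorm v.
  move=> hc; have [v0|v0] := eqVneq (sqnorm v) 0.
    by rewrite qzero // v0 normr0 mulr0.
  have vp : 0 < sqnorm v by rewrite lt_neqAle eq_sym v0 sqnorm_ge0.
  pose b := (Num.sqrt (sqnorm v))^-1.
  have b2 : b ^+ 2 = (sqnorm v)^-1 by rewrite exprVn sqr_sqrtr // ltW.
  have := hc (fun s => b * v s).
  rewrite sqnormZ b2 mulVf // lexx => /(_ isT).
  rewrite quadratic_hom // b2 normrM gtr0_norm ?invr_gt0 // mulrC.
  by rewrite ler_pdivrMr.
move=> v0; apply: (homB v0 (2 * e)) => {v0}.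
suff : sup E <= 2 * e.
  move=> sE v v1; apply: le_trans sE; apply: sup_upper_bound => //.
  by exists v.
suff : sup E <= e + sup E / 2 by lra.
apply: sup_le_ub; first by case: hE.
move=> _ [v v1 ->]; have [g gn vw] := rounding v1.
have w1 := net_le1 gn; set w := grid_point g in w1 vw.
have pol := quadratic_polar v w qq.
set p := (fun s => 4 * _ + _) in pol; set m := (fun s => _ - _ / 2) in pol.
have SE u : `|q u| <= sup E * sqnorm u.
  by apply: (homB u (sup E)) => z z1; apply: sup_upper_bound => //; exists z.
have pm : sqnorm p + sqnorm m <= 4.
  rewrite /sqnorm -big_split /=.
  apply: (@le_trans _ _ (\sum_s (32 * (v s - w s) ^+ 2 + (v s ^+ 2 + w s ^+ 2)))).
    apply: ler_sum => s _; rewrite /p /m.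
    have := sqr_ge0 (v s - w s); nra.
  rewrite big_split big_split /= -mulr_sumr.
  move: v1 w1 vw; rewrite /sqnorm; lra.
have sE0 : 0 <= sup E.
  apply: (@le_trans _ _ `|q w|) => //.
  by apply: sup_upper_bound => //; exists w.
have b1 := SE p; have b2 := SE m.
have : `|q v| <= `|q w| + 8^-1 * (`|q p| + `|q m|).
  have -> : q v = q w + 8^-1 * (q p - q m) by rewrite -pol; ring.
  apply: (le_trans (ler_normD _ _)); rewrite lerD2l normrM ger0_norm //.
  by rewrite ler_wpM2l // ler_normB.
have := qe _ gn; rewrite -/w.
have := ler_wpM2l sE0 pm; lra.
Qed.

End QuadraticForms.

(** * Functionals of independent subgaussian variables *)

Lemma lee_prod_EFin (R : realType) (G : Type) (s : seq G) (E : G -> \bar R)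
    (c : G -> R) : (forall l, 0 <= E l <= (c l)%:E)%E ->
  (\prod_(l <- s) E l <= (\prod_(l <- s) c l)%:E)%E.
Proof.
move=> Ec; suff : (0 <= \prod_(l <- s) E l <= (\prod_(l <- s) c l)%:E)%E.
  by case/andP.
elim: s => [|l s /andP[IH0 IH1]]; first by rewrite !big_nil lee_fin ler01 lexx.
rewrite !big_cons; have /andP[h0 h1] := Ec l.
by rewrite mule_ge0 //= EFinM lee_pmul.
Qed.

(** Jensen's inequality, the missing mass being put at zero. *)
Lemma jensen_expR (R : realType) (K : finType) (p y : K -> R) :
  (forall k, 0 <= p k) -> \sum_k p k <= 1 ->
  expR (\sum_k p k * y k) <= (1 - \sum_k p k) + \sum_k p k * expR (y k).
Proof.
move=> p0 p1; set m := \sum_k p k * y k.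
have tangent z : expR m * (1 + (z - m)) <= expR z.
  have -> : expR z = expR m * expR (z - m) by rewrite -expRD addrC subrK.
  by rewrite ler_pM2l ?expR_gt0 // expR_ge1Dx.
have t0 := tangent 0; rewrite expR0 in t0.
have h1 : (1 - \sum_k p k) * (expR m * (1 + (0 - m))) <= 1 - \sum_k p k.
  by rewrite -[leRHS]mulr1 ler_wpM2l // subr_ge0.
have h2 : \sum_k p k * (expR m * (1 + (y k - m))) <= \sum_k p k * expR (y k).
  by apply: ler_sum => k _; rewrite ler_wpM2l.
have h3 : \sum_k p k * (expR m * (1 + (y k - m))) =
    expR m * (m + (\sum_k p k) * (1 - m)).
  transitivity (expR m * (\sum_k p k * y k + (\sum_k p k) * (1 - m))); last by [].
  rewrite mulr_suml -big_split /= mulr_sumr; apply: eq_bigr => k _.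
  by ring.
rewrite h3 in h2; have := lerD h1 h2; apply: le_trans.
by rewrite le_eqVlt; apply/orP; left; apply/eqP; ring.
Qed.

Lemma expectation_combination_le (dT : measure_display)
    (T : measurableType dT) (R : realType) (P : probability T R) (L : finType)
    (a : R) (c p : L -> R) (f : L -> T -> R) :
  0 <= a -> (forall k, 0 <= p k) -> (forall k, measurable_fun setT (f k)) ->
  (forall k w, 0 <= f k w) -> (forall k, \int[P]_w (f k w)%:E <= (c k)%:E)%E ->
  (\int[P]_w (a + \sum_k p k * f k w)%:E <= (a + \sum_k p k * c k)%:E)%E.
Proof.
move=> a0 p0 mf f0 fc.
under eq_integral do rewrite EFinD -sumEFin.
rewrite ge0_integralD //; last 2 first.
- by move=> w _; apply: sume_ge0 => k _; rewrite lee_fin mulr_ge0.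
- apply: emeasurable_sum => k; apply/measurable_EFinP; exact: measurable_funM.
rewrite ge0_integral_sum //; last 2 first.
- by move=> k; apply/measurable_EFinP; exact: measurable_funM.
- by move=> k w _; rewrite lee_fin mulr_ge0.
rewrite integral_cst //= probability_setT mule1 EFinD leeD2l //.
rewrite -sumEFin; apply: lee_sum => k _.
under eq_integral do rewrite EFinM.
rewrite ge0_integralZl ?lee_fin //; last 2 first.
- exact/measurable_EFinP.
- by move=> w _; rewrite lee_fin.
by rewrite EFinM lee_wpmul2l ?lee_fin.
Qed.

Section Subgaussian.
Variables (dT : measure_display) (T : measurableType dT) (R : realType).
Variables (P : probability T R) (I : finType) (xi : I -> T -> R).
Hypothesis mxi : forall i, measurable_fun setT (xi i).
Hypothesis ind : independent_family P xi.
Variables (K : R) (K_gt0 : 0 < K).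
Hypothesis mgf : forall i s,
  (\int[P]_w (expR (s * xi i w))%:E <= (expR (K * s ^+ 2))%:E)%E.

Local Notation c0 := (3 / (16 * K)).

Let c0_gt0 : 0 < c0. Proof. by rewrite divr_gt0 // mulr_gt0. Qed.

Lemma measurable_lin d (U : measurableType d) (h : I -> U -> R) (v : I -> R) :
  (forall i, measurable_fun setT (h i)) ->
  measurable_fun setT (fun w => \sum_i v i * h i w).
Proof.
by move=> mh; apply: measurable_sum => i; apply: measurable_funM.
Qed.

Lemma linear_mgf (v : I -> R) (s : R) :
  (\int[P]_w (expR (s * \sum_i v i * xi i w))%:E <=
   (expR (K * s ^+ 2 * sqnorm v))%:E)%E.
Proof.
pose F (i : I) (x : vec R I) := expR (s * v i * x i).
have E w : expR (s * \sum_i v i * xi i w) = \prod_i F i (fun i => xi i w).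
  by rewrite -expR_sum mulr_sumr; congr expR; apply: eq_bigr => i _; rewrite mulrA.
under eq_integral do rewrite E.
rewrite (expectation_prod_groups mxi ind (g := id)); last 3 first.
- move=> i; apply: measurableT_comp => //; apply: measurable_funM => //.
  exact: measurable_coord.
- by move=> i x; exact: expR_ge0.
- by move=> i x y xy; rewrite /F xy.
rewrite /sqnorm mulr_sumr expR_sum; apply: lee_prod_EFin => i.
rewrite integral_ge0 => [|w _]; last by rewrite lee_fin expR_ge0.
by rewrite (le_trans (mgf _ _)) // lee_fin ler_expR exprMn mulrA.
Qed.

Lemma linear_exp_sqr (v : I -> R) : sqnorm v <= 1 ->
  (\int[P]_w (expR (c0 * (\sum_i v i * xi i w) ^+ 2))%:E <= 2%:E)%E.
Proof.
move=> v1; apply: expectation_exp_sqr_of_mgf => //; first exact: measurable_lin.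
move=> s; apply: (le_trans (linear_mgf _ _)).
by rewrite lee_fin ler_expR ler_piMr // mulr_ge0 ?sqr_ge0 // ltW.
Qed.

(** By convexity of the exponential, a weighted sum of squares of linear
    functionals inherits the exponential moment of a single square. *)
Lemma quadratic_exp (L : finType) (c : L -> R) (a : L -> I -> R) :
  (forall k, 0 <= c k) -> \sum_k c k * sqnorm (a k) <= c0 ->
  (\int[P]_w (expR (\sum_k c k * (\sum_i a k i * xi i w) ^+ 2))%:E <= 2%:E)%E.
Proof.
move=> c_ge0 cs.
pose p k := c k * sqnorm (a k) / c0.
pose b k := fun i => (Num.sqrt (sqnorm (a k)))^-1 * a k i.
pose y k w := c0 * (\sum_i b k i * xi i w) ^+ 2.
have p0 k : 0 <= p k.
  by apply: divr_ge0; [apply: mulr_ge0; [|exact: sqnorm_ge0]|exact: ltW].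
have p1 : \sum_k p k <= 1 by rewrite -mulr_suml ler_pdivrMr // mul1r.
have b2 k : sqnorm (b k) <= 1.
  rewrite sqnormZ exprVn sqr_sqrtr ?sqnorm_ge0 //.
  have [->|n0] := eqVneq (sqnorm (a k)) 0; first by rewrite mulr0.
  by rewrite mulVf.
have E w : \sum_k c k * (\sum_i a k i * xi i w) ^+ 2 = \sum_k p k * y k w.
  apply: eq_bigr => k _; rewrite /y /b.
  under [in RHS]eq_bigr do rewrite -mulrA.
  rewrite -mulr_sumr exprMn exprVn sqr_sqrtr ?sqnorm_ge0 // /p.
  have [n0|n0] := eqVneq (sqnorm (a k)) 0.
    rewrite n0 mulr0 !mul0r big1 ?expr0n ?mulr0 // => i _.
    by rewrite (sqnorm_eq0 n0) mul0r.
  by field; rewrite n0 gt_eqF.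
have my k : measurable_fun setT (y k).
  apply: measurable_funM => //; apply: measurable_funX; exact: measurable_lin.
have mey k : measurable_fun setT (fun w => expR (y k w)).
  exact: measurableT_comp.
apply: (@le_trans _ _
   (\int[P]_w ((1 - \sum_k p k) + \sum_k p k * expR (y k w))%:E)%E).
  apply: le_expectation => //.
  - apply: measurableT_comp => //; apply: measurable_sum => k.
    by apply: measurable_funM => //; apply: measurable_funX; exact: measurable_lin.
  - apply: measurable_funD => //; apply: measurable_sum => k.
    exact: measurable_funM.
  - by move=> w; rewrite E; exact: jensen_expR.
have e0 k w : 0 <= expR (y k w) by exact: expR_ge0.
have h1 : 0 <= 1 - \sum_k p k by rewrite subr_ge0.
apply: (le_trans (expectation_combination_le (c := fun=> 2) h1 p0 mey e0 _)).
  by move=> k; apply: linear_exp_sqr; exact: b2.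
by rewrite lee_fin -mulr_suml; lra.
Qed.

End Subgaussian.

(** * Laplace transform of a square *)

Section BernsteinSquare.
Variables (dT : measure_display) (T : measurableType dT) (R : realType).
Variables (P : probability T R) (f : T -> R) (c0 sigma : R).
Hypotheses (mf : measurable_fun setT f) (c0_gt0 : 0 < c0).
Hypothesis exp_le2 : (\int[P]_w (expR (c0 * f w ^+ 2))%:E <= 2%:E)%E.
Hypothesis moment2 : (\int[P]_w (f w ^+ 2)%:E = sigma%:E)%E.

Let y w := c0 * f w ^+ 2.
Let y0 w : 0 <= y w. Proof. by rewrite mulr_ge0 ?sqr_ge0 // ltW. Qed.
Let mf2 : measurable_fun setT (fun w => f w ^+ 2).
Proof. exact: measurable_funX. Qed.
Let mey p : measurable_fun setT (fun w => expR (p * (c0 * f w ^+ 2))).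
Proof. by apply: measurableT_comp => //; apply: measurable_funM => //; apply: measurable_funM. Qed.
Let mey1 : measurable_fun setT (fun w => expR (c0 * f w ^+ 2)).
Proof. by apply: measurableT_comp => //; apply: measurable_funM. Qed.

(** The exponentials below are bounded by combinations of [1], [f^2] and
    [exp (c0 f^2)], whose expectations are under control. *)
Let combine (p q : R) : 0 <= p -> 0 <= q ->
  (\int[P]_w (1 + \sum_(b : bool) (if b then p * c0 else q) *
     (if b then f w ^+ 2 else expR (c0 * f w ^+ 2)))%:E <=
   (1 + p * c0 * sigma + 2 * q)%:E)%E.
Proof.
move=> p0 q0.
pose F (b : bool) w := if b then f w ^+ 2 else expR (c0 * f w ^+ 2).
apply: (@le_trans _ _ (1 + \sum_(b : bool) (if b then p * c0 else q) *
    (if b then sigma else 2))%:E).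
  apply: (@expectation_combination_le _ _ _ P bool 1 (fun b => if b then sigma else 2)
    (fun b => if b then p * c0 else q) F) => //.
  - by case=> //; rewrite mulr_ge0 // ltW.
  - by case.
  - by case=> w; rewrite /F ?sqr_ge0 ?expR_ge0.
  - by case; rewrite /F // moment2.
by rewrite lee_fin big_bool /=; lra.
Qed.

(** With [y = c0 f^2], the remainder of [exp (p y)] after the linear term is at
    most [p^2 y^2 exp (p y)], and [y^2 exp (p y) <= 16 exp y] as [p <= 1/2]. *)
Lemma bernstein_sqr_upper (p : R) : 0 <= p <= 2^-1 ->
  (\int[P]_w (expR (p * (c0 * f w ^+ 2)))%:E <=
   (expR (p * c0 * sigma + 32 * p ^+ 2))%:E)%E.
Proof.
move=> /andP[p0 p2].
apply: (@le_trans _ _ (1 + p * c0 * sigma + 2 * (16 * p ^+ 2))%:E); last first.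
  rewrite lee_fin; have := expR_ge1Dx (p * c0 * sigma + 32 * p ^+ 2); lra.
apply: le_trans (combine p0 _); last by rewrite mulr_ge0 // sqr_ge0.
apply: le_expectation => //.
- apply: measurable_funD => //; apply: measurable_sum => b.
  by apply: measurable_funM => //; case: b.
move=> w; rewrite big_bool /= -(mulrA p c0) -/(y w).
have py0 : 0 <= p * y w by rewrite mulr_ge0.
have h1 := expR_le_sqr_expR py0.
have h2 := sqr_le_expR_half (y0 w).
have h3 : expR (y w / 2) * expR (p * y w) <= expR (y w).
  by rewrite -expRD ler_expR; have := y0 w; nra.
have e0 := expR_ge0 (p * y w); have p20 := sqr_ge0 p.
have h4 : y w ^+ 2 * expR (p * y w) <= 16 * expR (y w).
  by apply: (le_trans (ler_wpM2r e0 h2)); rewrite -mulrA ler_wpM2l.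
have := ler_wpM2l p20 h4; move: h1; rewrite exprMn; lra.
Qed.

(** The remainder of the exponential at a nonpositive point is bounded by its
    square alone, without an exponential factor. *)
Lemma bernstein_sqr_lower (p : R) : 0 <= p ->
  (\int[P]_w (expR (- p * (c0 * f w ^+ 2)))%:E <=
   (expR (- (p * c0 * sigma) + 64 * p ^+ 2))%:E)%E.
Proof.
move=> p0.
apply: (@le_trans _ _ (1 + 64 * p ^+ 2 - p * c0 * sigma)%:E); last first.
  rewrite lee_fin; have := expR_ge1Dx (- (p * c0 * sigma) + 64 * p ^+ 2); lra.
rewrite EFinB leeBrDr //.
have -> : (p * c0 * sigma)%:E = (\int[P]_w (p * c0 * f w ^+ 2)%:E)%E.
  under eq_integral do rewrite EFinM.
  rewrite ge0_integralZl ?moment2 //.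
  - exact/measurable_EFinP.
  - by move=> w _; rewrite lee_fin sqr_ge0.
  - by rewrite lee_fin mulr_ge0 // ltW.
rewrite -ge0_integralD //; last 3 first.
- exact/measurable_EFinP.
- by move=> w _; rewrite lee_fin mulr_ge0 ?sqr_ge0 // mulr_ge0 // ltW.
- by apply/measurable_EFinP; apply: measurable_funM.
under eq_integral do rewrite -EFinD.
have q0 : 0 <= 32 * p ^+ 2 by rewrite mulr_ge0 // sqr_ge0.
apply: le_trans (le_trans (combine (lexx 0) q0) _); last first.
  by rewrite lee_fin; lra.
apply: le_expectation.
- by apply: measurable_funD => //; apply: measurable_funM.
- apply: measurable_funD => //; apply: measurable_sum => b.
  by apply: measurable_funM => //; case: b.
- by move=> w; rewrite addr_ge0 ?expR_ge0 // mulr_ge0 ?sqr_ge0 // mulr_ge0 // ltW.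
move=> w; rewrite big_bool /= !mul0r add0r -(mulrA p c0) -/(y w) mulNr.
have h1 : expR (- (p * y w)) <= 1 + - (p * y w) + 2 * (- (p * y w)) ^+ 2.
  by apply: expR_le_quadratic; have := mulr_ge0 p0 (y0 w); lra.
have h2 := sqr_le_expR_half (y0 w).
have h3 : expR (y w / 2) <= expR (y w) by rewrite ler_expR; have := y0 w; lra.
have h4 : y w ^+ 2 <= 16 * expR (y w) by lra.
have := ler_wpM2l (sqr_ge0 p) h4; move: h1; rewrite sqrrN exprMn; lra.
Qed.

End BernsteinSquare.

(** * Deviations of independent arrays *)

Section Events.
Variables (dT : measure_display) (T : measurableType dT) (R : realType).
Variables (P : probability T R).

Lemma union_bound (G : finType) (D : {set G}) (E : G -> set T) (p : R) :
  (forall g, measurable (E g)) -> (forall g, g \in D -> P (E g) <= p%:E)%E ->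
  exists2 F : set T, measurable F /\ (P F <= (#|D|%:R * p)%:E)%E &
    forall g, g \in D -> E g `<=` F.
Proof.
move=> mE PE.
suff [F [mF PF] EF] : exists2 F : set T, measurable F /\
    (P F <= ((size (enum D))%:R * p)%:E)%E & forall g, g \in enum D -> E g `<=` F.
  exists F; first by split=> //; rewrite cardE.
  by move=> g gD; apply: EF; rewrite mem_enum.
have : {subset enum D <= D} by move=> g; rewrite mem_enum.
elim: (enum D) => [_|g s IH sD].
  by exists set0 => //; split=> //; rewrite measure0 mul0r.
have [h hs|F [mF PF] EF] := IH; first by apply: sD; rewrite inE hs orbT.
exists (E g `|` F).
  split; first exact: measurableU.
  apply: (le_trans (measureU2 P (mE g) mF)).
  by rewrite /= -natr1 mulrDl mul1r addrC EFinD leeD // PE // sD // mem_head.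
move=> h; rewrite inE => /orP[/eqP ->|hs]; first exact: subsetUl.
by apply: (subset_trans (EF h hs)); exact: subsetUr.
Qed.

End Events.

Section Array.
Variables (dT : measure_display) (T : measurableType dT) (R : realType).
Variables (P : probability T R) (A B : finType) (xi : A * B -> T -> R).
Hypothesis mxi : forall z, measurable_fun setT (xi z).
Hypothesis ind : independent_family P xi.
Variables (K : R) (K_gt0 : 0 < K).
Hypothesis mgf : forall z s,
  (\int[P]_w (expR (s * xi z w))%:E <= (expR (K * s ^+ 2))%:E)%E.

Local Notation c0 := (3 / (16 * K)).

Let c0_gt0 : 0 < c0. Proof. by rewrite divr_gt0 // mulr_gt0. Qed.

Definition row_weight (i : A) (v : B -> R) : A * B -> R :=
  fun z => if z.1 == i then v z.2 else 0.

Definition col_weight (j : B) (v : A -> R) : A * B -> R :=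
  fun z => if z.2 == j then v z.1 else 0.

Let sum_pair (h : A * B -> R) : \sum_z h z = \sum_a \sum_b h (a, b).
Proof. by rewrite pair_bigA; apply: eq_bigr => -[]. Qed.

Lemma row_weightE i v (x : A * B -> R) :
  \sum_z row_weight i v z * x z = \sum_b v b * x (i, b).
Proof.
rewrite sum_pair.
rewrite (bigD1 i) //= [X in _ + X]big1 ?addr0.
  by apply: eq_bigr => b _; rewrite /row_weight /= eqxx.
by move=> a ai; rewrite big1 // => b _; rewrite /row_weight /= (negbTE ai) mul0r.
Qed.

Lemma col_weightE j v (x : A * B -> R) :
  \sum_z col_weight j v z * x z = \sum_a v a * x (a, j).
Proof.
rewrite sum_pair.
apply: eq_bigr => a _; rewrite (bigD1 j) //= big1 ?addr0.
  by rewrite /col_weight /= eqxx.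
by move=> b bj; rewrite /col_weight /= (negbTE bj) mul0r.
Qed.

Lemma sqnorm_row i v : sqnorm (row_weight i v) = sqnorm v.
Proof.
rewrite /sqnorm; under eq_bigr do rewrite expr2.
rewrite row_weightE; apply: eq_bigr => b _.
by rewrite /row_weight /= eqxx expr2.
Qed.

Lemma sqnorm_col j v : sqnorm (col_weight j v) = sqnorm v.
Proof.
rewrite /sqnorm; under eq_bigr do rewrite expr2.
rewrite col_weightE; apply: eq_bigr => b _.
by rewrite /col_weight /= eqxx expr2.
Qed.

Lemma expectation_prod_le (G : finType) (g : A * B -> G)
    (F : G -> vec R (A * B)%type -> R) (c : G -> R) :
  (forall l, measurable_fun setT (F l)) -> (forall l x, 0 <= F l x) ->
  (forall l x y, (forall z, g z = l -> x z = y z) -> F l x = F l y) ->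
  (forall l, \int[P]_w (F l (fun z => xi z w))%:E <= (c l)%:E)%E ->
  (\int[P]_w (\prod_l F l (fun z => xi z w))%:E <= (\prod_l c l)%:E)%E.
Proof.
move=> mF F0 dF Fc; rewrite (expectation_prod_groups mxi ind mF F0 dF).
apply: lee_prod_EFin => l; rewrite Fc andbT.
by apply: integral_ge0 => w _; rewrite lee_fin.
Qed.

Lemma measurable_entry (z : A * B) :
  measurable_fun setT (fun x : vec R (A * B)%type => x z).
Proof. exact: measurable_coord. Qed.

Lemma measurable_row d (U : measurableType d) (h : U -> A * B -> R) i (v : B -> R) :
  (forall z, measurable_fun setT (fun x => h x z)) ->
  measurable_fun setT (fun x => \sum_b v b * h x (i, b)).
Proof. by move=> mh; apply: measurable_sum => b; apply: measurable_funM. Qed.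

Lemma measurable_col d (U : measurableType d) (h : U -> A * B -> R) j (v : A -> R) :
  (forall z, measurable_fun setT (fun x => h x z)) ->
  measurable_fun setT (fun x => \sum_a v a * h x (a, j)).
Proof. by move=> mh; apply: measurable_sum => b; apply: measurable_funM. Qed.

Let c0_exp_row i v : sqnorm v <= 1 ->
  (\int[P]_w (expR (c0 * (\sum_b v b * xi (i, b) w) ^+ 2))%:E <= 2%:E)%E.
Proof.
move=> v1; have := @linear_exp_sqr _ _ _ P _ xi mxi ind K K_gt0 mgf (row_weight i v).
rewrite sqnorm_row => /(_ v1); apply: le_trans.
rewrite le_eqVlt; apply/orP; left; apply/eqP; apply: eq_integral => w _.
by rewrite (row_weightE i v (fun z => xi z w)).
Qed.

Let c0_exp_col j v : sqnorm v <= 1 ->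
  (\int[P]_w (expR (c0 * (\sum_a v a * xi (a, j) w) ^+ 2))%:E <= 2%:E)%E.
Proof.
move=> v1; have := @linear_exp_sqr _ _ _ P _ xi mxi ind K K_gt0 mgf (col_weight j v).
rewrite sqnorm_col => /(_ v1); apply: le_trans.
rewrite le_eqVlt; apply/orP; left; apply/eqP; apply: eq_integral => w _.
by rewrite (col_weightE j v (fun z => xi z w)).
Qed.

Let mrow i v : measurable_fun setT (fun w => \sum_b v b * xi (i, b) w).
Proof. exact: (@measurable_row _ _ (fun w z => xi z w)). Qed.

Section Rows.
Variable v : B -> R.
Hypothesis v_le1 : sqnorm v <= 1.
Hypothesis moment2 : forall i,
  (\int[P]_w ((\sum_b v b * xi (i, b) w) ^+ 2)%:E = (sqnorm v)%:E)%E.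

Let gram w := \sum_i (\sum_b v b * xi (i, b) w) ^+ 2.

Let gram_exp (p c : R) :
  (forall i, \int[P]_w (expR (p * (c0 * (\sum_b v b * xi (i, b) w) ^+ 2)))%:E <=
     (expR c)%:E)%E ->
  (\int[P]_w (expR (p * (c0 * gram w)))%:E <= (expR (#|A|%:R * c))%:E)%E.
Proof.
move=> H.
pose F (i : A) (x : vec R (A * B)%type) :=
  expR (p * (c0 * (\sum_b v b * x (i, b)) ^+ 2)).
under eq_integral => w _.
  rewrite (_ : expR _ = \prod_i F i (fun z => xi z w)); last first.
    by rewrite -expR_sum /gram !mulr_sumr.
  over.
rewrite expRM_natl -prodr_const; apply: (expectation_prod_le (g := fst)).
- move=> i; apply: measurableT_comp => //; do 2!apply: measurable_funM => //.
  apply: measurable_funX; exact: (@measurable_row _ (vec R (A * B)%type) (fun x z => x z) i v measurable_entry).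
- by move=> i x; exact: expR_ge0.
- move=> i x y xy; rewrite /F; congr (expR (_ * (_ * _ ^+ 2))).
  by apply: eq_bigr => b _; rewrite xy.
- exact: H.
Qed.

(** The rows are independent, so that the Laplace transforms of their squares
    multiply. *)
Lemma bernstein_rows (e : R) : c0 <= 1 -> 0 <= e <= 1 ->
  (P [set w | (#|A|%:R * e <= `|gram w - #|A|%:R * sqnorm v|)%R] <=
   (2 * expR (- (#|A|%:R * (c0 ^+ 2 * e ^+ 2 / 256))))%:E)%E.
Proof.
move=> c01 /andP[e0 e1]; set N : R := #|A|%:R.
have N0 : 0 <= N by [].
(* Then [p c0 e = 128 p^2]: the gain of the deviation is twice the larger of the
   two quadratic remainders, [32 p^2] and [64 p^2]. *)
pose p := c0 * e / 128.
have p0 : 0 <= p by rewrite divr_ge0 // mulr_ge0 // ltW.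
have ce1 : c0 * e <= 1 by rewrite -[leRHS]mulr1 ler_pM // ltW.
have p2 : p <= 2^-1 by rewrite /p; lra.
have mg : measurable_fun setT gram.
  by apply: measurable_sum => i; apply: measurable_funX; exact: mrow.
have mgc (q : R) : measurable_fun setT (fun w => q * (c0 * gram w)).
  by apply: measurable_funM => //; apply: measurable_funM.
have up : (\int[P]_w (expR (p * (c0 * gram w)))%:E <=
    (expR (N * (p * c0 * sqnorm v + 32 * p ^+ 2)))%:E)%E.
  apply: gram_exp => i; apply: bernstein_sqr_upper => //; last by rewrite p0 p2.
  exact: c0_exp_row.
have lo : (\int[P]_w (expR (- p * (c0 * gram w)))%:E <=
    (expR (N * (- (p * c0 * sqnorm v) + 64 * p ^+ 2)))%:E)%E.
  apply: gram_exp => i; apply: bernstein_sqr_lower => //.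
  exact: c0_exp_row.
pose s1 := p * (c0 * (N * sqnorm v + N * e)).
pose s2 := - p * (c0 * (N * sqnorm v - N * e)).
have sub : [set w | N * e <= `|gram w - N * sqnorm v|] `<=`
    [set w | s1 <= p * (c0 * gram w)] `|` [set w | s2 <= - p * (c0 * gram w)].
  move=> w /=; rewrite ler_normr => /orP[h|h]; [left|right].
    by rewrite /s1 ler_wpM2l // ler_wpM2l ?(ltW c0_gt0) //; lra.
  by rewrite /s2 !mulNr lerN2 ler_wpM2l // ler_wpM2l ?(ltW c0_gt0) //; lra.
have ms : measurable [set w | N * e <= `|gram w - N * sqnorm v|].
  apply: measurable_ge; apply: measurableT_comp => //; exact: measurable_funB.
apply: (le_trans (le_measure P _ _ sub)); rewrite ?inE //.
  by apply: measurableU; apply: measurable_ge; exact: mgc.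
apply: (le_trans (measureU2 P _ _)); try by apply: measurable_ge; exact: mgc.
have M1 := le_trans (exp_markov P s1 (mgc p)) (lee_wpmul2l _ up).
have M2 := le_trans (exp_markov P s2 (mgc (- p))) (lee_wpmul2l _ lo).
apply: (le_trans (leeD (M1 _) (M2 _))); rewrite ?lee_fin ?expR_ge0 //.
rewrite -!expRD.
have key : p * c0 * e = 128 * p ^+ 2.
  by rewrite /p; field; rewrite gt_eqF.
have e256 : c0 ^+ 2 * e ^+ 2 / 256 = 64 * p ^+ 2.
  by rewrite /p; field; rewrite gt_eqF.
have twice (x : R) : 2 * x = x + x by ring.
rewrite e256 twice lerD // ler_expR /s1 /s2.
- have -> : - (p * (c0 * (N * sqnorm v + N * e))) +
      N * (p * c0 * sqnorm v + 32 * p ^+ 2) = N * (32 * p ^+ 2 - p * c0 * e) by ring.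
  by rewrite key -[leRHS]mulrN ler_wpM2l //; have := sqr_ge0 p; lra.
- have -> : - (- p * (c0 * (N * sqnorm v - N * e))) +
      N * (- (p * c0 * sqnorm v) + 64 * p ^+ 2) = N * (64 * p ^+ 2 - p * c0 * e) by ring.
  by rewrite key -[leRHS]mulrN ler_wpM2l //; have := sqr_ge0 p; lra.
Qed.

End Rows.

Section Columns.
Variables (lam : B -> R) (lam_ge0 : forall b, 0 <= lam b).

(** The columns are independent, and by interpolation the column [b] contributes
    at most a factor [exp (theta lam b / c0)] to the Laplace transform. *)
Lemma deviation_columns (theta s : R) (v : A -> R) : 0 <= theta ->
  (forall b, theta * lam b <= c0) -> sqnorm v <= 1 ->
  (P [set w | (s <= \sum_b lam b * (\sum_a v a * xi (a, b) w) ^+ 2)%R] <=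
   (expR (- (theta * s) + theta * (\sum_b lam b) / c0))%:E)%E.
Proof.
move=> th0 thlam v1.
have mq : measurable_fun setT
    (fun w => \sum_b lam b * (\sum_a v a * xi (a, b) w) ^+ 2).
  apply: measurable_sum => b; apply: measurable_funM => //.
  by apply: measurable_funX; exact: (@measurable_col _ _ (fun w z => xi z w)).
apply: (@le_trans _ _ (P [set w |
    theta * s <= theta * \sum_b lam b * (\sum_a v a * xi (a, b) w) ^+ 2])).
  apply: le_measure; rewrite ?inE.
  - exact: measurable_ge.
  - by apply: measurable_ge; exact: measurable_funM.
  - by move=> w /= h; rewrite ler_wpM2l.
apply: (le_trans (exp_markov P _ _)); first exact: measurable_funM.
rewrite expRD EFinM; apply: lee_wpmul2l; first by rewrite lee_fin expR_ge0.
pose F (b : B) (x : vec R (A * B)%type) :=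
  expR (theta * (lam b * (\sum_a v a * x (a, b)) ^+ 2)).
under eq_integral => w _.
  rewrite (_ : expR _ = \prod_b F b (fun z => xi z w)); last first.
    by rewrite -expR_sum mulr_sumr.
  over.
rewrite mulr_sumr mulr_suml expR_sum.
apply: (expectation_prod_le (g := snd)).
- move=> b; apply: measurableT_comp => //; do 2!apply: measurable_funM => //.
  apply: measurable_funX.
  exact: (@measurable_col _ (vec R (A * B)%type) (fun x z => x z) b v measurable_entry).
- by move=> b x; exact: expR_ge0.
- move=> b x y xy; rewrite /F; congr (expR (_ * (_ * _ ^+ 2))).
  by apply: eq_bigr => a _; rewrite xy.
move=> b; have mY : measurable_fun setT
    (fun w => c0 * (\sum_a v a * xi (a, b) w) ^+ 2).
  apply: measurable_funM => //; apply: measurable_funX.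
  exact: (@measurable_col _ _ (fun w z => xi z w)).
have p01 : 0 <= theta * lam b / c0 <= 1.
  apply/andP; split; last by rewrite ler_pdivrMr // mul1r.
  by apply: divr_ge0; [apply: mulr_ge0|exact: ltW].
have := expectation_exp_interpolation mY p01 (c0_exp_col b v1).
apply: le_trans; rewrite le_eqVlt; apply/orP; left; apply/eqP.
apply: eq_integral => w _; rewrite /F; congr (expR _)%:E.
by field; rewrite gt_eqF.
Qed.

Let trace w := \sum_a \sum_b lam b * xi (a, b) w ^+ 2.

Let mtrace : measurable_fun setT trace.
Proof.
apply: measurable_sum => a; apply: measurable_sum => b.
by apply: measurable_funM => //; exact: measurable_funX.
Qed.

(** Each row contributes at most a factor 2 by [quadratic_exp], and [2 <= exp 1]. *)
Lemma deviation_trace (m s : R) : 0 < m -> \sum_b lam b <= m ->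
  (P [set w | (s <= trace w)%R] <=
   (expR (- (c0 / m * s) + #|A|%:R))%:E)%E.
Proof.
move=> m0 lm; have cm0 : 0 < c0 / m by rewrite divr_gt0.
apply: (@le_trans _ _ (P [set w | c0 / m * s <= c0 / m * trace w])).
  apply: le_measure; rewrite ?inE.
  - exact: measurable_ge.
  - by apply: measurable_ge; exact: measurable_funM.
  - by move=> w /= h; rewrite ler_pM2l.
apply: (le_trans (exp_markov P _ _)); first exact: measurable_funM.
rewrite expRD EFinM; apply: lee_wpmul2l; first by rewrite lee_fin expR_ge0.
pose F (a : A) (x : vec R (A * B)%type) :=
  expR (\sum_b (c0 / m * lam b) * x (a, b) ^+ 2).
under eq_integral => w _.
  rewrite (_ : expR _ = \prod_a F a (fun z => xi z w)); last first.
    rewrite -expR_sum mulr_sumr; congr expR; apply: eq_bigr => a _.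
    by rewrite mulr_sumr; apply: eq_bigr => b _; rewrite mulrA.
  over.
apply: (@le_trans _ _ (\prod_(a : A) 2)%:E).
  apply: (expectation_prod_le (g := fst)).
  - move=> a; apply: measurableT_comp => //; apply: measurable_sum => b.
    apply: measurable_funM => //; apply: measurable_funX; exact: measurable_entry.
  - by move=> a x; exact: expR_ge0.
  - move=> a x y xy; rewrite /F; congr expR.
    by apply: eq_bigr => b _; rewrite xy.
  move=> a; pose e b := col_weight b (fun a' => (a' == a)%:R : R).
  have eE b (x : A * B -> R) : \sum_z e b z * x z = x (a, b).
    rewrite col_weightE (bigD1 a) //= eqxx mul1r big1 ?addr0 // => a' aa'.
    by rewrite (negbTE aa') mul0r.
  have e1 b : sqnorm (e b) = 1.
    rewrite sqnorm_col /sqnorm (bigD1 a) //= eqxx expr1n big1 ?addr0 // => a' aa'.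
    by rewrite (negbTE aa') expr0n.
  have := @quadratic_exp _ _ _ P _ xi mxi ind K K_gt0 mgf B
    (fun b => c0 / m * lam b) e.
  have h1 b : 0 <= c0 / m * lam b by rewrite mulr_ge0 // ltW.
  have h2 : \sum_b c0 / m * lam b * sqnorm (e b) <= c0.
    under eq_bigr do rewrite e1 mulr1.
    rewrite -mulr_sumr mulrAC ler_pdivrMr // ler_pM2l //.
  move=> /(_ h1 h2); apply: le_trans.
  rewrite le_eqVlt; apply/orP; left; apply/eqP; apply: eq_integral => w _.
  rewrite /F; congr (expR _)%:E; apply: eq_bigr => b _.
  by rewrite (eE b (fun z => xi z w)).
rewrite prodr_const lee_fin -[#|A|%:R]mulr1 expRM_natl lerXn2r ?nnegrE ?expR_ge0 //.
by have := expR_ge1Dx (1 : R); lra.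
Qed.

Variables (J : {set B}) (lamJ : forall b, b \in J -> lam b = 0).

Let cross w := \sum_(j in J) \sum_b lam b *
  (\sum_a xi (a, b) w * xi (a, j) w) ^+ 2.

(** Dividing by the trace normalises the form that the columns in [J] see: once
    the columns outside [J] are frozen by decoupling, the columns in [J] are
    independent, and each of them faces a positive form of trace at most [c0].
    The inverse is written as a power to make its measurability immediate. *)
Let self_normalised (tau : R) : 0 < tau ->
  (\int[P]_w (expR (c0 * cross w * (trace w + tau) `^ (-1)))%:E <=
   (2 ^+ #|J|)%:E)%E.
Proof.
move=> tau0.
pose tr (x : vec R (A * B)%type) := \sum_a \sum_b lam b * x (a, b) ^+ 2.
pose cr (x : vec R (A * B)%type) := \sum_(j in J) \sum_b lam b *
  (\sum_a x (a, b) * x (a, j)) ^+ 2.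
pose F (x : vec R (A * B)%type) := (expR (c0 * cr x * (tr x + tau) `^ (-1)))%:E.
have mF : measurable_fun setT F.
  apply/measurable_EFinP; apply: measurableT_comp => //; apply: measurable_funM.
    apply: measurable_funM => //.
    have -> : cr = fun x => \sum_j if j \in J then
        \sum_b lam b * (\sum_a x (a, b) * x (a, j)) ^+ 2 else 0.
      by apply/funext => x; rewrite /cr big_mkcond.
    apply: measurable_sum => j; case: (j \in J) => //.
    apply: measurable_sum => b; apply: measurable_funM => //.
    apply: measurable_funX; apply: measurable_sum => a.
    by apply: measurable_funM; exact: measurable_entry.
  apply: (measurableT_comp (measurable_powR _)); apply: measurable_funD => //.
  apply: measurable_sum => a; apply: measurable_sum => b.
  apply: measurable_funM => //; apply: measurable_funX; exact: measurable_entry.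
have F0 x : (0 <= F x)%E by rewrite lee_fin expR_ge0.
have := decoupling mxi ind (fun z => z.2 \in J) mF F0.
rewrite {1}/F => ->.
apply: (@le_trans _ _ (\int[P]_w (2 ^+ #|J|)%:E)%E); last first.
  by rewrite integral_cst //= probability_setT mule1.
apply: ge0_le_integral => //.
- by move=> w' _; exact: integral_ge0.
- refine (@measurable_decoupled _ _ R P _ xi mxi (fun z => z.2 \in J) F mF F0).
move=> w' _.
pose t b : A -> R := fun a => xi (a, b) w'.
pose th := c0 * (trace w' + tau)^-1.
have tr0 : 0 <= trace w'.
  by apply: sumr_ge0 => a _; apply: sumr_ge0 => b _; rewrite mulr_ge0 ?sqr_ge0.
have trt : 0 < trace w' + tau by rewrite ltr_wpDl.
have th0 : 0 <= th by rewrite mulr_ge0 ?(ltW c0_gt0) // invr_ge0 ltW.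
pose G (l : B) (x : vec R (A * B)%type) := if l \in J then
  expR (\sum_b th * lam b * (\sum_a t b a * x (a, l)) ^+ 2) else 1.
have E w : F (fun z => if z.2 \in J then xi z w else xi z w') =
    (\prod_l G l (fun z => xi z w))%:E.
  rewrite /F /G -big_mkcond /= -expR_sum; congr (expR _)%:E.
  have -> : tr (fun z => if z.2 \in J then xi z w else xi z w') = trace w'.
    apply: eq_bigr => a _; apply: eq_bigr => b _ /=.
    by case: ifP => // bJ; rewrite lamJ // !mul0r.
  rewrite powR_inv1 ?(ltW trt) // mulrAC -/th /cr mulr_sumr.
  apply: eq_bigr => j jJ; rewrite mulr_sumr; apply: eq_bigr => b _ /=.
  rewrite jJ mulrA; have [bJ|bJ] := boolP (b \in J).
    by rewrite lamJ // mulr0 !mul0r.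
  by [].
under eq_integral do rewrite E.
rewrite -prodr_const big_mkcond /=.
apply: (expectation_prod_le (g := snd)).
- move=> l; rewrite /G; case: (l \in J) => //.
  apply: measurableT_comp => //; apply: measurable_sum => b.
  apply: measurable_funM => //; apply: measurable_funX.
  exact: (@measurable_col _ (vec R (A * B)%type) (fun x z => x z) l (t b) measurable_entry).
- by move=> l x; rewrite /G; case: ifP => // _; exact: expR_ge0.
- move=> l x y xy; rewrite /G; case: ifP => // _; congr expR.
  apply: eq_bigr => b _; congr (_ * _ ^+ 2); apply: eq_bigr => a _.
  by rewrite xy.
move=> l; rewrite /G; case: ifP => lJ; last first.
  by rewrite integral_cst //= probability_setT mule1.
have := @quadratic_exp _ _ _ P _ xi mxi ind K K_gt0 mgf B
    (fun b => th * lam b) (fun b => col_weight l (t b)).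
have h1 b : 0 <= th * lam b by rewrite mulr_ge0.
have h2 : \sum_b th * lam b * sqnorm (col_weight l (t b)) <= c0.
  under eq_bigr do rewrite sqnorm_col -mulrA.
  have trE : \sum_b lam b * sqnorm (t b) = trace w'.
    rewrite /trace exchange_big /=; apply: eq_bigr => b _.
    by rewrite /sqnorm mulr_sumr.
  rewrite -mulr_sumr trE /th -mulrA ler_piMr ?(ltW c0_gt0) //.
  by rewrite mulrC ler_pdivrMr // mul1r lerDl ltW.
move=> /(_ h1 h2); apply: le_trans.
rewrite le_eqVlt; apply/orP; left; apply/eqP; apply: eq_integral => w _.
congr (expR _)%:E; apply: eq_bigr => b _.
by rewrite (col_weightE l (t b) (fun z => xi z w)).
Qed.

(** Where the trace stays below [tau], undoing the self-normalisation costs a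
    factor [2 tau]. *)
Lemma deviation_cross (tau t : R) : 0 < tau ->
  (P [set w | ((#|J|%:R + t) * (2 * tau) / c0 <= cross w)%R] <=
   (expR (- t))%:E + P [set w | (tau <= trace w)%R])%E.
Proof.
move=> tau0.
have mcr : measurable_fun setT cross.
  have -> : cross = fun w => \sum_j if j \in J then
      \sum_b lam b * (\sum_a xi (a, b) w * xi (a, j) w) ^+ 2 else 0.
    by apply/funext => x; rewrite /cross big_mkcond.
  apply: measurable_sum => j; case: (j \in J) => //.
  apply: measurable_sum => b; apply: measurable_funM => //.
  by apply: measurable_funX; apply: measurable_sum => a; apply: measurable_funM.
pose g w := c0 * cross w * (trace w + tau) `^ (-1).
have mg : measurable_fun setT g.
  apply: measurable_funM; first exact: measurable_funM.
  by apply: (measurableT_comp (measurable_powR _)); exact: measurable_funD.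
have tr0 w : 0 <= trace w.
  by apply: sumr_ge0 => a _; apply: sumr_ge0 => b _; rewrite mulr_ge0 ?sqr_ge0.
have cr0 w : 0 <= cross w.
  by apply: sumr_ge0 => a _; apply: sumr_ge0 => b _; rewrite mulr_ge0 ?sqr_ge0.
apply: (@le_trans _ _ (P ([set w | #|J|%:R + t <= g w] `|` [set w | tau <= trace w]))).
  apply: le_measure; rewrite ?inE.
  - exact: measurable_ge.
  - by apply: measurableU; exact: measurable_ge.
  move=> w /= h; have [big|small] := leP tau (trace w); [by right|left].
  have trt : 0 < trace w + tau by rewrite ltr_wpDl.
  rewrite /g powR_inv1 ?(ltW trt) // ler_pdivlMr //.
  move: h; rewrite ler_pdivrMr // => h; rewrite [leRHS]mulrC.
  have [neg|pos] := leP (#|J|%:R + t) 0.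
    apply: (@le_trans _ _ 0); first by rewrite mulr_le0_ge0 // ltW.
    by rewrite mulr_ge0 // ltW.
  by apply: le_trans h; rewrite ler_pM2l //; lra.
apply: (le_trans (measureU2 P _ _)); try exact: measurable_ge.
rewrite leeD2r //; apply: (le_trans (exp_markov P _ mg)).
apply: (@le_trans _ _ ((expR (- (#|J|%:R + t)))%:E * (2 ^+ #|J|)%:E)%E).
  by apply: lee_wpmul2l; rewrite ?lee_fin ?expR_ge0 //; exact: self_normalised.
rewrite -EFinM lee_fin opprD expRD mulrAC ler_piMl ?expR_ge0 //.
rewrite expRN mulrC ler_pdivrMr ?expR_gt0 // mul1r.
rewrite -[#|J|%:R]mulr1 expRM_natl lerXn2r ?nnegrE ?expR_ge0 //.
by have := expR_ge1Dx (1 : R); lra.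
Qed.

End Columns.

End Array.

(** * Hilbert bases *)

Section InnerProduct.
Variables (R : realType) (H : completeNormedModType R).
Variable ip : {dot H for idfun}.
Hypothesis ip_norm : forall x : H, ip x x = `|x| ^+ 2.

Lemma ipC (x y : H) : ip x y = ip y x.
Proof. by rewrite (@hermC _ _ idfun) expr0 mul1r. Qed.

Lemma ipDl (x y z : H) : ip (x + y) z = ip x z + ip y z.
Proof. exact: linearDl. Qed.

Lemma ipZl a (x z : H) : ip (a *: x) z = a * ip x z.
Proof. exact: linearZl_LR. Qed.

Lemma ipBl (x y z : H) : ip (x - y) z = ip x z - ip y z.
Proof. exact: linearBl. Qed.

Lemma ip0l (z : H) : ip 0 z = 0.
Proof. exact: linear0l. Qed.

Lemma ip_suml I (r : seq I) (Q : pred I) (F : I -> H) z :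
  ip (\sum_(i <- r | Q i) F i) z = \sum_(i <- r | Q i) ip (F i) z.
Proof. exact: linear_sumlz. Qed.

Lemma ipDr (x y z : H) : ip z (x + y) = ip z x + ip z y.
Proof. by rewrite !(ipC z) ipDl. Qed.

Lemma ipZr a (x z : H) : ip z (a *: x) = a * ip z x.
Proof. by rewrite !(ipC z) ipZl. Qed.

Lemma ipBr (x y z : H) : ip z (x - y) = ip z x - ip z y.
Proof. by rewrite !(ipC z) ipBl. Qed.

Lemma ip_sumr I (r : seq I) (Q : pred I) (F : I -> H) z :
  ip z (\sum_(i <- r | Q i) F i) = \sum_(i <- r | Q i) ip z (F i).
Proof. by rewrite ipC ip_suml; apply: eq_bigr => i _; exact: ipC. Qed.

Lemma cauchy_schwarz (x y : H) : `|ip x y| <= `|x| * `|y|.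
Proof.
have [->|x0] := eqVneq x 0; first by rewrite ip0l !normr0 mul0r.
have xp : 0 < `|x| by rewrite normr_gt0.
rewrite -(@ler_pXn2r _ 2) ?nnegrE ?mulr_ge0 // real_normK ?num_real // exprMn.
have : 0 <= ip (`|x| ^+ 2 *: y - ip x y *: x) (`|x| ^+ 2 *: y - ip x y *: x).
  by rewrite ip_norm sqr_ge0.
rewrite ipBl !ipBr !ipZl !ipZr !ip_norm (ipC y x).
have -> : `|x| ^+ 2 * (`|x| ^+ 2 * `|y| ^+ 2) - `|x| ^+ 2 * (ip x y * ip x y) -
    (ip x y * (`|x| ^+ 2 * ip x y) - ip x y * (ip x y * `|x| ^+ 2)) =
  `|x| ^+ 2 * (`|x| ^+ 2 * `|y| ^+ 2 - ip x y ^+ 2) by ring.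
by rewrite pmulr_rge0 ?exprn_gt0 // subr_ge0.
Qed.

Lemma ip_continuous (y : H) : continuous (fun x : H => ip x y).
Proof.
move=> x; apply/cvgrPdist_le => e e0.
near=> z; rewrite -ipBl.
apply: (le_trans (cauchy_schwarz _ _)).
have : `|x - z| <= e / (`|y| + 1).
  near: z; apply: cvgr_dist_le; first exact: cvg_id.
  by rewrite divr_gt0 // ltr_wpDl.
move=> h; apply: (@le_trans _ _ (e / (`|y| + 1) * `|y|)); first exact: ler_wpM2r.
rewrite mulrAC ler_pdivrMr ?ltr_wpDl //.
by rewrite ler_pM2l // lerDl.
Unshelve. all: by end_near. Qed.

Section Basis.
Variable e : nat -> H.
Hypothesis eB : orthonormal_basis ip e.

Lemma ip_basis i j : ip (e i) (e j) = (i == j)%:R.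
Proof. by case: eB. Qed.

Lemma norm_basis i : `|e i| = 1.
Proof.
by apply/eqP; rewrite -sqrp_eq1 ?normr_ge0 // -ip_norm ip_basis eqxx.
Qed.

Lemma parseval_polar (x y : H) :
  (fun n => \sum_(0 <= j < n) ip (e j) x * ip (e j) y) @ \oo --> ip x y.
Proof.
have [_ /(_ x) xs] := eB.
have := cvg_comp _ _ xs (@ip_continuous y x).
rewrite (_ : _ \o _ = (fun n => \sum_(0 <= j < n) ip (e j) x * ip (e j) y)) //.
apply/funext => n /=; rewrite /series /= ip_suml.
by apply: eq_bigr => j _; rewrite ipZl.
Qed.

Lemma parseval (x : H) :
  (fun n => \sum_(0 <= j < n) ip (e j) x ^+ 2) @ \oo --> `|x| ^+ 2.
Proof. by rewrite -ip_norm; exact: parseval_polar. Qed.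

Lemma parseval_eseries (x : H) :
  (\sum_(j <oo) (ip (e j) x ^+ 2)%:E = (`|x| ^+ 2)%:E)%E.
Proof. exact: (eseries_EFin (u := fun j => ip (e j) x ^+ 2) (parseval (x := x))). Qed.

Lemma bessel m n (x : H) : \sum_(m <= j < n) ip (e j) x ^+ 2 <= `|x| ^+ 2.
Proof.
have h k : \sum_(0 <= j < k) ip (e j) x ^+ 2 <= `|x| ^+ 2.
  rewrite -lee_fin -parseval_eseries.
  by apply: eseries_ge_partial => j; exact: sqr_ge0.
apply: le_trans (h n).
have [mn|mn] := leqP m n; last first.
  rewrite big_geq ?(ltnW mn) // sumr_ge0 // => j _; exact: sqr_ge0.
rewrite [leRHS](@big_cat_nat _ _ _ m) //= lerDr.
by apply: sumr_ge0 => j _; exact: sqr_ge0.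
Qed.

End Basis.

End InnerProduct.

(** * Orthogonal projections *)

Section Projections.
Variables (R : realType) (H : completeNormedModType R).
Variable ip : {dot H for idfun}.
Hypothesis ip_norm : forall x : H, ip x x = `|x| ^+ 2.

Lemma projD p (x y : H) : orthogonal_projection ip p -> p (x + y) = p x + p y.
Proof. by case=> lp _ _; have := lp 1 x y; rewrite !scale1r. Qed.

Lemma proj0 p : orthogonal_projection ip p -> p 0 = 0.
Proof.
by move=> hp; apply: (addrI (p 0)); rewrite -projD // !addr0.
Qed.

Lemma projN p (x : H) : orthogonal_projection ip p -> p (- x) = - p x.
Proof.
by move=> hp; apply/eqP; rewrite -addr_eq0 -projD // addNr proj0.
Qed.

Lemma proj_pythagoras p (x : H) : orthogonal_projection ip p ->
  `|x - p x| ^+ 2 = `|x| ^+ 2 - `|p x| ^+ 2.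
Proof.
case=> _ pp ps; rewrite -!ip_norm ipBl !ipBr.
rewrite (ps x (p x)) pp (ipC _ x); ring.
Qed.

Lemma proj_compl_sym p (x y : H) : orthogonal_projection ip p ->
  ip (x - p x) y = ip x (y - p y).
Proof. by case=> _ _ ps; rewrite ipBl ipBr ps. Qed.

Lemma zero_projection : orthogonal_projection ip (fun=> 0).
Proof. by split=> [a x y|//|x y]; rewrite ?scaler0 ?addr0 // ip0l ipC ip0l. Qed.

Section Basis.
Variable e : nat -> H.
Hypothesis eB : orthonormal_basis ip e.

Definition basis_projection (d : nat) : H -> H :=
  fun x => \sum_(j < d) tensor ip (e j) (e j) x.

Lemma basis_projectionE d k :
  basis_projection d (e k) = if (k < d)%N then e k else 0.
Proof.
rewrite /basis_projection /tensor.
under eq_bigr do rewrite (ip_basis eB).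
case: ltnP => kd.
  rewrite (bigD1 (Ordinal kd)) //= eqxx scale1r big1 ?addr0 // => i ik.
  rewrite (_ : (nat_of_ord i == k) = false) ?scale0r //.
  by apply/negbTE; apply: contra ik => /eqP ik; apply/eqP/val_inj.
rewrite big1 // => i _; rewrite (_ : (nat_of_ord i == k) = false) ?scale0r //.
by apply/negbTE; rewrite neq_ltn (leq_trans (ltn_ord i) kd).
Qed.

Lemma basis_projection_linear d : linear (basis_projection d).
Proof.
move=> a x y; rewrite /basis_projection scaler_sumr -big_split /=.
by apply: eq_bigr => j _; rewrite /tensor ipDr ipZr scalerDl scalerA.
Qed.

Lemma basis_projection_orthogonal d :
  orthogonal_projection ip (basis_projection d).
Proof.
split; first exact: basis_projection_linear.
  move=> x; rewrite {2 3}/basis_projection.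
  rewrite [LHS](_ : _ = \sum_(j < d) basis_projection d (tensor ip (e j) (e j) x)).
    apply: eq_bigr => j _; rewrite /tensor -[_ *: e j]addr0.
    rewrite basis_projection_linear basis_projectionE ltn_ord.
    suff -> : basis_projection d 0 = 0 by [].
    by rewrite /basis_projection big1 // => i _; rewrite /tensor ipC ip0l scale0r.
  elim/big_rec2: _ => [|j a b _ <-].
    by rewrite /basis_projection big1 // => i _; rewrite /tensor ipC ip0l scale0r.
  by have := basis_projection_linear d 1 (tensor ip (e j) (e j) x) b; rewrite !scale1r.
move=> x y; rewrite /basis_projection ip_suml ip_sumr; apply: eq_bigr => j _.
by rewrite /tensor ipZl ipZr (ipC ip x) mulrC.
Qed.

Lemma basis_projection_rank d : has_rank d (basis_projection d).
Proof.
exists (fun i => e i); split.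
  move=> a a0 i; have : ip (e i) (\sum_(i < d) a i *: e i) = 0.
    by rewrite a0 ipC ip0l.
  rewrite ip_sumr (bigD1 i) //= ipZr (ip_basis eB) eqxx mulr1 big1 ?addr0 // => j ji.
  rewrite ipZr (ip_basis eB) (_ : (i == j :> nat) = false) ?mulr0 //.
  by apply/negbTE; apply: contra ji => /eqP ij; apply/eqP/val_inj.
apply/seteqP; split=> _ [x _ <-].
  by exists (fun i => ip (e i) x).
exists (\sum_(i < d) x i *: e i) => //.
apply: eq_bigr => i _; rewrite /tensor; congr (_ *: _).
rewrite ip_sumr (bigD1 i) //= ipZr (ip_basis eB) eqxx mulr1 big1 ?addr0 // => j ji.
rewrite ipZr (ip_basis eB) (_ : (i == j :> nat) = false) ?mulr0 //.
by apply/negbTE; apply: contra ji => /eqP ij; apply/eqP/val_inj.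
Qed.

Lemma basis_residual d x :
  (fun n => \sum_(d <= l < n) ip (e l) x ^+ 2) @ \oo -->
  `|x - basis_projection d x| ^+ 2.
Proof.
have := parseval ip_norm eB (x := x - basis_projection d x).
rewrite (_ : (fun n => \sum_(0 <= j < n) _) =
  (fun n => \sum_(0 <= l < n) if (d <= l)%N then ip (e l) x ^+ 2 else 0)).
  rewrite (_ : (fun n => _) = (fun n => \sum_(d <= l < n) ip (e l) x ^+ 2)) //.
  by apply/funext => n; rewrite [RHS](@big_nat_widenl _ _ _ d 0) //= -big_mkcond.
apply/funext => n; apply: eq_bigr => j _.
rewrite ipC (proj_compl_sym _ _ (basis_projection_orthogonal d)).
rewrite basis_projectionE [(d <= j)%N]leqNgt; case: ltnP => jd /=.
  by rewrite subrr ipC ip0l expr0n.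
by rewrite subr0 ipC.
Qed.

(** With [M] the Gram matrix of a basis [b] of the range, the coefficients of
    [p x] in [b] are [M^-1 <b, x>]; the trace of [p] is therefore the trace of
    [M^-1 M], which is [d]. *)
Lemma projection_trace_le d p n : projections ip d p ->
  \sum_(0 <= k < n) `|p (e k)| ^+ 2 <= d%:R.
Proof.
move=> [hp [b [bfree rp]]]; have [lp pp ps] := hp.
pose M : 'M[R]_d := \matrix_(i, j) ip (b i) (b j).
have Mu : M \in unitmx.
  have key (a : 'rV[R]_d) : a *m M = 0 -> a = 0.
    move=> aM; apply/rowP => i; rewrite [RHS]mxE.
    apply: (bfree (fun i => a 0 i)).
    apply/eqP; rewrite -normr_eq0 -sqrf_eq0 -ip_norm ip_sumr big1 // => j _.
    have aj : \sum_i a 0 i * ip (b i) (b j) = 0.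
      have := congr1 (fun m : 'rV[R]_d => m 0 j) aM; rewrite !mxE => aj.
      by rewrite -[RHS]aj; apply: eq_bigr => i' _; rewrite mxE.
    rewrite ipZr ip_suml (_ : \sum_(_ < _) _ = 0) ?mulr0 // -[RHS]aj.
    by apply: eq_bigr => i' _; rewrite ipZl.
  rewrite -row_free_unit -kermx_eq0; apply/eqP/row_matrixP => r.
  by rewrite row0; apply: key; rewrite -row_mul mulmx_ker row0.
have pb i : p (b i) = b i.
  have : range p (b i).
    rewrite rp; exists (fun j => (i == j)%:R) => //.
    rewrite (bigD1 i) //= eqxx scale1r big1 ?addr0 // => j ji.
    by rewrite eq_sym (negbTE ji) scale0r.
  by case=> x _ <-.
have normp x : `|p x| ^+ 2 = \sum_i \sum_j (invmx M) i j * (ip (b i) x * ip (b j) x).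
  have : range p (p x) by exists x.
  rewrite rp => -[c _ cx].
  pose v : 'rV[R]_d := \row_j ip (b j) x.
  pose cv : 'rV[R]_d := \row_j c j.
  have vc : v = cv *m M.
    apply/rowP => j; rewrite !mxE -{1}(pb j) ps -cx ipC ip_suml.
    by apply: eq_bigr => i _; rewrite ipZl !mxE.
  have cvE : cv = v *m invmx M by rewrite vc mulmxK.
  rewrite -ip_norm ps pp -cx ip_sumr.
  under eq_bigr => j _.
    rewrite ipZr (_ : c j = cv 0 j); last by rewrite mxE.
    rewrite cvE mxE mulr_suml.
    over.
  rewrite exchange_big /=; apply: eq_bigr => i _; apply: eq_bigr => j _.
  by rewrite mxE (ipC ip x); ring.
have lim : (fun n => \sum_(0 <= k < n) `|p (e k)| ^+ 2) @ \oo --> (d%:R : R).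
  have -> : (fun n => \sum_(0 <= k < n) `|p (e k)| ^+ 2) = (fun n =>
      \sum_i \sum_j (invmx M) i j * \sum_(0 <= k < n) ip (e k) (b i) * ip (e k) (b j)).
    apply/funext => n'; under eq_bigr do rewrite normp.
    rewrite exchange_big /=; apply: eq_bigr => i _.
    rewrite exchange_big /=; apply: eq_bigr => j _.
    by rewrite mulr_sumr; apply: eq_bigr => k _; rewrite !(ipC ip (e k)).
  have -> : (d%:R : R) = \sum_i \sum_j (invmx M) i j * ip (b i) (b j).
    have -> : (d%:R : R) = \tr (invmx M *m M).
      by rewrite mulVmx // mxtrace1.
    rewrite /mxtrace; apply: eq_bigr => i _; rewrite mxE; apply: eq_bigr => j _.
    by rewrite mxE ipC.
  apply: cvg_big => [|i _]; first exact: add_continuous.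
  apply: cvg_big => [|j _]; first exact: add_continuous.
  by apply: cvgMr; exact: parseval_polar.
rewrite -lee_fin -(eseries_EFin (u := fun k => `|p (e k)| ^+ 2) lim).
by apply: eseries_ge_partial => k; exact: sqr_ge0.
Qed.

End Basis.

End Projections.

(** * The reconstruction error *)

Section Risk.
Variables (R : realType) (H : completeNormedModType R).
Variable ip : {dot H for idfun}.
Hypothesis ip_norm : forall x : H, ip x x = `|x| ^+ 2.

Lemma measurable_ip_borel (h : H) :
  measurable_fun setT (fun x : borel H => ip (x : H) h).
Proof.
have G_sub : preimage_set_system setT (fun x : borel H => ip (x : H) h)
    (@RGenOInfty.G R) `<=` @measurable _ (borel H).
  move=> _ [_ [a ->] <-]; rewrite setTI; apply: sub_sigma_algebra => /=.
  apply: (@open_comp _ _ (fun x : H => ip x h)) => [x _|].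
    exact: (ip_continuous ip_norm).
  exact: interval_open.
exact: (measurability _ (RGenOInfty.measurableE R) G_sub).
Qed.

Variables (dT : measure_display) (T : measurableType dT).
Variable P : probability T R.
Variables (X : {RV P >-> borel H}) (Sigma : H -> H) (lam : nat -> R) (u : nat -> H).
Hypothesis X_covariance : is_covariance P ip X Sigma.
Hypothesis lam_gt0 : forall j, 0 < lam j.
Hypothesis Sigma_eigenbasis : eigenbasis ip Sigma lam u.

Let uB : orthonormal_basis ip u. Proof. by case: Sigma_eigenbasis. Qed.

Lemma measurable_ip (Y : {RV P >-> borel H}) (h : H) :
  measurable_fun setT (fun w => ip (Y w : H) h).
Proof.
exact: (measurableT_comp (measurable_ip_borel h) (measurable_funPT Y)).
Qed.

Lemma covariance_moment (h g : H) :
  (\int[P]_w (ip (X w) h * ip (X w) g)%:E = (ip (Sigma h) g)%:E)%E.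
Proof.
have [_ /(_ g)] := X_covariance h; rewrite unlock => <-.
by apply: eq_integral => w _; rewrite /tensor ipZl.
Qed.

Lemma covariance_sqr (h : H) :
  (\int[P]_w (ip (X w) h ^+ 2)%:E = (ip (Sigma h) h)%:E)%E.
Proof. by rewrite -covariance_moment; under eq_integral do rewrite expr2. Qed.

Lemma Sigma_sym (h g : H) : ip (Sigma h) g = ip h (Sigma g).
Proof.
apply: EFin_inj; rewrite [in RHS]ipC -!covariance_moment.
by apply: eq_integral => w _; rewrite mulrC.
Qed.

Lemma Sigma_form (h : H) :
  (\sum_(k <oo) (lam k * ip (u k) h ^+ 2)%:E = (ip (Sigma h) h)%:E)%E.
Proof.
apply: eseries_EFin; have := parseval_polar ip_norm uB (x := Sigma h) (y := h).
rewrite (_ : (fun n => _) = (fun n => \sum_(0 <= k < n) lam k * ip (u k) h ^+ 2)) //.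
apply/funext => n; apply: eq_bigr => k _.
have [_ _ uE] := Sigma_eigenbasis.
by rewrite -Sigma_sym uE ipZl; ring.
Qed.

(** Both sides are the trace of [Sigma (I - p)]: on the left through Parseval
    applied to the residual of [X], on the right after exchanging the two sums. *)
Lemma risk_series p : orthogonal_projection ip p ->
  reconstruction_error P X p =
  (\sum_(k <oo) (lam k * `|u k - p (u k)| ^+ 2)%:E)%E.
Proof.
move=> hp; rewrite /reconstruction_error unlock.
transitivity (\int[P]_w \sum_(j <oo) (ip (X w) (u j - p (u j)) ^+ 2)%:E)%E.
  apply: eq_integral => w _; rewrite -(parseval_eseries ip_norm uB).
  apply: eq_eseriesr => j _.
  by rewrite ipC (proj_compl_sym _ _ hp).
rewrite integral_nneseries //; last 2 first.
- move=> j; apply/measurable_EFinP; apply: measurable_funX; exact: measurable_ip.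
- by move=> j w _; rewrite lee_fin sqr_ge0.
under eq_eseriesr do rewrite covariance_sqr -Sigma_form.
rewrite nneseries_interchange; last first.
  by move=> j k; rewrite lee_fin mulr_ge0 ?sqr_ge0 // ltW.
apply: eq_eseriesr => k _.
under eq_eseriesr do rewrite EFinM.
rewrite nneseriesZl; last by move=> j _; rewrite lee_fin sqr_ge0.
rewrite EFinM -(parseval_eseries ip_norm uB); congr (_ * _)%E.
apply: eq_eseriesr => j _; congr (_ ^+ 2)%:E.
by rewrite -(proj_compl_sym _ _ hp) ipC.
Qed.

Lemma residual_le1 p k : orthogonal_projection ip p ->
  `|u k - p (u k)| ^+ 2 <= 1.
Proof.
move=> hp; rewrite (proj_pythagoras ip_norm _ hp) (norm_basis ip_norm uB) expr1n.
by rewrite gerBl sqr_ge0.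
Qed.

Lemma risk_split p d : orthogonal_projection ip p ->
  reconstruction_error P X p =
  ((\sum_(0 <= k < d) lam k * `|u k - p (u k)| ^+ 2)%:E +
   \sum_(d <= k <oo) (lam k * `|u k - p (u k)| ^+ 2)%:E)%E.
Proof.
move=> hp; rewrite risk_series // (nneseries_split 0 d).
  by rewrite add0n sumEFin.
by move=> k _; rewrite lee_fin mulr_ge0 ?sqr_ge0 // ltW.
Qed.

Lemma risk_basis_projection d :
  reconstruction_error P X (basis_projection ip u d) =
  (\sum_(d <= k <oo) (lam k)%:E)%E.
Proof.
rewrite (risk_split d); last exact: basis_projection_orthogonal.
rewrite big_nat big1 ?add0e => [|k /andP[_ kd]]; last first.
  by rewrite (basis_projectionE uB) kd subrr normr0 expr0n mulr0.
apply: congr_lim; apply/funext => n; apply: eq_big_nat => k /andP[dk _].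
rewrite (basis_projectionE uB) ltnNge dk subr0.
by rewrite (norm_basis ip_norm uB) expr1n mulr1.
Qed.

Lemma risk_upper p d : orthogonal_projection ip p ->
  (reconstruction_error P X p <=
   (\sum_(0 <= k < d) lam k * `|u k - p (u k)| ^+ 2)%:E +
   \sum_(d <= k <oo) (lam k)%:E)%E.
Proof.
move=> hp; rewrite (risk_split d) // leeD2l //; apply: lee_nneseries => k *.
  by rewrite lee_fin mulr_ge0 ?sqr_ge0 // ltW.
by rewrite lee_fin ler_piMr ?residual_le1 // ltW.
Qed.

Lemma eigenvalues_summable : ('E_P[fun w => (`|(X w : H)| ^+ 2)%R] < +oo)%E ->
  (\sum_(0 <= k <oo) (lam k)%:E < +oo)%E.
Proof.
apply: le_lt_trans.
have := risk_series (zero_projection ip).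
rewrite /reconstruction_error; rewrite (_ : (fun w => _) = (fun w => (`|(X w : H)| ^+ 2)%R)); last first.
  by apply/funext => w; rewrite subr0.
move=> ->; rewrite le_eqVlt; apply/orP; left; apply/eqP.
apply: eq_eseriesr => k _.
by rewrite subr0 (norm_basis ip_norm uB) expr1n mulr1.
Qed.

(** Ky Fan: the weights [|p (u k)|^2] lie between 0 and 1 and sum to at most [d],
    so that they reduce the risk most when spent on the largest eigenvalues. *)
Lemma risk_lower p d : projections ip d p ->
  (\sum_(d <= k <oo) (lam k)%:E <= reconstruction_error P X p)%E.
Proof.
move=> hpd; have [hp _] := hpd; rewrite risk_series //.
apply: lime_le; first by apply: is_cvg_nneseries => k _ _; rewrite lee_fin ltW.
apply: nearW => n; rewrite sumEFin.
apply: le_trans (eseries_ge_partial 0 n _); last first.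
  by move=> k; rewrite mulr_ge0 ?sqr_ge0 // ltW.
rewrite lee_fin; have [lam_mono _ _] := Sigma_eigenbasis.
have [nd|dn] := leqP n d.
  rewrite big_geq // sumr_ge0 // => k _.
  by rewrite mulr_ge0 ?sqr_ge0 // ltW.
have tr := projection_trace_le ip_norm uB n hpd.
rewrite (@big_cat_nat _ _ _ d 0 n) ?(ltnW dn) //=.
rewrite (@big_cat_nat _ _ _ d 0 n) ?(ltnW dn) //= in tr.
have res k : `|u k - p (u k)| ^+ 2 = 1 - `|p (u k)| ^+ 2.
  by rewrite (proj_pythagoras ip_norm _ hp) (norm_basis ip_norm uB) expr1n.
have h1 : \sum_(0 <= k < d) lam d * (1 - `|p (u k)| ^+ 2) <=
    \sum_(0 <= k < d) lam k * `|u k - p (u k)| ^+ 2.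
  rewrite !big_nat; apply: ler_sum => k /andP[_ kd]; rewrite -res.
  by apply: ler_wpM2r; [exact: sqr_ge0|apply: lam_mono; exact: ltnW].
have h2 : \sum_(d <= k < n) (lam k - lam d * `|p (u k)| ^+ 2) <=
    \sum_(d <= k < n) lam k * `|u k - p (u k)| ^+ 2.
  rewrite [leLHS]big_nat [leRHS]big_nat; apply: ler_sum => k /andP[dk _].
  rewrite res mulrBr mulr1 lerB //.
  by apply: ler_wpM2r; [exact: sqr_ge0|exact: lam_mono].
apply: le_trans (lerD h1 h2).
rewrite -mulr_sumr !sumrB -mulr_sumr sumr_const_nat subn0.
have := ler_wpM2l (ltW (lam_gt0 d)) tr; rewrite mulrDr; lra.
Qed.

Lemma risk_minimum d :
  is_minimum (reconstruction_error P X @` projections ip d)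
    (\sum_(d <= k <oo) (lam k)%:E)%E.
Proof.
split; last by move=> _ [p hp <-]; exact: risk_lower.
exists (basis_projection ip u d); last exact: risk_basis_projection.
by split; [exact: basis_projection_orthogonal|exact: basis_projection_rank].
Qed.

End Risk.

(** * Perturbation of the empirical eigenvectors *)

Lemma cvg_le_bound (R : realType) (f : nat -> R) (l B : R) :
  f @ \oo --> l -> (forall n, f n <= B) -> l <= B.
Proof.
by move=> fl fB; apply: (cvgr_to_le fl); exact: nearW.
Qed.

Section BasisProjection.
Variables (R : realType) (H : completeNormedModType R).
Variable ip : {dot H for idfun}.
Hypothesis ip_norm : forall x : H, ip x x = `|x| ^+ 2.
Variable e : nat -> H.
Hypothesis eB : orthonormal_basis ip e.

Lemma ip_basis_projection d (x y : H) :
  ip (basis_projection ip e d x) y = \sum_(j < d) ip (e j) x * ip (e j) y.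
Proof.
by rewrite /basis_projection ip_suml; apply: eq_bigr => j _; rewrite /tensor ipZl.
Qed.

Lemma norm_basis_projection d (x : H) :
  `|basis_projection ip e d x| ^+ 2 = \sum_(j < d) ip (e j) x ^+ 2.
Proof.
have [_ pp ps] := basis_projection_orthogonal eB d.
rewrite -ip_norm -ps pp ip_basis_projection.
by apply: eq_bigr => j _; rewrite expr2.
Qed.

End BasisProjection.

Section SampleCovariance.
Variables (R : realType) (H : completeNormedModType R).
Variable ip : {dot H for idfun}.
Hypothesis ip_norm : forall x : H, ip x x = `|x| ^+ 2.
Variables (lam : nat -> R) (u : nat -> H).
Hypotheses (lam_gt0 : forall j, 0 < lam j) (lam_mono : nonincreasing_seq lam).
Hypothesis uB : orthonormal_basis ip u.
Variables (n : nat) (n_gt0 : (0 < n)%N) (xs : 'I_n -> H).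

Definition sample_operator (x : H) : H :=
  n%:R^-1 *: \sum_(i < n) tensor ip (xs i) (xs i) x.

Definition coef (i : 'I_n) (j : nat) : R := (Num.sqrt (lam j))^-1 * ip (xs i) (u j).

Variables (lamhat : nat -> R) (uhat : nat -> H).
Hypothesis uhat_eigenbasis : eigenbasis ip sample_operator lamhat uhat.

Let uhatB : orthonormal_basis ip uhat. Proof. by case: uhat_eigenbasis. Qed.
Let nR_gt0 : 0 < n%:R :> R. Proof. by rewrite ltr0n. Qed.

Lemma coefE i j : ip (u j) (xs i) = Num.sqrt (lam j) * coef i j.
Proof.
rewrite /coef mulrA mulfV ?mul1r 1?ipC //.
by rewrite gt_eqF // sqrtr_gt0.
Qed.

Lemma sample_form x y :
  n%:R * ip (sample_operator x) y = \sum_i ip (xs i) x * ip (xs i) y.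
Proof.
rewrite /sample_operator ipZl mulrA mulfV ?gt_eqF // mul1r ip_suml.
by apply: eq_bigr => i _; rewrite /tensor ipZl.
Qed.

Variables (d' d r : nat) (beta Lam Qmax : R).
Hypothesis Lam_le : forall j, (j < d')%N -> Lam <= lam j.
Hypothesis Lam_gap : 2 * lam d <= Lam.
Hypothesis beta_le : 110 * beta <= Lam.

Hypothesis head_lower : forall v : 'I_d' -> R,
  9 / 10 * n%:R * sqnorm v <= \sum_i (\sum_j v j * coef i j) ^+ 2.
Hypothesis middle_upper : forall v : 'I_r -> R,
  \sum_i (\sum_b v b * coef i (d + b)) ^+ 2 <= 11 / 10 * n%:R * sqnorm v.
Hypothesis tail_upper : forall K (g : 'I_n -> R),
  \sum_(b < K) lam (d + r + b) * (\sum_i g i * coef i (d + r + b)) ^+ 2 <=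
  beta * n%:R * sqnorm g.
Hypothesis cross_upper : forall K,
  \sum_(j < d') \sum_(d' <= b < K) lam b * (\sum_i coef i b * coef i j) ^+ 2 <=
  Qmax.

Let sqrt_lam j : Num.sqrt (lam j) ^+ 2 = lam j.
Proof. by rewrite sqr_sqrtr // ltW. Qed.

Let Lam_gt0 : 0 < Lam.
Proof. by apply: lt_le_trans Lam_gap; rewrite mulr_gt0. Qed.

Let N := (d + r)%N.

Let ip_combination (g : 'I_n -> R) k :
  ip (u k) (\sum_i g i *: xs i) = Num.sqrt (lam k) * \sum_i g i * coef i k.
Proof.
rewrite ip_sumr mulr_sumr; apply: eq_bigr => i _.
by rewrite ipZr coefE mulrCA.
Qed.

Let norm_tail (g : 'I_n -> R) (y : H) : y = \sum_i g i *: xs i ->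
  `|y - basis_projection ip u N y| ^+ 2 <= beta * n%:R * sqnorm g.
Proof.
move=> ->; apply: (cvg_le_bound (basis_residual ip_norm uB (d := N) (x := _))) => K.
have [NK|NK] := leqP N K; last first.
  rewrite big_geq ?(ltnW NK) //.
  by apply: le_trans (tail_upper 0 g); rewrite big_ord0.
apply: le_trans (tail_upper (K - N) g).
rewrite -{1}[N]add0n big_addn big_mkord; apply: ler_sum => b _.
by rewrite addnC ip_combination exprMn sqrt_lam.
Qed.

(** Duality: testing the sample against vectors without the first [N] coordinates
    is the same as measuring combinations of the tails of the observations, which
    only involves an [n x n] Gram matrix. *)
Let tail_form (v v2 : H) : v2 = v - basis_projection ip u N v ->
  \sum_i ip (xs i) v2 ^+ 2 <= beta * n%:R * `|v2| ^+ 2.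
Proof.
move=> v2E; pose b i := ip (xs i) v2; pose y := \sum_i b i *: xs i.
have bE : \sum_i b i ^+ 2 = ip (y - basis_projection ip u N y) v2.
  rewrite (proj_compl_sym _ _ (basis_projection_orthogonal uB N)).
  have hp := basis_projection_orthogonal uB N; have [_ pp _] := hp.
  have -> : v2 - basis_projection ip u N v2 = v2.
    by rewrite v2E (projD _ _ hp) (projN _ hp) pp subrr subr0.
  by rewrite /y ip_suml; apply: eq_bigr => i _; rewrite ipZl expr2.
have S0 : 0 <= \sum_i b i ^+ 2 by apply: sumr_ge0 => i _; exact: sqr_ge0.
have h := @norm_tail b y erefl; rewrite /sqnorm in h.
have cs := cauchy_schwarz ip_norm (y - basis_projection ip u N y) v2.
rewrite -bE ger0_norm // in cs.
have cs2 : (\sum_i b i ^+ 2) ^+ 2 <= beta * n%:R * `|v2| ^+ 2 * \sum_i b i ^+ 2.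
  apply: (@le_trans _ _ ((`|y - basis_projection ip u N y| * `|v2|) ^+ 2)).
    by rewrite lerXn2r ?nnegrE ?mulr_ge0.
  by rewrite exprMn [leRHS]mulrAC; apply: ler_wpM2r => //; exact: sqr_ge0.
have [S1|S1] := eqVneq (\sum_i b i ^+ 2) 0; last first.
  have Sp : 0 < \sum_i b i ^+ 2 by rewrite lt_neqAle eq_sym S1.
  by rewrite -(ler_pM2r Sp) -expr2.
rewrite -/b S1.
have b0 : 0 <= beta * n%:R.
  have := tail_upper 0 (fun=> 1); rewrite big_ord0 /sqnorm.
  under eq_bigr do rewrite expr1n.
  rewrite sumr_const card_ord -mulrA => hb.
  have nn : 0 < n%:R * n%:R :> R by rewrite mulr_gt0.
  by rewrite mulr_ge0 // -(pmulr_lge0 _ nn).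
by rewrite mulr_ge0 // sqr_ge0.
Qed.

(** Courant--Fischer: some combination of the first [d + 1] empirical eigenvectors
    is orthogonal to the first [d] vectors of [u]. On it, the coordinates from [d]
    to [d + r] are controlled by their Gram matrix and the remaining ones by
    [tail_form]. *)
Lemma lamhat_le : lamhat d <= 121 / 200 * Lam.
Proof.
have [lm _ uhE] := uhat_eigenbasis.
pose M : 'M[R]_(d.+1, d) := \matrix_(l, j) ip (uhat l) (u j).
have [c cM c0] : exists2 c : 'rV[R]_d.+1, c *m M = 0 & c != 0.
  have : kermx M != 0.
    rewrite kermx_eq0 /row_free; apply/negP => /eqP rk.
    by have := rank_leq_col M; rewrite rk ltnn.
  move=> /rowV0Pn[c /sub_kermxP cM c0]; by exists c.
pose v := \sum_(l < d.+1) c 0 l *: uhat l.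
have v_u j : (j < d)%N -> ip (u j) v = 0.
  move=> jd; have := congr1 (fun m : 'rV[R]_d => m 0 (Ordinal jd)) cM.
  rewrite !mxE => hj; rewrite /v ip_sumr -[RHS]hj; apply: eq_bigr => l _.
  by rewrite ipZr mxE ipC.
have v_uhat (l : 'I_d.+1) : ip (uhat l) v = c 0 l.
  rewrite /v ip_sumr (bigD1 l) //= ipZr (ip_basis uhatB) eqxx mulr1 big1 ?addr0 //.
  move=> k kl; rewrite ipZr (ip_basis uhatB) (_ : (l == k :> nat) = false) ?mulr0 //.
  by apply/negbTE; apply: contra kl => /eqP lk; apply/eqP/val_inj.
have normv : `|v| ^+ 2 = \sum_l c 0 l ^+ 2.
  rewrite -ip_norm {1}/v ip_suml; apply: eq_bigr => l _.
  by rewrite ipZl v_uhat expr2.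
have v0 : 0 < `|v| ^+ 2.
  rewrite normv lt_neqAle eq_sym sumr_ge0 ?andbT => [|l _]; last exact: sqr_ge0.
  apply/negP => /eqP s0; move/eqP: c0; apply; apply/rowP => l; rewrite mxE.
  exact: (sqnorm_eq0 (v := fun l => c 0 l) s0).
have low : lamhat d * `|v| ^+ 2 <= ip (sample_operator v) v.
  have -> : ip (sample_operator v) v = \sum_(l < d.+1) lamhat l * c 0 l ^+ 2.
    have -> : ip (sample_operator v) v = ip (\sum_(l < d.+1) c 0 l *: sample_operator (uhat l)) v.
      apply: (mulfI (lt0r_neq0 nR_gt0)).
      rewrite sample_form ip_suml mulr_sumr.
      under [RHS]eq_bigr do rewrite ipZl mulrCA sample_form mulr_sumr.
      rewrite exchange_big /=; apply: eq_bigr => i _.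
      rewrite {1}/v ip_sumr mulr_suml; apply: eq_bigr => l _.
      by rewrite ipZr mulrA.
    rewrite ip_suml; apply: eq_bigr => l _.
    by rewrite uhE !ipZl v_uhat; ring.
  rewrite normv mulr_sumr; apply: ler_sum => l _.
  by apply: ler_wpM2r; [exact: sqr_ge0|apply: lm; rewrite -ltnS].
pose v2 := v - basis_projection ip u N v.
pose w := fun b : 'I_r => Num.sqrt (lam (d + b)) * ip (u (d + b)) v.
have split_sum (f : nat -> R) : (forall j, (j < d)%N -> f j = 0) ->
    \sum_(j < N) f j = \sum_(b < r) f (d + b)%N.
  by move=> f0; rewrite /N big_split_ord /= big1 ?add0r // => j _; rewrite f0.
have split_ip i : ip (xs i) v = \sum_b w b * coef i (d + b) + ip (xs i) v2.
  rewrite /v2 ipBr (ipC ip _ (basis_projection _ _ _ _)) ip_basis_projection.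
  rewrite (split_sum (fun j => ip (u j) v * ip (u j) (xs i))); last first.
    by move=> j jd; rewrite v_u // mul0r.
  rewrite (_ : \sum_b w b * _ = \sum_(b < r) ip (u (d + b)) v * ip (u (d + b)) (xs i)).
    by rewrite addrC subrK.
  by apply: eq_bigr => b _; rewrite coefE /w; ring.
have Q1 := middle_upper w.
have Q2 := tail_form (erefl v2).
have w_le : sqnorm w <= lam d * (`|v| ^+ 2 - `|v2| ^+ 2).
  have -> : `|v| ^+ 2 - `|v2| ^+ 2 = \sum_(b < r) ip (u (d + b)) v ^+ 2.
    rewrite /v2 (proj_pythagoras ip_norm _ (basis_projection_orthogonal uB N)).
    rewrite (norm_basis_projection ip_norm uB) opprB addrC subrK.
    apply: (split_sum (fun j => ip (u j) v ^+ 2)) => j jd.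
    by rewrite v_u // expr0n.
  rewrite /sqnorm mulr_sumr; apply: ler_sum => b _.
  rewrite exprMn sqrt_lam; apply: ler_wpM2r; first exact: sqr_ge0.
  by apply: lam_mono; exact: leq_addr.
have v2_le : `|v2| ^+ 2 <= `|v| ^+ 2.
  rewrite /v2 (proj_pythagoras ip_norm _ (basis_projection_orthogonal uB N)).
  by rewrite gerBl sqr_ge0.
(* [(a + b)^2 <= 11/10 a^2 + 11 b^2]: the large factor falls on the tail, which
   [beta_le] makes small; the middle block gives [11/10 * 11/10 * 1/2]. *)
have up : n%:R * ip (sample_operator v) v <=
    11 / 10 * (\sum_i (\sum_b w b * coef i (d + b)) ^+ 2) +
    11 * \sum_i ip (xs i) v2 ^+ 2.
  rewrite sample_form !mulr_sumr -big_split /=; apply: ler_sum => i _.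
  rewrite split_ip; set a := \sum_b _; set b := ip _ _.
  have := sqr_ge0 (a - 10 * b); lra.
have S2 := sqr_ge0 `|v2|.
have ub : n%:R * ip (sample_operator v) v <= n%:R * (121 / 200 * Lam * `|v| ^+ 2).
  apply: (le_trans up).
  have e1 : 11 / 10 * n%:R * sqnorm w <=
      n%:R * (11 / 10 * (Lam / 2 * (`|v| ^+ 2 - `|v2| ^+ 2))).
    have -> : 11 / 10 * n%:R * sqnorm w = n%:R * (11 / 10 * sqnorm w) by ring.
    rewrite ler_pM2l // ler_pM2l; last by lra.
    apply: (le_trans w_le); apply: ler_wpM2r; [by rewrite subr_ge0|].
    by rewrite ler_pdivlMr // mulrC.
  have e2 : beta * n%:R * `|v2| ^+ 2 <= n%:R * (Lam / 110 * `|v2| ^+ 2).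
    have -> : beta * n%:R * `|v2| ^+ 2 = n%:R * (beta * `|v2| ^+ 2) by ring.
    rewrite ler_pM2l //; apply: ler_wpM2r => //.
    by rewrite ler_pdivlMr // mulrC.
  have e3 : 0 <= n%:R * (Lam * `|v2| ^+ 2).
    by apply: mulr_ge0; [exact: ltW|apply: mulr_ge0; [exact: ltW|]].
  apply: (@le_trans _ _ (11 / 10 * (n%:R * (11 / 10 * (Lam / 2 *
      (`|v| ^+ 2 - `|v2| ^+ 2)))) + 11 * (n%:R * (Lam / 110 * `|v2| ^+ 2)))).
    apply: lerD; apply: ler_wpM2l => //; first exact: le_trans e1.
    exact: le_trans e2.
  set A := `|v| ^+ 2; set B := `|v2| ^+ 2 in e3 *; lra.
move: ub; rewrite ler_pM2l // => /(le_trans low); rewrite ler_pM2r //.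
Qed.

(** [z l] is the head of [uhat l] scaled by the square root of the covariance, and
    [kappa l] is [n] times the empirical covariance of the standardised head and
    the tail of the sample, applied to [uhat l]. *)
Let z l (j : 'I_d') := Num.sqrt (lam j) * ip (u j) (uhat l).

Let ytail i := xs i - basis_projection ip u d' (xs i).

Let kappa l (j : 'I_d') := \sum_i ip (ytail i) (uhat l) * coef i j.

(** Test the eigenvector equation against the head of [uhat l]: by [head_lower]
    and the spectral gap the quadratic form of the head exceeds the eigenvalue
    term, so the head can only be balanced by [kappa l]. *)
Let head_of_eigenvector l : (d <= l)%N ->
  sqnorm (z l) <= 12 * n%:R ^- 2 * sqnorm (kappa l).
Proof.
move=> dl; have [lm _ uhE] := uhat_eigenbasis.
pose s i := \sum_j z l j * coef i j.
pose t i := ip (ytail i) (uhat l).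
have proj_s i : ip (basis_projection ip u d' (xs i)) (uhat l) = s i.
  rewrite ip_basis_projection; apply: eq_bigr => j _.
  by rewrite coefE /z; ring.
have split_ip i : ip (xs i) (uhat l) = s i + t i.
  by rewrite /t /ytail ipBl proj_s addrC subrK.
have proj_ip i : ip (xs i) (basis_projection ip u d' (uhat l)) = s i.
  have [_ _ ps] := basis_projection_orthogonal uB d'.
  by rewrite -ps proj_s.
have eigen : \sum_i (s i + t i) * s i =
    n%:R * (lamhat l * \sum_(j < d') ip (u j) (uhat l) ^+ 2).
  have := sample_form (uhat l) (basis_projection ip u d' (uhat l)).
  under [X in _ = X]eq_bigr do rewrite split_ip proj_ip.
  move=> <-; rewrite uhE ipZl (ipC ip _ (basis_projection _ _ _ _)).
  rewrite ip_basis_projection; congr (_ * (_ * _)).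
have lamhat_l : lamhat l <= 121 / 200 * Lam.
  by apply: le_trans lamhat_le; exact: lm.
have rhs : lamhat l * (\sum_(j < d') ip (u j) (uhat l) ^+ 2) <=
    121 / 200 * sqnorm (z l).
  apply: (@le_trans _ _ (121 / 200 * (Lam * \sum_(j < d') ip (u j) (uhat l) ^+ 2))).
    rewrite mulrA; apply: ler_wpM2r => //.
    by apply: sumr_ge0 => j _; exact: sqr_ge0.
  apply: ler_wpM2l; first by rewrite divr_ge0.
  rewrite mulr_sumr; apply: ler_sum => j _; rewrite /z exprMn sqrt_lam.
  by apply: ler_wpM2r; [exact: sqr_ge0|exact: Lam_le].
have cross : \sum_i t i * s i = \sum_j z l j * kappa l j.
  under eq_bigr do rewrite /s mulr_sumr.
  rewrite exchange_big /=; apply: eq_bigr => j _.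
  by rewrite /kappa mulr_sumr; apply: eq_bigr => i _; rewrite /t; ring.
have Z0 := sqnorm_ge0 (z l).
(* Half of the margin [9/10 - 121/200 = 59/200] is given up to Young's
   inequality. *)
have young : - (\sum_i t i * s i) <=
    59 / 400 * n%:R * sqnorm (z l) + 100 / 59 * n%:R^-1 * sqnorm (kappa l).
  rewrite cross -sumrN /sqnorm !mulr_sumr -big_split /=; apply: ler_sum => j _.
  have := sqr_ge0 (59 / 200 * n%:R * z l j + kappa l j) => h.
  have c0 : 0 <= 100 / 59 * n%:R^-1 :> R by rewrite mulr_ge0 // invr_ge0 ltW.
  have := mulr_ge0 c0 h.
  have nn : n%:R^-1 * n%:R = 1 :> R by rewrite mulVf // gt_eqF.
  rewrite (_ : 100 / 59 * n%:R^-1 * _ =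
    59 / 400 * (n%:R^-1 * n%:R) * n%:R * z l j ^+ 2 +
    (n%:R^-1 * n%:R) * (z l j * kappa l j) +
    100 / 59 * n%:R^-1 * kappa l j ^+ 2); last by field; rewrite gt_eqF.
  rewrite nn; lra.
have head := head_lower (z l); rewrite -/(s _) in head.
have key : 59 / 400 * n%:R * sqnorm (z l) <= 100 / 59 * n%:R^-1 * sqnorm (kappa l).
  have : \sum_i (s i + t i) * s i = \sum_i s i ^+ 2 + \sum_i t i * s i.
    by rewrite -big_split /=; apply: eq_bigr => i _; ring.
  have := ler_wpM2l (ltW nR_gt0) rhs; rewrite -eigen => h1 h2; rewrite h2 in h1.
  have : 9 / 10 * n%:R * sqnorm (z l) <= \sum_i s i ^+ 2 by [].
  move: h1 young; set A := \sum_i s i ^+ 2; set B := \sum_i t i * s i.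
  set Z := sqnorm (z l) in Z0 *; set W := _ * sqnorm (kappa l).
  rewrite (_ : n%:R * (121 / 200 * Z) = 121 / 200 * (n%:R * Z)); last by ring.
  rewrite -!(mulrA _ n%:R Z); lra.
have c1 : 0 < 59 / 400 * n%:R :> R by apply: mulr_gt0 _ nR_gt0; lra.
rewrite -(ler_pM2l c1); apply: (le_trans key).
have W0 := sqnorm_ge0 (kappa l).
have -> : 59 / 400 * n%:R * (12 * n%:R ^- 2 * sqnorm (kappa l)) =
    177 / 100 * (n%:R^-1 * sqnorm (kappa l)) by field; rewrite gt_eqF.
have : 0 <= n%:R^-1 * sqnorm (kappa l) by rewrite mulr_ge0 // invr_ge0 ltW.
rewrite -mulrA; lra.
Qed.

Let kappaE l j : kappa l j = ip (uhat l)
  ((\sum_i coef i j *: xs i) - basis_projection ip u d' (\sum_i coef i j *: xs i)).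
Proof.
have hp := basis_projection_orthogonal uB d'.
rewrite ipC (proj_compl_sym _ _ hp) ip_suml; apply: eq_bigr => i _.
by rewrite ipZl -(proj_compl_sym _ _ hp) mulrC.
Qed.

(** Bessel's inequality in the basis [uhat] leaves the squared Hilbert--Schmidt
    norm of the covariance of head and tail, which no longer depends on the
    empirical eigenvectors. *)
Let sum_kappa m : \sum_(d <= l < m) sqnorm (kappa l) <= Qmax.
Proof.
pose W j := \sum_i coef i j *: xs i.
apply: (@le_trans _ _ (\sum_(j < d') `|W j - basis_projection ip u d' (W j)| ^+ 2)).
  rewrite /sqnorm exchange_big /=; apply: ler_sum => j _.
  by under eq_bigr do rewrite kappaE; exact: (bessel ip_norm uhatB).
have lim : (fun K => \sum_(j < d') \sum_(d' <= k < K) ip (u k) (W j) ^+ 2) @ \oo -->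
    \sum_(j < d') `|W j - basis_projection ip u d' (W j)| ^+ 2.
  apply: cvg_big => [|j _]; first exact: add_continuous.
  exact: basis_residual.
apply: (cvg_le_bound lim) => K; apply: le_trans (cross_upper K).
apply: ler_sum => j _; apply: ler_sum => k _.
rewrite ip_combination exprMn sqrt_lam le_eqVlt; apply/orP; left; apply/eqP.
by congr (_ * _ ^+ 2); apply: eq_bigr => i _; rewrite mulrC.
Qed.

Lemma head_excess :
  \sum_(j < d') lam j * `|u j - basis_projection ip uhat d (u j)| ^+ 2 <=
  12 * n%:R ^- 2 * Qmax.
Proof.
have lim : (fun m => \sum_(j < d') lam j * \sum_(d <= l < m) ip (uhat l) (u j) ^+ 2)
    @ \oo --> \sum_(j < d') lam j * `|u j - basis_projection ip uhat d (u j)| ^+ 2.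
  apply: cvg_big => [|j _]; first exact: add_continuous.
  by apply: cvgMr; exact: basis_residual.
apply: (cvg_le_bound lim) => m.
apply: (@le_trans _ _ (\sum_(d <= l < m) sqnorm (z l))).
  rewrite /sqnorm exchange_big /=; apply: ler_sum => j _.
  rewrite mulr_sumr; apply: ler_sum => l _.
  by rewrite /z exprMn sqrt_lam (ipC ip (uhat l)).
apply: (@le_trans _ _ (\sum_(d <= l < m) 12 * n%:R ^- 2 * sqnorm (kappa l))).
  rewrite !big_nat; apply: ler_sum => l /andP[dl _].
  exact: head_of_eigenvector.
rewrite -mulr_sumr; apply: ler_wpM2l; last exact: sum_kappa.
by rewrite mulr_ge0 // invr_ge0 exprn_ge0.
Qed.

End SampleCovariance.

(** * Coefficients of a sample *)

Lemma mutually_independent_seq (dT : measure_display) (T : measurableType dT)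
    (R : realType) (P : probability T R) (I : choiceType) (dE : measure_display)
    (E : measurableType dE) (Y : I -> T -> E) (s : seq I) (B : I -> set E) :
  mutually_independent P Y -> uniq s -> (forall j, measurable (B j)) ->
  fine (P [set w | forall j, j \in s -> B j (Y j w)]) =
  \prod_(j <- s) fine (P (Y j @^-1` B j)).
Proof.
move=> indY us mB; have := indY (seq_fset tt s) B mB.
rewrite (perm_big _ (seq_fset_perm tt s)) undup_id // => <-.
congr (fine (P _)); apply/seteqP; split=> w /= h j.
  by move=> js; apply: h; rewrite -(seq_fsetE tt s j).
by move=> js; apply: h; move: js; rewrite -(seq_fsetE tt s j).
Qed.

Section Coefficients.
Variables (R : realType) (H : completeNormedModType R).
Variable ip : {dot H for idfun}.
Hypothesis ip_norm : forall x : H, ip x x = `|x| ^+ 2.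
Variables (dT : measure_display) (T : measurableType dT).
Variable P : probability T R.
Variables (X : {RV P >-> borel H}) (Sigma : H -> H) (lam : nat -> R) (u : nat -> H).
Hypothesis X_centered : is_expectation P ip X 0.
Hypothesis X_covariance : is_covariance P ip X Sigma.
Hypothesis lam_gt0 : forall j, 0 < lam j.
Hypothesis Sigma_eigenbasis : eigenbasis ip Sigma lam u.
Hypothesis KL_independent : mutually_independent P (KL_coefficient ip X lam u).
Variables (n : nat) (Xs : 'I_n -> {RV P >-> borel H}).
Hypothesis Xs_independent : mutually_independent P (Xs : 'I_n -> T -> borel H).
Hypothesis Xs_copies : forall i, same_law P (Xs i : T -> borel H) X.

Let uB : orthonormal_basis ip u. Proof. by case: Sigma_eigenbasis. Qed.

Let kl (k : nat) (x : borel H) : R := (Num.sqrt (lam k))^-1 * ip (x : H) (u k).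

Let mkl k : measurable_fun setT (kl k).
Proof.
apply: measurable_funM => //; exact: (measurable_ip_borel ip_norm).
Qed.

Lemma measurable_KL (Y : {RV P >-> borel H}) k :
  measurable_fun setT (KL_coefficient ip Y lam u k).
Proof. exact: (measurableT_comp (mkl k) (measurable_funPT Y)). Qed.

Lemma same_law_integral i (f : borel H -> \bar R) : measurable_fun setT f ->
  (forall x, 0 <= f x)%E -> (\int[P]_w f (Xs i w) = \int[P]_w f (X w))%E.
Proof.
move=> mf f0.
rewrite -[LHS](ge0_integral_distribution (Xs i) mf f0).
rewrite -[RHS](ge0_integral_distribution X mf f0).
by apply: eq_measure_integral => A mA _; exact: (Xs_copies i mA).
Qed.

(** The product rule is applied first to the observations, then to the
    coefficients of one of them, whose law is the one of [X]. *)
Lemma KL_array_independent (s K : nat) :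
  independent_family P (fun (z : 'I_n * 'I_K) =>
    KL_coefficient ip (Xs z.1) lam u (s + z.2)).
Proof.
move=> B mB.
pose A i : set (borel H) := [set x | forall b : 'I_K, B (i, b) (kl (s + b) x)].
have mA i : measurable (A i).
  rewrite (_ : A i = \bigcap_(b in [set: 'I_K]) (kl (s + b) @^-1` B (i, b))).
    apply: fin_bigcap_measurable => // b _; rewrite -[_ @^-1` _]setTI.
    exact: mkl.
  by apply/seteqP; split=> x h b; [move=> _; exact: h|exact: (h b I)].
have step1 : fine (P [set w | forall z : 'I_n * 'I_K,
      B z (KL_coefficient ip (Xs z.1) lam u (s + z.2) w)]) =
    \prod_i fine (P (Xs i @^-1` A i)).
  rewrite -(mutually_independent_seq Xs_independent (index_enum_uniq _) mA).
  congr (fine (P _)); apply/seteqP; split=> w /= h.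
    by move=> i _ b; exact: (h (i, b)).
  by move=> [i b]; exact: (h i (mem_index_enum _) b).
have step2 i : fine (P (Xs i @^-1` A i)) =
    \prod_(b < K) fine (P (KL_coefficient ip (Xs i) lam u (s + b) @^-1` B (i, b))).
  rewrite (Xs_copies i (mA i)).
  pose B' k := if (insub (k - s)%N : option 'I_K) is Some b then B (i, b) else setT.
  have B'E (b : 'I_K) : B' (s + b)%N = B (i, b).
    by rewrite /B' addKn valK.
  have mB' k : measurable (B' k) by rewrite /B'; case: insub.
  have us : uniq [seq (s + nat_of_ord b)%N | b <- index_enum 'I_K].
    by rewrite map_inj_uniq ?index_enum_uniq // => b1 b2 /addnI /val_inj.
  transitivity (fine (P [set w | forall k,
      k \in [seq (s + nat_of_ord b)%N | b <- index_enum 'I_K] ->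
      B' k (KL_coefficient ip X lam u k w)])).
    congr (fine (P _)); apply/seteqP; split=> w /= h.
      by move=> k /mapP[b _ ->]; rewrite B'E; exact: h.
    move=> b; rewrite -B'E; apply: h.
    by apply/mapP; exists b => //; exact: mem_index_enum.
  rewrite (mutually_independent_seq KL_independent us mB') big_map.
  apply: eq_bigr => b _; rewrite B'E; congr fine.
  have mC : measurable (kl (s + b) @^-1` B (i, b)).
    by rewrite -[_ @^-1` _]setTI; exact: mkl.
  exact: (esym (Xs_copies i mC)).
rewrite -(fineK (x := P _)) ?fin_num_measure //.
  congr EFin; rewrite step1; under eq_bigr do rewrite step2.
  by rewrite pair_bigA; apply: eq_bigr => -[].
rewrite (_ : [set w | _] = \bigcap_(z in [set: 'I_n * 'I_K])
  (KL_coefficient ip (Xs z.1) lam u (s + z.2) @^-1` B z)).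
  apply: fin_bigcap_measurable => // z _; rewrite -[_ @^-1` _]setTI.
  exact: measurable_KL.
by apply/seteqP; split=> w h z; [move=> _; exact: h|exact: (h z I)].
Qed.

Variables (L a : R).
Hypotheses (L_gt0 : 0 < L) (a_gt0 : 0 < a).
Hypothesis aL : 4 * (a * L ^+ 2) * expR 1 <= 1.
Hypothesis KL_subgaussian :
  (ereal_sup (range (fun j => psi2_norm P (KL_coefficient ip X lam u j))) <= L%:E)%E.

Lemma KL_mgf i k s :
  (\int[P]_w (expR (s * KL_coefficient ip (Xs i) lam u k w))%:E <=
   (expR (2 / a * s ^+ 2))%:E)%E.
Proof.
have mf := measurable_KL X k.
have msk : measurable_fun setT (fun x : borel H => (expR (s * kl k x))%:E).
  apply/measurable_EFinP; apply: measurableT_comp => //.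
  by apply: measurable_funM => //; exact: mkl.
have sk0 x : (0 <= (expR (s * kl k x))%:E)%E by rewrite lee_fin expR_ge0.
have := same_law_integral i msk sk0; rewrite /kl /= => ->.
have psi2 : (psi2_norm P (KL_coefficient ip X lam u k) <= L%:E)%E.
  by apply: le_trans KL_subgaussian; apply: ereal_sup_ubound; exists k.
have e2 := expectation_exp_sqr mf L_gt0 (ltW a_gt0) aL
  (fun j j0 => psi2_moment mf psi2 j0 L_gt0).
have [intX EX] := X_centered.
have intf : P.-integrable setT (EFin \o KL_coefficient ip X lam u k).
  apply: (@le_integrable _ _ _ P setT measurableT _ (fun w =>
      (((Num.sqrt (lam k))^-1 * `|u k|)%:E * (`|(X w : H)|)%:E)%E)) => //.
  - exact/measurable_EFinP.
  - move=> w _ /=; rewrite /KL_coefficient lee_fin !normrM normr_id.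
    rewrite (ger0_norm (x := (Num.sqrt (lam k))^-1)) ?invr_ge0 //.
    rewrite -mulrA ler_wpM2l ?invr_ge0 //.
    by rewrite normr_id [leRHS]mulrC; exact: (cauchy_schwarz ip_norm).
  - exact: integrableZl.
have f0 : (\int[P]_w (KL_coefficient ip X lam u k w)%:E = 0)%E.
  have := EX ((Num.sqrt (lam k))^-1 *: u k); rewrite unlock ip0l => EX0.
  by apply: etrans EX0; apply: eq_integral => w _; rewrite ipZr.
exact: (subgaussian_mgf s mf a_gt0 e2 intf f0).
Qed.

(** The coefficients are standardised: the combination with weights [v] is the
    inner product of the observation with a vector at which the covariance form
    equals [sqnorm v]. *)
Lemma KL_moment2 i (s K : nat) (v : 'I_K -> R) :
  (\int[P]_w ((\sum_b v b * KL_coefficient ip (Xs i) lam u (s + b) w) ^+ 2)%:E =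
   (sqnorm v)%:E)%E.
Proof.
pose h : H := \sum_b (v b / Num.sqrt (lam (s + b))) *: u (s + b)%N.
have E (x : borel H) : \sum_b v b * kl (s + b) x = ip (x : H) h.
  by rewrite /h ip_sumr; apply: eq_bigr => b _; rewrite /kl ipZr mulrA.
have mh : measurable_fun setT (fun x : borel H => ((\sum_b v b * kl (s + b) x) ^+ 2)%:E).
  apply/measurable_EFinP; apply: measurable_funX; apply: measurable_sum => b.
  by apply: measurable_funM => //; exact: mkl.
have h0 (x : borel H) : (0 <= ((\sum_b v b * kl (s + b) x) ^+ 2)%:E)%E.
  by rewrite lee_fin sqr_ge0.
have := same_law_integral i mh h0; rewrite {1}/kl /= => ->.
under eq_integral do rewrite E.
rewrite (covariance_sqr X_covariance).
have uh k : ip (u k) h = \sum_(b < K) if (s + b == k)%N then v b / Num.sqrt (lam k) else 0.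
  rewrite /h ip_sumr; apply: eq_bigr => b _; rewrite ipZr (ip_basis uB) eq_sym.
  by case: eqP => [->|_]; rewrite ?mulr1 ?mulr0.
rewrite -(Sigma_form ip_norm X_covariance Sigma_eigenbasis).
rewrite (nneseries_split 0 (s + K)); last first.
  by move=> k _; rewrite lee_fin mulr_ge0 ?sqr_ge0 // ltW.
rewrite add0n eseries0 ?adde0; last first.
  move=> k sk _; rewrite uh big1 ?expr0n ?mulr0 // => b _.
  case: eqP => // kb; move: sk; rewrite -kb leq_add2l leqNgt ltn_ord //.
rewrite sumEFin; congr EFin.
rewrite big_mkord big_split_ord /= big1 ?add0r => [|k _]; last first.
  rewrite uh big1 ?expr0n ?mulr0 // => b _.
  by case: eqP => // kb; have := ltn_ord k; rewrite -kb ltnNge leq_addr.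
apply: eq_bigr => b _; rewrite uh (bigD1 b) //= eqxx big1 ?addr0 => [|b' bb'].
  rewrite exprMn exprVn sqr_sqrtr ?ltW // mulrCA mulfV ?mulr1 //.
  exact: lt0r_neq0.
by rewrite eqn_add2l (_ : (b' == b :> nat) = false) //; apply/negbTE.
Qed.

End Coefficients.

(** * Concentration events *)

Lemma probability_increasing_union (dT : measure_display) (T : measurableType dT)
    (R : realType) (P : probability T R) (E : nat -> set T) (p : \bar R) :
  (forall k, measurable (E k)) -> (forall k, E k `<=` E k.+1) ->
  (forall k, P (E k) <= p)%E ->
  measurable (\bigcup_k E k) /\ (P (\bigcup_k E k) <= p)%E.
Proof.
move=> mE inc Ep; have mU := bigcupT_measurable E mE; split=> //.
have homE : {homo E : m k / (m <= k)%N >-> (m <= k)%O}.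
  apply: homo_leq => [A|A B C AB BC|k].
  - by rewrite subsetEset.
  - by move: AB BC; rewrite !subsetEset; exact: subset_trans.
  - by rewrite subsetEset.
rewrite -(cvg_lim _ (nondecreasing_cvg_mu mE mU homE)) //.
apply: lime_le; last exact: nearW.
by apply/cvg_ex; exists (P (\bigcup_k E k)); exact: nondecreasing_cvg_mu.
Qed.

Section Sample.
Variables (dT : measure_display) (T : measurableType dT) (R : realType).
Variables (P : probability T R) (n : nat) (eta : 'I_n -> nat -> T -> R).
Hypothesis meta : forall i k, measurable_fun setT (eta i k).
Hypothesis ind : forall s m,
  independent_family P (fun z : 'I_n * 'I_m => eta z.1 (s + z.2)).
Variables (K : R) (K_gt0 : 0 < K).
Hypothesis mgf : forall i k s,
  (\int[P]_w (expR (s * eta i k w))%:E <= (expR (K * s ^+ 2))%:E)%E.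
Hypothesis moment2 : forall i s m (v : 'I_m -> R),
  (\int[P]_w ((\sum_b v b * eta i (s + b) w) ^+ 2)%:E = (sqnorm v)%:E)%E.

Local Notation c0 := (3 / (16 * K)).
Hypothesis c0_le1 : c0 <= 1.

Let c0_gt0 : 0 < c0. Proof. by rewrite divr_gt0 // mulr_gt0. Qed.

(** Bernstein's inequality at every point of the net. The precision there is
    [1 / 20], half of the one required, because of [quadratic_net]. *)
Lemma gram_event s m : exists2 F : set T, measurable F /\
    (P F <= ((2 ^ (18 * m))%:R *
       (2 * expR (- (n%:R * ((c0 / 320) ^+ 2)))))%:E)%E &
  forall w, ~ F w -> forall v : 'I_m -> R,
    `|\sum_i (\sum_b v b * eta i (s + b) w) ^+ 2 - n%:R * sqnorm v| <=
    n%:R / 10 * sqnorm v.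
Proof.
pose q w (v : 'I_m -> R) :=
  \sum_i (\sum_b v b * eta i (s + b) w) ^+ 2 - n%:R * sqnorm v.
pose E (g : grid 'I_m) := [set w | n%:R / 20 <= `|q w (grid_point R g)|].
have mE g : measurable (E g).
  apply: measurable_ge; apply: measurableT_comp => //.
  apply: measurable_funB => //; apply: measurable_sum => i.
  apply: measurable_funX; apply: measurable_sum => b.
  by apply: measurable_funM.
have PE g : g \in net R 'I_m ->
    (P (E g) <= (2 * expR (- (n%:R * ((c0 / 320) ^+ 2))))%:E)%E.
  move=> /net_le1 g1.
  have := @bernstein_rows _ _ _ P 'I_n 'I_m (fun z => eta z.1 (s + z.2))
    (fun z => meta _ _) (@ind s m) K K_gt0 (fun z => mgf _ _) (grid_point R g) g1
    (fun i => moment2 i s (grid_point R g)) 20^-1 c0_le1.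
  rewrite (card_ord n); have e01 : 0 <= (20^-1 : R) <= 1 by apply/andP; split; lra.
  move=> /(_ e01).
  by rewrite (_ : c0 ^+ 2 * 20^-1 ^+ 2 / 256 = (c0 / 320) ^+ 2); last by field; rewrite gt_eqF.
have [F [mF PF] EF] := union_bound mE PE.
exists F; first split=> //.
  apply: (le_trans PF); rewrite lee_fin; apply: ler_wpM2r.
    exact: mulr_ge0 (ler0n _ _) (expR_ge0 _).
  by rewrite ler_nat (leq_trans (card_net R 'I_m)) // card_ord.
move=> w wF v.
have qq : quadratic (q w).
  apply: quadraticD.
    apply: quadratic_sum => i.
    have [A hA] := quadratic_sqr (fun b : 'I_m => eta i (s + b) w).
    by exists A => x; rewrite -hA; congr (_ ^+ 2); apply: eq_bigr => b _; rewrite mulrC.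
  have [A hA] := quadraticZ (- n%:R) (@quadratic_sqnorm R 'I_m).
  by exists A => x; rewrite -hA mulNr.
have := @quadratic_net R 'I_m (q w) (n%:R / 20) qq.
have qe g : g \in net R 'I_m -> `|q w (grid_point R g)| <= n%:R / 20.
  by move=> gn; rewrite leNgt; apply/negP => h; apply/wF/(EF g gn)/ltW.
move=> /(_ qe v); rewrite (_ : 2 * _ = n%:R / 10) //; by field.
Qed.

Variables (lam : nat -> R) (lam_ge0 : forall k, 0 <= lam k).

(** The number [m] of coordinates is unbounded, so for every point of the net the
    events for increasing [m] are joined first; the union over the net comes last
    and its size depends only on [n]. *)
Lemma tail_event N (theta S s : R) : 0 <= theta -> 0 <= s ->
  (forall b, theta * lam (N + b) <= c0) ->
  (forall m, \sum_(b < m) lam (N + b) <= S) ->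
  exists2 F : set T, measurable F /\
    (P F <= ((2 ^ (18 * n))%:R *
      expR (- (theta * s) + theta * S / c0))%:E)%E &
  forall w, ~ F w -> forall m (v : 'I_n -> R),
    \sum_(b < m) lam (N + b) * (\sum_i v i * eta i (N + b) w) ^+ 2 <=
    2 * s * sqnorm v.
Proof.
move=> th0 s0 thlam lamS.
pose q m w (v : 'I_n -> R) :=
  \sum_(b < m) lam (N + b) * (\sum_i v i * eta i (N + b) w) ^+ 2.
pose Em (g : grid 'I_n) m := [set w | s <= q m w (grid_point R g)].
have mEm g m : measurable (Em g m).
  apply: measurable_ge; apply: measurable_sum => b; apply: measurable_funM => //.
  by apply: measurable_funX; apply: measurable_sum => i; apply: measurable_funM.
have incEm g m : Em g m `<=` Em g m.+1.
  move=> w /= h; apply: (le_trans h); rewrite /q big_ord_recr /= lerDl.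
  by rewrite mulr_ge0 ?sqr_ge0.
have PEm g : g \in net R 'I_n -> forall m,
    (P (Em g m) <= (expR (- (theta * s) + theta * S / c0))%:E)%E.
  move=> /net_le1 g1 m.
  have := @deviation_columns _ _ _ P 'I_n 'I_m (fun z => eta z.1 (N + z.2))
    (fun z => meta _ _) (@ind N m) K K_gt0 (fun z => mgf _ _)
    (fun b : 'I_m => lam (N + b)) (fun b => lam_ge0 _) theta s (grid_point R g) th0 _ g1.
  move=> /(_ (fun b => thlam b)) /le_trans; apply.
  rewrite lee_fin ler_expR lerD2l; apply: ler_wpM2r.
    by rewrite invr_ge0 ltW.
  by apply: ler_wpM2l => //; exact: lamS.
pose E g := \bigcup_m Em g m.
have mE g : measurable (E g) by exact: bigcupT_measurable.
have PE g : g \in net R 'I_n ->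
    (P (E g) <= (expR (- (theta * s) + theta * S / c0))%:E)%E.
  by move=> gn; have [] := probability_increasing_union (mEm g) (incEm g) (PEm g gn).
have [F [mF PF] EF] := union_bound mE PE.
exists F; first split=> //.
  apply: (le_trans PF); rewrite lee_fin; apply: ler_wpM2r; first exact: expR_ge0.
  by rewrite ler_nat (leq_trans (card_net R 'I_n)) // card_ord.
move=> w wF m v.
have q0 x : 0 <= q m w x.
  by apply: sumr_ge0 => b _; rewrite mulr_ge0 ?sqr_ge0.
have qq : quadratic (q m w).
  apply: quadratic_sum => b.
  have [A hA] := quadraticZ (lam (N + b)) (quadratic_sqr (fun i => eta i (N + b) w)).
  exists A => x; rewrite -hA; congr (_ * _ ^+ 2).
  by apply: eq_bigr => i _; rewrite mulrC.
have qe g : g \in net R 'I_n -> `|q m w (grid_point R g)| <= s.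
  move=> gn; rewrite ger0_norm // leNgt; apply/negP => h; apply/wF/(EF g gn).
  by exists m => //; exact: ltW.
by have := quadratic_net qq qe v; rewrite ger0_norm.
Qed.

(** The head columns are independent of the tail, to which [deviation_cross]
    applies with the trace controlled by [deviation_trace]. *)
Lemma cross_event d' (m t : R) : 0 < m -> 0 <= t -> (0 < n)%N ->
  (forall k, \sum_(d' <= b < k) lam b <= m) ->
  exists2 F : set T, measurable F /\
    (P F <= (expR (- t) + expR (- (3 * n%:R)))%:E)%E &
  forall w, ~ F w -> forall k,
    \sum_(j < d') \sum_(d' <= b < k) lam b * (\sum_i eta i b w * eta i j w) ^+ 2 <=
    (d'%:R + t) * (8 * n%:R * m) / c0 ^+ 2.
Proof.
move=> m0 t0 n0 lamm; pose Q := (d'%:R + t) * (8 * n%:R * m) / c0 ^+ 2; rewrite -/Q.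
have nR0 : 0 < n%:R :> R by rewrite ltr0n.
pose q k w := \sum_(j < d') \sum_(d' <= b < k)
  lam b * (\sum_i eta i b w * eta i j w) ^+ 2.
pose E k := [set w | Q <= q (d' + k)%N w].
have mE k : measurable (E k).
  apply: measurable_ge; apply: measurable_sum => j; apply: measurable_sum => b.
  apply: measurable_funM => //; apply: measurable_funX.
  by apply: measurable_sum => i; apply: measurable_funM.
have qinc k w : q (d' + k)%N w <= q (d' + k.+1)%N w.
  apply: ler_sum => j _; rewrite addnS big_nat_recr ?leq_addr //= lerDl.
  by rewrite mulr_ge0 ?sqr_ge0.
have incE k : E k `<=` E k.+1 by move=> w /= h; exact: (le_trans h (qinc k w)).
have PE k : (P (E k) <= (expR (- t) + expR (- (3 * n%:R)))%:E)%E.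
  pose M := (d' + k)%N.
  pose lamk (b : 'I_M) := if (b < d')%N then 0 else lam b.
  have lamk0 b : 0 <= lamk b by rewrite /lamk; case: ifP.
  pose J : {set 'I_M} := finset (fun b : 'I_M => (b < d')%N).
  have lamJ b : b \in J -> lamk b = 0 by rewrite inE /lamk => ->.
  have sumJ (f : nat -> R) : \sum_(j in J) f j = \sum_(j < d') f j.
    rewrite (eq_bigl (fun b : 'I_M => (b < d')%N)); last by move=> b; rewrite inE.
    by rewrite -(big_ord_widen M f) ?leq_addr.
  have sumlam (f : nat -> R) : \sum_(b < M) lamk b * f b = \sum_(d' <= b < M) lam b * f b.
    rewrite [RHS](@big_nat_widenl _ _ _ d' 0) //= big_mkord [RHS]big_mkcond /=.
    apply: eq_bigr => b _; rewrite /lamk [(d' <= b)%N]leqNgt.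
    by case: (b < d')%N => /=; rewrite ?mul0r.
  have cardJ : #|J| = d'.
    have := sumJ (fun=> 1); rewrite !sumr_const card_ord => /eqP.
    by rewrite eqr_nat => /eqP.
  have suml : \sum_b lamk b <= m.
    have := sumlam (fun=> 1); under eq_bigr do rewrite mulr1.
    by move=> ->; under eq_bigr do rewrite mulr1; exact: lamm.
  (* The trace exceeds this level with probability at most [exp (- 4 n + n)]. *)
  pose tau := 4 * n%:R * m / c0.
  have tau0 : 0 < tau by rewrite divr_gt0 // mulr_gt0 // mulr_gt0.
  have A1 := @deviation_trace _ _ _ P 'I_n 'I_M (fun z => eta z.1 (0 + z.2))
    (fun z => meta _ _) (@ind 0%N M) K K_gt0 (fun z => mgf _ _) lamk lamk0
    m tau m0 suml.
  have A2 := @deviation_cross _ _ _ P 'I_n 'I_M (fun z => eta z.1 (0 + z.2))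
    (fun z => meta _ _) (@ind 0%N M) K K_gt0 (fun z => mgf _ _) lamk lamk0
    J lamJ tau t tau0.
  rewrite cardJ in A2; rewrite EFinD.
  have QE : Q = (d'%:R + t) * (2 * tau) / c0.
    by rewrite /Q /tau; field; rewrite gt_eqF.
  have qE w : q M w = \sum_(j in J) \sum_b lamk b *
      (\sum_a eta a (0 + b)%N w * eta a (0 + j)%N w) ^+ 2.
    rewrite (sumJ (fun j => \sum_b lamk b *
      (\sum_a eta a (0 + b)%N w * eta a (0 + j)%N w) ^+ 2)).
    apply: eq_bigr => j _.
    by rewrite (sumlam (fun b => (\sum_a eta a (0 + b)%N w * eta a (0 + j)%N w) ^+ 2)).
  apply: le_trans (le_trans A2 _).
    rewrite le_eqVlt; apply/orP; left; apply/eqP; congr (P _).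
    by rewrite /E QE; apply/seteqP; split=> w /=; rewrite -/M qE.
  rewrite leeD2l //; apply: (le_trans A1); rewrite lee_fin ler_expR card_ord.
  rewrite (_ : c0 / m * tau = 4 * n%:R); [lra|].
  by rewrite /tau; field; rewrite !gt_eqF.
have [mF PF] := probability_increasing_union mE incE PE.
exists (\bigcup_k E k) => // w wF k.
have [kd|dk] := leqP k d'.
  rewrite big1 => [|j _]; last by rewrite big_geq.
  rewrite /Q divr_ge0 ?sqr_ge0 // mulr_ge0 ?addr_ge0 //.
  by rewrite mulr_ge0 // ltW.
rewrite leNgt; apply/negP => h; apply: wF; exists (k - d')%N => //=.
by rewrite /E /= subnKC ?(ltnW dk) // ltW.
Qed.

End Sample.

(** * Constants *)

Definition gram_rate (R : realType) (c0 : R) : R := (c0 / 320) ^+ 2.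

(** The net for a block of [block_ratio c0 * n] coordinates has at most
    [2 ^ (n * gram_rate c0 / 4)] points, which [gram_event] can afford. *)
Definition block_ratio (R : realType) (c0 : R) : R := gram_rate c0 / 72.

(** The factor 110 is the one by which the normalised Gram matrix of the tails
    must stay below [lam d'.-1] in operator norm, and [44 / c0] is the constant
    lost in [tail_event]. *)
Definition size_ratio (R : realType) (c0 : R) : R :=
  block_ratio c0 * c0 / (44 * 110).

Definition deviation_ratio (R : realType) (c0 : R) : R := gram_rate c0 / 4.

Lemma pow2_le_expR (R : realType) (k : nat) : (2 ^ k)%:R <= expR k%:R :> R.
Proof.
rewrite natrX -[k%:R]mulr1 expRM_natl lerXn2r ?nnegrE ?expR_ge0 //.
by have := expR_ge1Dx (1 : R); lra.
Qed.

Section Constants.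
Variables (R : realType) (c0 : R).
Hypotheses (c0_gt0 : 0 < c0) (c0_le1 : c0 <= 1).
Local Notation b0 := (gram_rate c0).
Local Notation gam := (block_ratio c0).
Local Notation c1 := (size_ratio c0).
Local Notation c2 := (deviation_ratio c0).

Lemma gram_rate_gt0 : 0 < b0.
Proof. by apply: exprn_gt0; apply: divr_gt0 c0_gt0 _; rewrite ltr0n. Qed.

Lemma gram_rate_le1 : b0 <= 1.
Proof.
have h0 : 0 <= c0 / 320 by apply: divr_ge0 (ltW c0_gt0) _; rewrite ler0n.
have h1 : c0 / 320 <= 1 by move: c0_le1; lra.
by rewrite /gram_rate expr_le1.
Qed.

Lemma block_ratio_gt0 : 0 < gam.
Proof. by rewrite divr_gt0 // gram_rate_gt0. Qed.

Lemma block_ratio_le1 : gam <= 1.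
Proof. have := gram_rate_le1; rewrite /block_ratio; lra. Qed.

Lemma size_ratio_block : c1 * (44 * 110) = gam * c0.
Proof. by rewrite /size_ratio mulfVK // mulf_neq0. Qed.

Lemma size_ratio_gt0 : 0 < c1.
Proof.
apply: divr_gt0; last by lra.
by apply: mulr_gt0 => //; exact: block_ratio_gt0.
Qed.

Lemma size_ratio_le_block : c1 <= gam.
Proof.
have := ler_wpM2l (ltW block_ratio_gt0) c0_le1.
have := size_ratio_block; have := size_ratio_gt0; lra.
Qed.

Lemma deviation_ratio_gt0 : 0 < c2.
Proof. by rewrite divr_gt0 // gram_rate_gt0. Qed.

Lemma size_ratio_le_deviation : c1 <= c2.
Proof.
apply: (le_trans size_ratio_le_block).
have := gram_rate_gt0; rewrite /block_ratio /deviation_ratio; lra.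
Qed.

Variables (n : nat) (t : R).
Hypotheses (n_large : 1 <= c1 * n%:R) (t_ge0 : 0 <= t) (t_le : t <= c2 * n%:R).

Let nR : 0 <= n%:R :> R. Proof. by []. Qed.

Lemma gram_rate_n_large : 12 <= b0 * n%:R.
Proof.
have h := ler_wpM2r nR (ler_wpM2l (ltW block_ratio_gt0) c0_le1).
rewrite -size_ratio_block mulr1 in h.
move: n_large h; rewrite /block_ratio.
have := mulr_ge0 (ltW gram_rate_gt0) nR; lra.
Qed.

Lemma gram_probability m : m%:R <= gam * n%:R ->
  (2 ^ (18 * m))%:R * (2 * expR (- (n%:R * b0))) <= expR (- (t + 5)).
Proof.
move=> mg; apply: (@le_trans _ _
    (expR (18 * m)%:R * (expR 1 * expR (- (n%:R * b0))))).
  apply: ler_pM => //; rewrite ?pow2_le_expR //.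
  apply: ler_wpM2r; first exact: expR_ge0.
  by have := expR_ge1Dx (1 : R); lra.
rewrite -!expRD ler_expR natrM.
have := gram_rate_n_large; move: t_le mg; rewrite /deviation_ratio /block_ratio; lra.
Qed.

Lemma tail_probability :
  (2 ^ (18 * n))%:R * expR (- (22 * n%:R) + n%:R) <= expR (- (t + 5)).
Proof.
apply: (@le_trans _ _ (expR (18 * n)%:R * expR (- (22 * n%:R) + n%:R))).
  by apply: ler_wpM2r; [exact: expR_ge0|exact: pow2_le_expR].
rewrite -!expRD ler_expR natrM.
have := gram_rate_n_large; move: t_le; rewrite /deviation_ratio.
have := ler_wpM2r nR gram_rate_le1; lra.
Qed.

Lemma trace_probability : expR (- (3 * n%:R)) <= expR (- (t + 5)).
Proof.
rewrite ler_expR; have := gram_rate_n_large; move: t_le; rewrite /deviation_ratio.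
have := ler_wpM2r nR gram_rate_le1; lra.
Qed.

(** Each of the two Gram matrices and the tail fail with probability at most
    [exp (- (t + 5))], the cross-covariance with twice that. *)
Lemma five_expR : 5 * expR (- (t + 5)) <= expR (- t).
Proof.
rewrite opprD expRD mulrCA ler_piMr ?expR_ge0 //.
rewrite expRN ler_pdivrMr ?expR_gt0 // mul1r.
by have := expR_ge1Dx (5 : R); lra.
Qed.

End Constants.

(** * The oracle inequality *)

Section ExcessRisk.
Variables (R : realType) (L a c0 : R).
Hypotheses (L_gt0 : 0 < L) (a_gt0 : 0 < a).
Hypothesis aL : 4 * (a * L ^+ 2) * expR 1 <= 1.
Hypotheses (c0E : c0 = 3 / (16 * (2 / a))) (c0_le1 : c0 <= 1).
Variables (dT : measure_display) (T : measurableType dT) (P : probability T R).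
Variables (H : completeNormedModType R) (ip : {dot H for idfun}).
Hypothesis ip_norm : forall x : H, ip x x = `|x| ^+ 2.
Variables (X : {RV P >-> borel H}) (Sigma : H -> H) (lam : nat -> R) (u : nat -> H).
Hypothesis X_centered : is_expectation P ip X 0.
Hypothesis X_covariance : is_covariance P ip X Sigma.
Hypothesis lam_gt0 : forall j, 0 < lam j.
Hypothesis Sigma_eigenbasis : eigenbasis ip Sigma lam u.
Hypothesis KL_independent : mutually_independent P (KL_coefficient ip X lam u).
Hypothesis KL_subgaussian :
  (ereal_sup (range (fun j => psi2_norm P (KL_coefficient ip X lam u j)))
     <= L%:E)%E.
Variables (n : nat) (n_gt0 : (0 < n)%N) (Xs : 'I_n -> {RV P >-> borel H}).
Hypothesis Xs_independent : mutually_independent P (Xs : 'I_n -> T -> borel H).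
Hypothesis Xs_copies : forall i, same_law P (Xs i : T -> borel H) X.
Variables (lamhat : nat -> T -> R) (uhat : nat -> T -> H).
Hypothesis uhat_eigenbasis : forall w,
  eigenbasis ip (sample_covariance ip Xs w) (lamhat ^~ w) (uhat ^~ w).
Variables (d' d : nat) (m Lam t : R).
Hypotheses (m_gt0 : 0 < m) (Lam_gt0 : 0 < Lam).
Hypothesis lam_gap : 2 * lam d <= Lam.
Hypothesis Lam_le : forall j, (j < d')%N -> Lam <= lam j.
Hypothesis d'_le : d'%:R <= size_ratio c0 * n%:R.
Hypothesis n_large : 1 <= size_ratio c0 * n%:R.
Hypothesis middle_le : forall k,
  \sum_(d <= b < k) lam b <= size_ratio c0 * n%:R * Lam.
Hypothesis tail_le : forall k, \sum_(d' <= b < k) lam b <= m.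
Hypotheses (t_ge0 : 0 <= t) (t_le : t <= deviation_ratio c0 * n%:R).

Local Notation c1 := (size_ratio c0).
Local Notation gam := (block_ratio c0).
Local Notation kap := (c1 / gam).

Let K_gt0 : 0 < 2 / a. Proof. by rewrite divr_gt0. Qed.
Let c0_gt0 : 0 < c0. Proof. by rewrite c0E divr_gt0 // mulr_gt0. Qed.
Let nR : 0 < n%:R :> R. Proof. by rewrite ltr0n. Qed.
Let gam_gt0 : 0 < gam. Proof. exact: block_ratio_gt0. Qed.
Let c1_gt0 : 0 < c1. Proof. exact: size_ratio_gt0. Qed.
Let lam_ge0 k : 0 <= lam k. Proof. exact: ltW. Qed.
Let lam_mono : nonincreasing_seq lam. Proof. by case: Sigma_eigenbasis. Qed.

Let eta (i : 'I_n) k : T -> R := KL_coefficient ip (Xs i) lam u k.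
Let meta i k : measurable_fun setT (eta i k). Proof. exact: measurable_KL. Qed.
Let ind s k : independent_family P (fun z : 'I_n * 'I_k => eta z.1 (s + z.2)).
Proof. exact: (KL_array_independent ip_norm KL_independent Xs_independent Xs_copies). Qed.
Let mgf i k s :
  (\int[P]_w (expR (s * eta i k w))%:E <= (expR (2 / a * s ^+ 2))%:E)%E.
Proof. exact: (KL_mgf ip_norm X_centered Xs_copies L_gt0 a_gt0 aL KL_subgaussian). Qed.
Let moment2 i s k (v : 'I_k -> R) :
  (\int[P]_w ((\sum_b v b * eta i (s + b) w) ^+ 2)%:E = (sqnorm v)%:E)%E.
Proof. exact: (KL_moment2 ip_norm X_covariance lam_gt0 Sigma_eigenbasis Xs_copies). Qed.
Let c0_le1' : 3 / (16 * (2 / a)) <= 1. Proof. by rewrite -c0E. Qed.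

Let r := Num.trunc (gam * n%:R).
Let gn_gt0 : 0 < gam * n%:R. Proof. exact: mulr_gt0. Qed.

Let r_le : r%:R <= gam * n%:R.
Proof. by rewrite truncn_le ltW. Qed.

(** The average of the [r.+1] eigenvalues from [lam d] to [lam (d + r)] is at
    least the last of them. *)
Let lam_beyond : lam (d + r) <= kap * Lam.
Proof.
have r_gt : gam * n%:R < r.+1%:R by have /andP[] := truncn_itv (ltW gn_gt0).
have h : lam (d + r) * r.+1%:R <= c1 * n%:R * Lam.
  apply: le_trans (middle_le (d + r).+1).
  have -> : lam (d + r) * r.+1%:R = \sum_(d <= k < (d + r).+1) lam (d + r).
    by rewrite sumr_const_nat -addnS addKn mulr_natr.
  rewrite [leLHS]big_nat [leRHS]big_nat; apply: ler_sum => k /andP[_ kN].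
  exact: lam_mono.
have h2 : lam (d + r) * (gam * n%:R) <= c1 * n%:R * Lam.
  by apply: le_trans h; apply: ler_wpM2l => //; exact: ltW.
rewrite -(ler_pM2r gn_gt0); apply: (le_trans h2).
rewrite le_eqVlt; apply/orP; left; apply/eqP; field.
exact: lt0r_neq0.
Qed.

Let theta := c0 / (kap * Lam).
(** With this level [theta * s0 = 22 n], enough against [18 n] for the net and
    [n] for the Laplace transform, with [3 n] left for the probability. *)
Let s0 := 22 * (kap * Lam) * n%:R / c0.

Let kL_gt0 : 0 < kap * Lam.
Proof. by rewrite mulr_gt0 // divr_gt0. Qed.

Let theta_ge0 : 0 <= theta.
Proof. by rewrite ltW // divr_gt0. Qed.

Let s0_ge0 : 0 <= s0.
Proof. by rewrite ltW // divr_gt0 // mulr_gt0 // mulr_gt0. Qed.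

Let theta_lam b : theta * lam (d + r + b) <= 3 / (16 * (2 / a)).
Proof.
rewrite -c0E /theta mulrAC ler_pdivrMr // ler_pM2l //.
by apply: le_trans lam_beyond; apply: lam_mono; exact: leq_addr.
Qed.

Let sum_beyond k : \sum_(b < k) lam (d + r + b) <= c1 * n%:R * Lam.
Proof.
apply: le_trans (middle_le (d + r + k)%N).
rewrite [leRHS](@big_cat_nat _ _ _ (d + r)) ?leq_addr //=.
have := @big_addn R 0 +%R 0 (d + r + k) (d + r) xpredT lam.
rewrite add0n addKn big_mkord => ->.
under [X in _ <= _ + X]eq_bigr do rewrite addnC.
by rewrite lerDr sumr_ge0.
Qed.

Let gram_event' s k : k%:R <= gam * n%:R -> exists2 F : set T,
  measurable F /\ (P F <= (expR (- (t + 5)))%:E)%E &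
  forall w, ~ F w -> forall v : 'I_k -> R,
    `|\sum_i (\sum_b v b * eta i (s + b) w) ^+ 2 - n%:R * sqnorm v| <=
    n%:R / 10 * sqnorm v.
Proof.
move=> kg; have := gram_event meta ind K_gt0 mgf moment2 c0_le1' s k.
rewrite -c0E => -[F [mF PF] EF]; exists F => //; split=> //.
by apply: (le_trans PF); rewrite lee_fin; exact: gram_probability.
Qed.

Let tail_event' : exists2 F : set T,
  measurable F /\ (P F <= (expR (- (t + 5)))%:E)%E &
  forall w, ~ F w -> forall k (v : 'I_n -> R),
    \sum_(b < k) lam (d + r + b) * (\sum_i v i * eta i (d + r + b) w) ^+ 2 <=
    2 * s0 * sqnorm v.
Proof.
have := tail_event meta ind K_gt0 mgf lam_ge0 theta_ge0 s0_ge0 theta_lam sum_beyond.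
rewrite -c0E => -[F [mF PF] EF]; exists F => //; split=> //.
apply: (le_trans PF); rewrite lee_fin.
apply: le_trans (tail_probability c0_gt0 c0_le1 n_large t_le).
apply: ler_wpM2l => //; rewrite ler_expR.
have -> : theta * s0 = 22 * n%:R.
  by rewrite /theta /s0; field; rewrite !lt0r_neq0.
rewrite lerD2l.
have -> : theta * (c1 * n%:R * Lam) / c0 = gam * n%:R.
  by rewrite /theta; field; rewrite !lt0r_neq0.
by rewrite ler_piMl // block_ratio_le1.
Qed.

Let cross_event' : exists2 F : set T,
  measurable F /\ (P F <= (2 * expR (- (t + 5)))%:E)%E &
  forall w, ~ F w -> forall k,
    \sum_(j < d') \sum_(d' <= b < k) lam b * (\sum_i eta i b w * eta i j w) ^+ 2 <=
    (d'%:R + (t + 5)) * (8 * n%:R * m) / c0 ^+ 2.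
Proof.
have t5 : 0 <= t + 5 by rewrite addr_ge0.
have := cross_event meta ind K_gt0 mgf lam_ge0 m_gt0 t5 n_gt0 tail_le.
rewrite -c0E => -[F [mF PF] EF]; exists F => //; split=> //.
apply: (le_trans PF); rewrite lee_fin.
have := trace_probability c0_gt0 c0_le1 n_large t_le; lra.
Qed.

(** The excess comes from the head: [risk_upper] keeps the whole tail risk, which
    is the minimal risk of rank [d'], and [head_excess] bounds the rest. *)
Let deterministic w :
  (forall v : 'I_d' -> R,
    `|\sum_i (\sum_b v b * eta i (0 + b)%N w) ^+ 2 - n%:R * sqnorm v| <=
    n%:R / 10 * sqnorm v) ->
  (forall v : 'I_r -> R,
    `|\sum_i (\sum_b v b * eta i (d + b)%N w) ^+ 2 - n%:R * sqnorm v| <=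
    n%:R / 10 * sqnorm v) ->
  (forall k (v : 'I_n -> R),
    \sum_(b < k) lam (d + r + b) * (\sum_i v i * eta i (d + r + b) w) ^+ 2 <=
    2 * s0 * sqnorm v) ->
  (forall k,
    \sum_(j < d') \sum_(d' <= b < k) lam b * (\sum_i eta i b w * eta i j w) ^+ 2 <=
    (d'%:R + (t + 5)) * (8 * n%:R * m) / c0 ^+ 2) ->
  (reconstruction_error P X (pca_projection ip d uhat w) <=
   (12 * n%:R ^- 2 * ((d'%:R + (t + 5)) * (8 * n%:R * m) / c0 ^+ 2))%:E +
   \sum_(d' <= k <oo) (lam k)%:E)%E.
Proof.
move=> E1 E2 E3 E4.
have [_ uB _] := Sigma_eigenbasis.
have [_ uhB _] := uhat_eigenbasis w.
have proj := basis_projection_orthogonal uhB d.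
apply: (le_trans (risk_upper ip_norm X_covariance lam_gt0 Sigma_eigenbasis d' proj)).
rewrite leeD2r // lee_fin big_mkord.
apply: (@head_excess _ _ _ ip_norm lam u lam_gt0 lam_mono uB n n_gt0
  (fun i => Xs i w : H) (lamhat ^~ w) (uhat ^~ w) (uhat_eigenbasis w)
  d' d r (44 * (kap * Lam) / c0) Lam) => //.
- rewrite le_eqVlt; apply/orP; left; apply/eqP.
  have -> : 110 * (44 * (kap * Lam) / c0) = c1 * (44 * 110) * Lam / (gam * c0).
    by field; rewrite !lt0r_neq0.
  rewrite size_ratio_block mulrAC mulfV ?mul1r //; apply: lt0r_neq0.
  exact: mulr_gt0.
- move=> v; have := E1 v; rewrite ler_norml => /andP[h _].
  change (9 / 10 * n%:R * sqnorm v <=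
    \sum_i (\sum_j v j * eta i (0 + j)%N w) ^+ 2); lra.
- move=> v; have := E2 v; rewrite ler_norml => /andP[_ h].
  change (\sum_i (\sum_b v b * eta i (d + b)%N w) ^+ 2 <=
    11 / 10 * n%:R * sqnorm v); lra.
- move=> k g; apply: (le_trans (E3 k g)).
  rewrite le_eqVlt; apply/orP; left; apply/eqP; rewrite /s0; field.
  by rewrite !lt0r_neq0.
Qed.

Lemma excess_risk_event : exists2 F : set T,
  measurable F /\ (P F <= (expR (- t))%:E)%E &
  forall w, ~ F w ->
  (reconstruction_error P X (pca_projection ip d uhat w) <=
   (12 * n%:R ^- 2 * ((d'%:R + (t + 5)) * (8 * n%:R * m) / c0 ^+ 2))%:E +
   \sum_(d' <= k <oo) (lam k)%:E)%E.
Proof.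
have d'_gam : d'%:R <= gam * n%:R.
  apply: (le_trans d'_le); apply: ler_wpM2r; first exact: ltW.
  exact: size_ratio_le_block.
have [F1 [mF1 PF1] EF1] := gram_event' 0 d'_gam.
have [F2 [mF2 PF2] EF2] := gram_event' d r_le.
have [F3 [mF3 PF3] EF3] := tail_event'.
have [F4 [mF4 PF4] EF4] := cross_event'.
exists ((F1 `|` F2) `|` (F3 `|` F4)).
  split; first by apply: measurableU; exact: measurableU.
  apply: (le_trans (measureU2 P (measurableU _ _ mF1 mF2) (measurableU _ _ mF3 mF4))).
  have A12 := le_trans (measureU2 P mF1 mF2) (leeD PF1 PF2).
  have A34 := le_trans (measureU2 P mF3 mF4) (leeD PF3 PF4).
  apply: (le_trans (leeD A12 A34)); rewrite -!EFinD lee_fin.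
  by have := five_expR t; lra.
move=> w wF; apply: deterministic.
- by apply: EF1 => h; apply: wF; left; left.
- by apply: EF2 => h; apply: wF; left; right.
- by apply: EF3 => h; apply: wF; right; left.
- by apply: EF4 => h; apply: wF; right; right.
Qed.

End ExcessRisk.

Theorem theorem2 (R : realType) (L : R) (L_gt0 : 0 < L) :
  exists c1 c2 C1 : R, [/\ 0 < c1, 0 < c2, 0 < C1 &
  forall (dT : measure_display) (T : measurableType dT) (P : probability T R)
    (H : completeNormedModType R) (ip : {dot H for idfun})
    (ip_norm : forall x : H, ip x x = `|x| ^+ 2)
    (X : {RV P >-> borel H}) (Sigma : H -> H) (lam : nat -> R) (u : nat -> H)
    (X_square_integrable : ('E_P[fun w => (`|(X w : H)| ^+ 2)%R] < +oo)%E)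
    (X_centered : is_expectation P ip X 0)
    (X_covariance : is_covariance P ip X Sigma)
    (lam_gt0 : forall j, 0 < lam j)
    (Sigma_eigenbasis : eigenbasis ip Sigma lam u)
    (KL_independent : mutually_independent P (KL_coefficient ip X lam u))
    (KL_subgaussian :
      (ereal_sup (range (fun j => psi2_norm P (KL_coefficient ip X lam u j)))
         <= L%:E)%E)
    (n : nat) (n_gt0 : (0 < n)%N) (Xs : 'I_n -> {RV P >-> borel H})
    (Xs_independent : mutually_independent P (Xs : 'I_n -> T -> borel H))
    (Xs_copies : forall i, same_law P (Xs i : T -> borel H) X)
    (lamhat : nat -> T -> R) (uhat : nat -> T -> H)
    (lamhat_ge0 : forall j w, 0 <= lamhat j w)
    (uhat_eigenbasis : forall w,
      eigenbasis ip (sample_covariance ip Xs w) (lamhat ^~ w) (uhat ^~ w))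
    (d' d : nat) (d'_gt0 : (1 <= d')%N) (d'_le_d : (d' <= d)%N)
    (risk_measurable : measurable_fun setT (fun w =>
      reconstruction_error P X (pca_projection ip d uhat w) : \bar R))
    (lam_gap : 2 * lam d <= lam d'.-1)
    (n_large :
      (maxe d'%:R%:E ((lam d'.-1)^-1%:E * \sum_(d <= k <oo) (lam k)%:E)
         <= (c1 * n%:R)%:E)%E),
  exists2 m : \bar R,
    is_minimum (reconstruction_error P X @` projections ip d') m &
    (forall t : R, 1 <= t <= c2 * n%:R ->
      ((1 - expR (- t))%:E <=
       P [set w | reconstruction_error P X (pca_projection ip d uhat w) <=
                  (1 + C1 * (d'%:R / n%:R + t / n%:R))%:E * m])%E) /\
    ((1 - expR (- (c2 * n%:R)))%:E <=
     P [set w | reconstruction_error P X (pca_projection ip d uhat w) <=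
                (1 + C1 * (c1 + c2))%:E * m])%E].
Proof.

have e1_gt0 : 0 < expR 1 :> R by exact: expR_gt0.
(* The rate demanded by [expectation_exp_sqr], kept below 1 by the summand 1. *)
have [a [a_gt0 a_le1 aL]] : exists a : R,
    [/\ 0 < a, a <= 1 & 4 * (a * L ^+ 2) * expR 1 <= 1].
  have D_ge1 : 1 <= 1 + 4 * L ^+ 2 * expR 1.
    by rewrite lerDl; apply: mulr_ge0; [apply: mulr_ge0; [|exact: sqr_ge0]|exact: ltW].
  have D_gt0 : 0 < 1 + 4 * L ^+ 2 * expR 1 by lra.
  exists (1 + 4 * L ^+ 2 * expR 1)^-1; split.
  - by rewrite invr_gt0.
  - by rewrite invf_le1.
  - rewrite (_ : _ * expR 1 = (4 * L ^+ 2 * expR 1) / (1 + 4 * L ^+ 2 * expR 1)).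
      by rewrite ler_pdivrMr // mul1r lerDr.
    by ring.
have [c0 c0E] : exists c0 : R, c0 = 3 / (16 * (2 / a)) by exists (3 / (16 * (2 / a))).
have c0a : c0 = 3 / 32 * a by rewrite c0E; field; rewrite gt_eqF.
have c0_gt0 : 0 < c0 by rewrite c0a mulr_gt0.
have c0_le1 : c0 <= 1 by rewrite c0a; lra.
have c1_gt0 := size_ratio_gt0 c0_gt0.
have c2_gt0 := deviation_ratio_gt0 c0_gt0.
have c1_le_c2 := size_ratio_le_deviation c0_gt0 c0_le1.
have C1_gt0 : 0 < 576 / c0 ^+ 2.
  by apply: divr_gt0; [rewrite ltr0n|exact: exprn_gt0].
exists (size_ratio c0), (deviation_ratio c0), (576 / c0 ^+ 2); split => //.
move=> dT T P H ip ip_norm X Sigma lam u X_square_integrable X_centered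
  X_covariance lam_gt0 Sigma_eigenbasis KL_independent KL_subgaussian n n_gt0 Xs
  Xs_independent Xs_copies lamhat uhat lamhat_ge0 uhat_eigenbasis d' d d'_gt0
  d'_le_d risk_measurable lam_gap n_large.
have nR : 0 < n%:R :> R by rewrite ltr0n.
have [lam_mono uB uE] := Sigma_eigenbasis.
have Mfin := eigenvalues_summable ip_norm X_covariance lam_gt0 Sigma_eigenbasis
  X_square_integrable.
pose Mval := (\sum_(d' <= k <oo) (lam k)%:E)%E.
have Mval_fin : Mval \is a fin_num.
  rewrite ge0_fin_numE; last by apply: nneseries_ge0 => k _ _; rewrite lee_fin ltW.
  apply: le_lt_trans Mfin; rewrite [leRHS](nneseries_split 0 d'); last first.
    by move=> k _; rewrite lee_fin ltW.
  by rewrite add0n leeDr // sumEFin lee_fin sumr_ge0 // => k _; rewrite ltW.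
have [m mE] : exists m, Mval = m%:E by exists (fine Mval); rewrite fineK.
have m_partial k : \sum_(d' <= b < k) lam b <= m.
  by rewrite -lee_fin -mE; apply: eseries_ge_partial => j; exact: ltW.
have m_gt0 : 0 < m.
  by apply: lt_le_trans (m_partial d'.+1); rewrite big_nat1; exact: lam_gt0.
exists Mval; first exact: (risk_minimum ip_norm X_covariance lam_gt0 Sigma_eigenbasis).
have Lam_gt0 := lam_gt0 d'.-1.
have [d'_le tail_le] : d'%:R <= size_ratio c0 * n%:R /\
    forall k, \sum_(d <= b < k) lam b <= size_ratio c0 * n%:R * lam d'.-1.
  move: n_large; rewrite ge_max => /andP[h1 h2]; split.
    by rewrite -lee_fin.
  move=> k; rewrite -ler_pdivrMr // mulrC -lee_fin.
  apply: le_trans h2; rewrite EFinM; apply: lee_wpmul2l.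
    by rewrite lee_fin invr_ge0 ltW.
  by apply: eseries_ge_partial => j; exact: ltW.
have n_large1 : 1 <= size_ratio c0 * n%:R.
  by apply: le_trans d'_le; rewrite ler1n.
have Lam_le j : (j < d')%N -> lam d'.-1 <= lam j.
  by move=> jd; apply: lam_mono; rewrite -ltnS prednK.
have nRN0 : n%:R != 0 :> R by exact: lt0r_neq0.
have c0N0 : c0 != 0 by exact: lt0r_neq0.
have event t (B : R) : 1 <= t -> t <= deviation_ratio c0 * n%:R ->
    1 + 576 / c0 ^+ 2 * (d'%:R / n%:R + t / n%:R) <= B ->
    ((1 - expR (- t))%:E <=
     P [set w | reconstruction_error P X (pca_projection ip d uhat w) <=
                B%:E * Mval])%E.
  move=> t1 tc hB.
  have t0 : 0 <= t by lra.
  have [F [mF PF] EF] := excess_risk_event L_gt0 a_gt0 aL c0E c0_le1 ip_norm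
    X_centered X_covariance lam_gt0 Sigma_eigenbasis KL_independent KL_subgaussian
    n_gt0 Xs_independent Xs_copies uhat_eigenbasis m_gt0 Lam_gt0 lam_gap Lam_le
    d'_le n_large1 tail_le m_partial t0 tc.
  have PFC : (1 - (expR (- t))%:E <= P (~` F))%E.
    by rewrite probability_setC // leeB.
  rewrite EFinB; apply: (le_trans PFC); apply: le_measure; rewrite ?inE.
  - exact: measurableC.
  - rewrite -[X in measurable X]setTI.
    exact: (emeasurable_fun_infty_c measurableT risk_measurable).
  - move=> w wF; apply: (le_trans (EF w wF)).
    rewrite -/Mval mE -EFinM -EFinD lee_fin.
    apply: le_trans (ler_wpM2r (ltW m_gt0) hB).
    (* [12 * 8 = 96], and [d' + t + 5 <= 6 (d' + t)] as [t >= 1]. *)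
    have -> : 12 * n%:R ^- 2 * ((d'%:R + (t + 5)) * (8 * n%:R * m) / c0 ^+ 2) =
        96 * (d'%:R + (t + 5)) * (m / (n%:R * c0 ^+ 2)).
      by field; rewrite nRN0 c0N0.
    have -> : (1 + 576 / c0 ^+ 2 * (d'%:R / n%:R + t / n%:R)) * m =
        576 * (d'%:R + t) * (m / (n%:R * c0 ^+ 2)) + m.
      by field; rewrite nRN0 c0N0.
    rewrite lerD2r; apply: ler_wpM2r.
      by rewrite divr_ge0 ?(ltW m_gt0) // mulr_ge0 // exprn_ge0 // ltW.
    by have := ler0n R d'; lra.
split.
  by move=> t /andP[t1 tc]; apply: event.
apply: event => //.
  by apply: (le_trans n_large1); apply: ler_wpM2r.
rewrite lerD2l; apply: ler_wpM2l; first exact: ltW.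
by rewrite mulfK // lerD2r ler_pdivrMr.
Qed.
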